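(* Let $p_1, p_2, \gamma_1, \gamma_2$ be non-zero constants with $\gamma_1 \neq \gamma_2$. Let $$Q(z,f)=\sum_{j=0}^{k} a_j f^{(j)}$$ be a linear differential polynomial in $f$, where the coefficients $a_j$ $(j=0,1,\dots,k)$ are constants (hence small functions of $f$). If $f$ is a transcendental entire solution of the differential equation $$f^2(z)f'(z)+Q(z,f)=p_1e^{\gamma_1 z}+p_2e^{\gamma_2 z},$$ then the order of $f$ is $\rho(f)=1$, and one of the following holds: (i) $2T(r,f)\leq 3N\left(r,\frac{1}{f}\right)+S(r,f)$; (ii) $f(z)=c_1e^{\gamma_1 z/3}$, where $c_1=\left(\frac{3p_1}{\gamma_1}\right)^{1/3}$ is a constant, $p_2=c_1\sum_{j=0}^{k}a_j\left(\frac{\gamma_1}{3}\right)^j$, and $\frac{\gamma_1}{\gamma_2}=3$; (iii) $f(z)=c_2e^{\gamma_2 z/3}$, where $c_2=\left(\frac{3p_2}{\gamma_2}\right)^{1/3}$ is a constant, $p_1=c_2\sum_{j=0}^{k}a_j\left(\frac{\gamma_2}{3}\right)^j$, and $\frac{\gamma_2}{\gamma_1}=3$.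
   Context: Standard Nevanlinna theory notation is used: $T(r,f)$ is the Nevanlinna characteristic and $N(r,1/f)$ is the integrated counting function of zeros of $f$ (with multiplicity). The order is $\rho(f)=\limsup_{r\to\infty}\frac{\log T(r,f)}{\log r}$. $S(r,f)$ denotes any quantity satisfying $S(r,f)=o(T(r,f))$ as $r\to\infty$ outside a possible exceptional set of finite linear measure (not necessarily the same at each occurrence). A meromorphic function $g$ is a small function of $f$ if $T(r,g)=S(r,f)$. The cube roots $(3p_i/\gamma_i)^{1/3}$ denote some cube root. *)

(* Defs.v *)
From HB Require Import structures.
From mathcomp Require Import all_boot all_order all_algebra.
From mathcomp Require Import complex.
From mathcomp Require Import all_classical all_reals all_analysis.
Import Order.TTheory GRing.Theory Num.Theory numFieldNormedType.Exports.

Set Implicit Arguments.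
Unset Strict Implicit.
Unset Printing Implicit Defensive.

Local Open Scope complex_scope.
Local Open Scope ring_scope.
Local Open Scope classical_set_scope.

(* R[i] as a normed space over itself. *)
HB.instance Definition _ (R : rcfType) := NormedModule.copy R[i] R[i]^o.

Section ComplexFunctions.
Context {R : realType}.
Implicit Types (f : R[i] -> R[i]) (z a : R[i]).

(* The norm `|z| of R[i] takes values in R[i]. *)
Definition cmod z : R := complex.Re `|z|.

Definition cis (t : R) : R[i] := cos t +i* sin t.

Definition cexp z : R[i] := (expR (complex.Re z))%:C * cis (complex.Im z).

Definition entire f := forall z, derivable f z 1.

Definition transcendental_entire f :=
  entire f /\ ~ exists p : {poly R[i]}, forall z, f z = p.[z].

Definition lin_diff_poly (k : nat) (c : 'I_k.+1 -> R[i]) f z : R[i] :=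
  \sum_(j < k.+1) c j * f^`(j)%classic z.

(* The least element of P, and 0 when P is empty. *)
Definition least (P : set nat) : nat :=
  xget 0%N [set n | P n /\ forall m, P m -> (n <= m)%N].

Definition zero_order f a : nat := least [set n | f^`(n)%classic a != 0].

(* By Riemann's theorem on removable singularities, this is the multiplicity
   of the pole at a of a meromorphic f (0 if f is holomorphic near a); the
   value of f at a plays no role. *)
Definition pole_order f a : nat :=
  least [set n | exists M : R,
                   \forall z \near a^', cmod ((z - a) ^+ n * f z) <= M].

End ComplexFunctions.

Section Nevanlinna.
Context {R : realType}.
Implicit Types (f : R[i] -> R[i]) (ord : R[i] -> nat) (r t : R).

(* n(t): number of points of the closed disc of radius t, counted with the
   multiplicities ord; the sum is the finitely supported one. *)
Definition unint_count ord t : nat := \sum_(z \in [set z | cmod z <= t]) ord z.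

(* int_0^r (n(t) - n(0)) / t dt + n(0) log r *)
Definition int_count ord r : R :=
  (\int[lebesgue_measure]_(t in `]0, r])
     (((unint_count ord t)%:R - (unint_count ord 0)%:R) / t))
  + (unint_count ord 0)%:R * ln r.

Definition N_poles r f : R := int_count (pole_order f) r.

(* N(r, 1/f) *)
Definition N_zeros r f : R := int_count (zero_order f) r.

(* Since ln 0 = 0, this is 0 at 0, as the usual log^+. *)
Definition lnp (x : R) : R := Num.max 0 (ln x).

Definition proximity r f : R :=
  (2 * pi)^-1 *
  \int[lebesgue_measure]_(t in `[0, 2 * pi]) lnp (cmod (f (r%:C * cis t))).

Definition characteristic r f : R := proximity r f + N_poles r f.

Definition growth_order f : \bar R :=
  limf_esup (fun r => (ln (characteristic r f) / ln r)%:E) +oo%R.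

(* S is an S(r, f): o(T(r, f)) as r tends to +oo outside a set E of finite
   linear measure. *)
Definition small_error (S : R -> R) f :=
  exists E : set R,
    [/\ measurable E, (lebesgue_measure E < +oo)%E &
        forall e : R, 0 < e ->
          \forall r \near +oo, ~ E r -> `|S r| <= e * characteristic r f].

End Nevanlinna.

(* Main.v *)
(* Write P = f^2 f', so that P + Q(z, f) = p1 e^(g1 z) + p2 e^(g2 z).  Since P is
   cubic in f and Q is linear, integrating P = (f^3)'/3 bounds |f|^3 on a disc
   linearly by |f| on a slightly larger disc (Cauchy's estimates for Q), and
   iterating this gives |f| <= e^(B(|z|+1)).  Conversely the logarithmic
   derivative lemma gives m(r, P + Q) <= 4 T(r, f) + O(log r), while the
   exponential sum is large on a fixed sector, so T(r, f) >= c r and the order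
   is 1.

   Apply (D - g1)(D - g2) to the equation, D = d/dz: H := (D - g1)(D - g2) P
   equals minus a linear differential polynomial in f.  If H does not vanish
   identically, both H/f and H/f^3 have proximity function O(log r), and
   2 log^+ |f| <= log^+ |H/f| + log^+ |H/f^3| - log |H| + 3 log |f|;
   averaging over the circle and Jensen's formula for H and f give (i).  If
   H = 0, then f^3 = alpha e^(g1 z) + beta e^(g2 z) + C.  Multiplicities of the
   zeros of f^3 force C = 0 when one of alpha, beta vanishes, which leads to (ii)
   and (iii).  When neither vanishes they force f to be zero-free, hence a single
   exponential, contradicting the linear independence of exponentials.

   Jensen's formula and the logarithmic derivative lemma are proved for
   functions of exponential type from the factorisation of f by its zeros in a
   disc; they hold for all radii with no zeros on the circle, so the exceptional
   set is countable. *)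
Require Import Defs.
From HB Require Import structures.
From mathcomp Require Import all_boot all_order all_algebra.
From mathcomp Require Import complex.
From mathcomp Require Import all_classical all_reals all_analysis.
From mathcomp Require Import ring lra.
Import Order.TTheory GRing.Theory Num.Theory numFieldNormedType.Exports.

Local Open Scope complex_scope.
Local Open Scope ring_scope.
Local Open Scope classical_set_scope.

Set Implicit Arguments.
Unset Strict Implicit.
Unset Printing Implicit Defensive.

(** * Complex numbers and complex derivatives *)

Section Modulus.
Context {R : realType}.
Implicit Types (z w h d : R[i]) (x e t : R).

(** The growth bound has to precede all value distribution theory. Once f is of exponential type, a
    disc of radius 3r contains O(r) zeros, logarithmic derivatives contribute O(log r), and at
    generic radii T(r, f) lies between two multiples of r. Hence every quantity that is O(log r) off
    a countable set of radii is an S(r, f). The iteration behind the growth bound runs backwards. A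
    point where f is too large forces, in a slightly larger disc, a point where f exceeds the square
    of the previous lower bound; all these discs stay inside a fixed one, where f is bounded.
    Cauchy's theory is organised around circles. Goursat's theorem for a rectangle, carried to an
    annulus by the exponential, makes the integral over a circle independent of its radius. Mean
    values, the formula for f', Cauchy's estimates and the Borel-Caratheodory inequality all
    evaluate at the centre of the circle; estimates elsewhere come from moving the centre. *)

Lemma normC_cmod z : `|z| = (cmod z)%:C.
Proof. by rewrite /cmod normc_def. Qed.

Lemma cmodE z : cmod z = Num.sqrt (complex.Re z ^+ 2 + complex.Im z ^+ 2).
Proof. by rewrite /cmod normc_def. Qed.

Lemma cmod_ge0 z : 0 <= cmod z.
Proof. by rewrite cmodE sqrtr_ge0. Qed.

Lemma cmod0 : cmod 0 = 0 :> R.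
Proof. by rewrite /cmod normr0. Qed.

Lemma cmod1 : cmod 1 = 1 :> R.
Proof. by rewrite /cmod normr1. Qed.

Lemma cmod_eq0 z : (cmod z == 0) = (z == 0).
Proof. by rewrite -(normr_eq0 z) normC_cmod eq_complex /= eqxx andbT. Qed.

Lemma cmod_gt0 z : (0 < cmod z) = (z != 0).
Proof. by rewrite lt_neqAle cmod_ge0 andbT eq_sym cmod_eq0. Qed.

Lemma cmodM z w : cmod (z * w) = cmod z * cmod w.
Proof. by apply: complexI; rewrite rmorphM /= -!normC_cmod normrM. Qed.

Lemma cmodV z : cmod z^-1 = (cmod z)^-1.
Proof. by apply: complexI; rewrite fmorphV /= -!normC_cmod normfV. Qed.

Lemma cmodX z n : cmod (z ^+ n) = cmod z ^+ n.
Proof. by elim: n => [|n ih]; rewrite ?expr0 ?cmod1 // !exprS cmodM ih. Qed.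

Lemma cmodN z : cmod (- z) = cmod z.
Proof. by rewrite /cmod normrN. Qed.

Lemma cmodBC z w : cmod (z - w) = cmod (w - z).
Proof. by rewrite /cmod distrC. Qed.

Lemma cmodD z w : cmod (z + w) <= cmod z + cmod w.
Proof. by rewrite -lecR rmorphD /= -!normC_cmod ler_normD. Qed.

Lemma cmodB z w : cmod (z - w) <= cmod z + cmod w.
Proof. by rewrite (le_trans (cmodD _ _))// cmodN. Qed.

Lemma cmod_subl z w : cmod z - cmod w <= cmod (z - w).
Proof. by rewrite lerBlDr -{1}(subrK w z) cmodD. Qed.

Lemma cmod_real x : cmod x%:C = `|x|.
Proof. by rewrite cmodE /= expr0n addr0 sqrtr_sqr. Qed.

Lemma cmod_nat n : cmod n%:R = n%:R :> R.
Proof. by rewrite -(rmorph_nat (real_complex R)) cmod_real ger0_norm. Qed.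

Lemma cmod_sum (I : Type) (r : seq I) (P : pred I) (F : I -> R[i]) :
  cmod (\sum_(i <- r | P i) F i) <= \sum_(i <- r | P i) cmod (F i).
Proof.
elim/big_ind2: _ => [|a b c d ab cd|//]; first by rewrite cmod0.
by rewrite (le_trans (cmodD _ _)) ?lerD.
Qed.

Lemma cmod_prod (I : Type) (r : seq I) (F : I -> R[i]) :
  cmod (\prod_(i <- r) F i) = \prod_(i <- r) cmod (F i).
Proof. by elim/big_ind2: _ => [|a b c d <- <-|//]; rewrite ?cmod1 ?cmodM. Qed.

Lemma Re_le_cmod z : `|complex.Re z| <= cmod z.
Proof. by rewrite cmodE -sqrtr_sqr ler_wsqrtr// lerDl sqr_ge0. Qed.

Lemma Im_le_cmod z : `|complex.Im z| <= cmod z.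
Proof. by rewrite cmodE -sqrtr_sqr ler_wsqrtr// lerDr sqr_ge0. Qed.

Lemma Re_le z : complex.Re z <= cmod z.
Proof. exact: le_trans (ler_norm _) (Re_le_cmod z). Qed.

Lemma sqr_cmod z : cmod z ^+ 2 = complex.Re z ^+ 2 + complex.Im z ^+ 2.
Proof. by rewrite cmodE sqr_sqrtr// addr_ge0 ?sqr_ge0. Qed.

Lemma cmod_le_ReIm z : cmod z <= `|complex.Re z| + `|complex.Im z|.
Proof.
rewrite -ler_sqr ?nnegrE ?cmod_ge0 ?addr_ge0// sqr_cmod sqrrD -!normrX.
by rewrite !(ger0_norm (sqr_ge0 _)) -addrA lerD2l lerDr mulrn_wge0// mulr_ge0.
Qed.

Lemma ReD z w : complex.Re (z + w) = complex.Re z + complex.Re w.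
Proof. by case: z w => [a b] [c d]. Qed.

Lemma ImD z w : complex.Im (z + w) = complex.Im z + complex.Im w.
Proof. by case: z w => [a b] [c d]. Qed.

Lemma ReN z : complex.Re (- z) = - complex.Re z.
Proof. by case: z. Qed.

Lemma ImN z : complex.Im (- z) = - complex.Im z.
Proof. by case: z. Qed.

Lemma ReM z w : complex.Re (z * w) =
  complex.Re z * complex.Re w - complex.Im z * complex.Im w.
Proof. by case: z w => [a b] [c d]. Qed.

Lemma ImM z w : complex.Im (z * w) =
  complex.Re z * complex.Im w + complex.Im z * complex.Re w.
Proof. by case: z w => [a b] [c d]. Qed.

Lemma eqC z w : complex.Re z = complex.Re w -> complex.Im z = complex.Im w -> z = w.
Proof. by case: z w => [a b] [c d] /= -> ->. Qed.

Lemma cmodJ z : cmod z^* = cmod z.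
Proof. by case: z => a b; rewrite !cmodE /= sqrrN. Qed.

Lemma mulCJ z : z * z^* = (cmod z ^+ 2)%:C.
Proof.
by apply: eqC; case: z => a b; rewrite ?sqr_cmod /= ?mulrN ?opprK ?expr2// mulrC addNr.
Qed.

Lemma cis0 : cis 0 = 1 :> R[i].
Proof. by rewrite /cis cos0 sin0. Qed.

Lemma cisD x t : cis (x + t) = cis x * cis t.
Proof. by apply: eqC; rewrite ?ReM ?ImM /= ?cosD ?sinD//; ring. Qed.

Lemma cmod_cis t : cmod (cis t) = 1.
Proof. by rewrite cmodE /= cos2Dsin2 sqrtr1. Qed.

Lemma cis_neq0 t : cis t != 0.
Proof. by rewrite -cmod_eq0 cmod_cis oner_eq0. Qed.

Lemma cisN t : cis (- t) = (cis t)^-1.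
Proof.
apply: (mulfI (cis_neq0 t)); rewrite divff ?cis_neq0//.
by rewrite -cisD subrr cis0.
Qed.

Lemma conj_cis t : (cis t)^* = cis (- t).
Proof. by apply: eqC => /=; rewrite ?cosN ?sinN. Qed.

Lemma cis2pi : cis (2 * pi) = 1 :> R[i].
Proof. by rewrite /cis mulr_natl cos2pi sin2pi. Qed.

Lemma cmod_cexp z : cmod (cexp z) = expR (complex.Re z).
Proof. by rewrite cmodM cmod_cis mulr1 cmod_real ger0_norm ?expR_ge0. Qed.

Lemma cexp_neq0 z : cexp z != 0.
Proof. by rewrite -cmod_eq0 cmod_cexp expR_eq0. Qed.

Lemma cexpD z w : cexp (z + w) = cexp z * cexp w.
Proof. by rewrite /cexp ReD ImD expRD cisD rmorphM /=; ring. Qed.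

Lemma cexp0 : cexp 0 = 1 :> R[i].
Proof. by rewrite /cexp /= expR0 cis0 mulr1. Qed.

Lemma cexpN z : cexp (- z) = (cexp z)^-1.
Proof.
apply: (mulfI (cexp_neq0 z)); rewrite divff ?cexp_neq0//.
by rewrite -cexpD subrr cexp0.
Qed.

Lemma cexp_real_imag x t : cexp (x +i* t) = (expR x)%:C * cis t.
Proof. by []. Qed.

Lemma cexpX z n : cexp z ^+ n = cexp (n%:R * z).
Proof.
elim: n => [|n ih]; first by rewrite expr0 mul0r cexp0.
by rewrite exprS ih -cexpD -natr1; congr cexp; ring.
Qed.

Lemma polar z : exists2 t, 0 <= t < 2 * pi & z = (cmod z)%:C * cis t.
Proof.
have [->|z0] := eqVneq z 0.
  by exists 0; rewrite ?cmod0 ?mul0r// lexx mulr_gt0// pi_gt0.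
have m0 : 0 < cmod z by rewrite cmod_gt0.
pose c := complex.Re z / cmod z; pose s := complex.Im z / cmod z.
have cs1 : c ^+ 2 + s ^+ 2 = 1.
  by rewrite !exprMn -mulrDl -sqr_cmod exprVn divff// expf_neq0// gt_eqF.
have c1 : -1 <= c <= 1.
  rewrite -ler_norml -(@expr_le1 _ 2)// real_normK ?num_real//.
  by rewrite -cs1 lerDl sqr_ge0.
have zE t : cos t = c -> sin t = s -> z = (cmod z)%:C * cis t.
  move=> ct st; apply: eqC; rewrite ?ReM ?ImM /= ?ct ?st ?mul0r ?subr0 ?addr0.
  - by rewrite mulrC divfK// gt_eqF.
  - by rewrite mulrC divfK// gt_eqF.
have p0 : 0 < pi :> R by exact: pi_gt0.
have ac0 := acos_ge0 c1; have acp := acos_lepi c1.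
have ss : Num.sqrt (1 - c ^+ 2) = `|s| by rewrite -cs1 addrAC subrr add0r sqrtr_sqr.
have [s0|s0] := leP 0 s.
  exists (acos c); first by rewrite ac0/=; lra.
  by apply: zE; rewrite ?acosK// ?sin_acos// ss ger0_norm.
(* Lower half-plane: the angle is reflected. It stays below [2 * pi] because [acos c] vanishes only
   for [c = 1], which [s < 0] and [cs1] exclude. *)
exists (2 * pi - acos c); last first.
  apply: zE; rewrite mulr_natl ?cosB ?sinB cos2pi sin2pi acosK ?sin_acos//; first ring.
  by rewrite ss ltr0_norm//; ring.
have : 0 < acos c.
  apply: acos_gt0; case/andP: c1 => -> /= ; rewrite le_eqVlt => /orP[/eqP c1|//].
  by move: cs1; rewrite c1 expr1n => ?; nra.
by move=> a0; apply/andP; split; lra.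
Qed.

Lemma cexp_surj z : z != 0 -> exists w, cexp w = z.
Proof.
move=> z0; have [t _ zE] := polar z.
exists (ln (cmod z) +i* t); rewrite cexp_real_imag lnK// posrE cmod_gt0//.
Qed.

End Modulus.

(** * Derivatives along complex and real variables *)

Section ComplexDerivative.
Context {R : realType}.
Implicit Types (f g : R[i] -> R[i]) (z w h d : R[i]) (x e t : R).

(** Unfolds the limit of difference quotients into a first-order expansion with real tolerances;
    clearing the denominator also covers [h = 0]. The chain rules below start from this form. *)
Lemma is_deriveP f z d : is_derive z (1 : R[i]) f d <->
  forall e : R, 0 < e -> exists2 t : R, 0 < t &
    forall h, cmod h < t -> cmod (f (z + h) - f z - d * h) <= e * cmod h.
Proof.
split=> [[df dE] e e0|H].
  have : h^-1 *: ((f \o shift z) (h *: (1 : R[i])) - f z) @[h --> 0^'] --> d.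
    by rewrite -dE; exact: df.
  move=> /cvgrPdist_le /(_ e%:C); rewrite -(rmorph0 (real_complex R)) ltcR.
  move=> /(_ e0); rewrite /dnbhs /within /= => /nbhs_ballP [/= r r0 Hr].
  have rE : r = (complex.Re r)%:C by rewrite RRe_real// gtr0_real.
  exists (complex.Re r); first by rewrite -ltcR -rE.
  move=> h hr; have [->|h0] := eqVneq h 0.
    by rewrite addr0 subrr mulr0 subr0 cmod0 mulr0.
  have /= := Hr h; rewrite -ball_normE /= sub0r normrN normC_cmod rE ltcR.
  move=> /(_ hr h0); rewrite normC_cmod lecR => H.
  have -> : f (z + h) - f z - d * h =
      - ((d - h^-1 * (f (h * 1 + z) - f z)) * h).
    by rewrite mulr1 (addrC h z) mulrBl mulrAC mulVf// mul1r opprB.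
  by rewrite cmodN cmodM ler_wpM2r// cmod_ge0.
have : h^-1 *: ((f \o shift z) (h *: (1 : R[i])) - f z) @[h --> 0^'] --> d.
  apply/cvgrPdist_le => /= e e0.
  have eE : e = (complex.Re e)%:C by rewrite RRe_real// gtr0_real.
  have [|t t0 Ht] := H (complex.Re e); first by rewrite -ltcR -eE.
  rewrite /dnbhs /within /=; apply/nbhs_ballP; exists t%:C => /=.
    by rewrite ltcR.
  move=> h; rewrite -ball_normE /= sub0r normrN normC_cmod ltcR => ht h0.
  rewrite normC_cmod eE lecR.
  have -> : d - h^-1 *: (f (h *: 1 + z) - f z) = - ((f (z + h) - f z - d * h) * h^-1).
    rewrite /GRing.scale /= mulr1 (addrC h z) mulrBl mulfK// opprB; congr (_ - _).
    by rewrite mulrC.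
  rewrite cmodN cmodM cmodV ler_pdivrMr ?cmod_gt0//; exact: Ht.
move=> c; split; first by apply/cvg_ex; exists d.
exact/cvg_lim.
Qed.

Lemma derive1P f z : derivable f z 1 -> is_derive z (1 : R[i]) f (f^`() z).
Proof. by rewrite derive1E; exact: derivableP. Qed.

Lemma is_derive_derive1 f z d : is_derive z (1 : R[i]) f d -> f^`() z = d.
Proof. by rewrite derive1E => -[]. Qed.

(** Derivative of a path in the plane with respect to a real parameter, stated as a first-order
    expansion in the shape of [is_deriveP] so that both share one chain rule. *)
Definition pderive (u : R -> R[i]) (x : R) (d : R[i]) :=
  forall e : R, 0 < e -> exists2 t : R, 0 < t &
    forall h : R, `|h| < t -> cmod (u (x + h) - u x - d * h%:C) <= e * `|h|.

Lemma is_derive_realP (u : R -> R) x (d : R) : is_derive x (1 : R) u d <->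
  forall e : R, 0 < e -> exists2 t : R, 0 < t &
    forall h : R, `|h| < t -> `|u (x + h) - u x - d * h| <= e * `|h|.
Proof.
split=> [[df dE] e e0|H].
  have : h^-1 *: ((u \o shift x) (h *: (1 : R)) - u x) @[h --> 0^'] --> d.
    by rewrite -dE; exact: df.
  move=> /cvgrPdist_le /(_ e e0); rewrite /dnbhs /within /= => /nbhs_ballP [/= r r0 Hr].
  exists r => // h hr; have [->|h0] := eqVneq h 0.
    by rewrite addr0 subrr mulr0 subr0 normr0 mulr0.
  have /= := Hr h; rewrite -ball_normE /= sub0r normrN => /(_ hr h0) {}H.
  have -> : u (x + h) - u x - d * h = - ((d - h^-1 * (u (h * 1 + x) - u x)) * h).
    by rewrite mulr1 (addrC h x) mulrBl mulrAC mulVf// mul1r opprB.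
  by rewrite normrN normrM ler_wpM2r.
have : h^-1 *: ((u \o shift x) (h *: (1 : R)) - u x) @[h --> 0^'] --> d.
  apply/cvgrPdist_le => /= e e0; have [t t0 Ht] := H e e0.
  rewrite /dnbhs /within /=; apply/nbhs_ballP; exists t => //=.
  move=> h; rewrite -ball_normE /= sub0r normrN => ht h0.
  have -> : d - h^-1 *: (u (h *: 1 + x) - u x) = - ((u (x + h) - u x - d * h) * h^-1).
    rewrite /GRing.scale /= mulr1 (addrC h x) mulrBl mulfK// opprB; congr (_ - _).
    by rewrite mulrC.
  rewrite normrN normrM normfV ler_pdivrMr ?normr_gt0//; exact: Ht.
move=> c; split; first by apply/cvg_ex; exists d.
exact/cvg_lim.
Qed.

Lemma pderiveP (u : R -> R[i]) x d : pderive u x d <->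
  is_derive x (1 : R) (fun t => complex.Re (u t)) (complex.Re d) /\
  is_derive x (1 : R) (fun t => complex.Im (u t)) (complex.Im d).
Proof.
split=> [H|[/is_derive_realP H1 /is_derive_realP H2] e e0].
  split; apply/is_derive_realP => e e0; have [t t0 Ht] := H e e0; exists t => // h ht.
    have := le_trans (Re_le_cmod _) (Ht h ht).
    by rewrite !ReD !ReN ReM /= mulr0 subr0.
  have := le_trans (Im_le_cmod _) (Ht h ht).
  by rewrite !ImD !ImN ImM /= mulr0 add0r.
have [|t1 t10 Ht1] := H1 (e / 2); first by rewrite divr_gt0.
have [|t2 t20 Ht2] := H2 (e / 2); first by rewrite divr_gt0.
exists (Num.min t1 t2); first by rewrite lt_min t10.
move=> h; rewrite lt_min => /andP[h1 h2]; apply: le_trans (cmod_le_ReIm _) _.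
rewrite !ReD !ReN ReM !ImD !ImN ImM /= !mulr0 subr0 add0r.
by have := Ht1 h h1; have := Ht2 h h2; lra.
Qed.

Lemma is_derive_cts f z d : is_derive z (1 : R[i]) f d ->
  forall e : R, 0 < e -> exists2 t : R, 0 < t &
    forall h, cmod h < t -> cmod (f (z + h) - f z) < e.
Proof.
move=> /is_deriveP /(_ 1 ltr01) [t t0 Ht] e e0.
pose m := cmod d + 1; have m0 : 0 < m by rewrite ltr_wpDl ?cmod_ge0.
exists (Num.min t (e / (m + m))); first by rewrite lt_min t0 divr_gt0// addr_gt0//.
move=> h; rewrite lt_min => /andP[/Ht h1 h2].
have : cmod (f (z + h) - f z) <= cmod (f (z + h) - f z - d * h) + cmod (d * h).
  by rewrite -{1}(subrK (d * h) (f (z + h) - f z)) cmodD.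
move=> /le_lt_trans; apply; rewrite cmodM.
move: h2; rewrite (ltr_pdivlMr _ _ (addr_gt0 m0 m0)) => h2.
have := cmod_ge0 h; rewrite /m in m0 h2 *; nra.
Qed.

(* [T] is [R] or [R[i]], so that this covers both chain rules *)
Lemma chain_estimate (T : Type) (n : T -> R) (i : T -> R[i]) (k : T -> R[i]) f w d d' :
  (forall h : T, cmod (i h) = n h) -> is_derive w (1 : R[i]) f d ->
  (forall e : R, 0 < e -> exists2 t : R, 0 < t &
    forall h : T, n h < t -> cmod (k h - d' * i h) <= e * n h) ->
  forall e : R, 0 < e -> exists2 t : R, 0 < t &
    forall h : T, n h < t -> cmod (f (w + k h) - f w - d * d' * i h) <= e * n h.
Proof.
move=> ni /is_deriveP Hf Hu e e0.
pose m := cmod d + cmod d' + 1.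
have m0 : 0 < m by rewrite ltr_wpDl ?addr_ge0 ?cmod_ge0.
pose e' := Num.min 1 (e / (m + m)).
have e'0 : 0 < e' by rewrite lt_min ltr01 divr_gt0// addr_gt0//.
have [t1 t10 Ht1] := Hf e' e'0; have [t2 t20 Ht2] := Hu e' e'0.
exists (Num.min t2 (t1 / m)); first by rewrite lt_min t20 divr_gt0.
move=> h; rewrite lt_min ltr_pdivlMr// => /andP[ht2 ht1].
have E2 := Ht2 h ht2.
have h0 : 0 <= n h by rewrite -ni cmod_ge0.
have kb : cmod (k h) <= (e' + cmod d') * n h.
  rewrite -(subrK (d' * i h) (k h)) (le_trans (cmodD _ _))// cmodM ni.
  by rewrite mulrDl lerD.
have e'1 : e' <= 1 by rewrite ge_min lexx.
have kt1 : cmod (k h) < t1.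
  apply: le_lt_trans kb (le_lt_trans _ ht1); rewrite mulrC ler_wpM2l//.
  by rewrite /m; have := cmod_ge0 d; lra.
have := Ht1 _ kt1 => E1.
have -> : f (w + k h) - f w - d * d' * i h =
   (f (w + k h) - f w - d * k h) + d * (k h - d' * i h) by ring.
apply: le_trans (cmodD _ _) _; rewrite cmodM.
have e'2 : e' * (m + m) <= e.
  by rewrite -(ler_pdivlMr _ _ (addr_gt0 m0 m0)) ge_min lexx orbT.
have d0 := cmod_ge0 d; have d'0 := cmod_ge0 d'.
apply: le_trans (_ : e' * ((e' + cmod d') * n h) + cmod d * (e' * n h) <= _).
  apply: lerD; first by apply: le_trans E1 _; rewrite ler_wpM2l// ltW.
  by rewrite ler_wpM2l.
apply: le_trans (_ : (e' * (m + m)) * n h <= _); last by rewrite ler_wpM2r.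
have -> : e' * ((e' + cmod d') * n h) + cmod d * (e' * n h) =
  (e' * (e' + cmod d' + cmod d)) * n h by ring.
rewrite ler_wpM2r// ler_wpM2l ?ltW//; rewrite /m; lra.
Qed.

Lemma pderive_comp f (u : R -> R[i]) x d d' :
  is_derive (u x) (1 : R[i]) f d -> pderive u x d' ->
  pderive (f \o u) x (d * d').
Proof.
move=> Hf Hu e e0.
have [//|t t0 Ht] := @chain_estimate R (fun y : R => `|y|) (real_complex R)
  (fun y : R => u (x + y) - u x) f (u x) d d' cmod_real Hf Hu e.
by exists t => // h /Ht; rewrite (addrC (u x)) subrK.
Qed.

Lemma is_derive_ccomp f g z d d' :
  is_derive (g z) (1 : R[i]) f d -> is_derive z (1 : R[i]) g d' ->
  is_derive z (1 : R[i]) (f \o g) (d * d').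
Proof.
move=> Hf /is_deriveP Hu; apply/is_deriveP => e e0.
have [//|t t0 Ht] := @chain_estimate R[i] cmod id (fun h => g (z + h) - g z)
  f (g z) d d' (fun=> erefl) Hf Hu e.
by exists t => // h /Ht; rewrite (addrC (g z)) subrK.
Qed.

Lemma pderive_segment z h x : pderive (fun t => z + t%:C * h) x h.
Proof.
move=> e e0; exists 1 => // k _.
rewrite [X in cmod X](_ : _ = 0) ?cmod0 ?mulr_ge0 ?(ltW e0)//.
by rewrite rmorphD /=; ring.
Qed.

Lemma pderive_cis (a : R[i]) (rho : R) x :
  pderive (fun t => a + rho%:C * cis t) x ('i * (rho%:C * cis x)).
Proof.
apply/pderiveP; split.
  rewrite (_ : (fun t => _) = (fun t => complex.Re a + rho * cos t)); last first.
    by apply/funext => t; rewrite ReD ReM /= mul0r subr0.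
  apply: is_derive_eq; rewrite !(ReM, ImM) /= /GRing.scale /=; ring.
rewrite (_ : (fun t => _) = (fun t => complex.Im a + rho * sin t)); last first.
  by apply/funext => t; rewrite ImD ImM /= mul0r addr0.
apply: is_derive_eq; rewrite !(ReM, ImM) /= /GRing.scale /=; ring.
Qed.

(* The real mean value theorem applied to Re (conj (u 1 - u 0) * u). *)
Lemma pderive_mvt (u du : R -> R[i]) (M : R) :
  (forall t, 0 <= t <= 1 -> pderive u t (du t)) ->
  (forall t, 0 <= t <= 1 -> cmod (du t) <= M) ->
  cmod (u 1 - u 0) <= M.
Proof.
move=> Hu HM.
pose v := (u 1 - u 0)^*.
pose F := (fun t => complex.Re v * complex.Re (u t) - complex.Im v * complex.Im (u t)).
pose dF := (fun t => complex.Re v * complex.Re (du t) - complex.Im v * complex.Im (du t)).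
have FF t : 0 <= t <= 1 -> is_derive t (1 : R) F (dF t).
  by move=> /Hu/pderiveP[? ?]; apply: is_derive_eq.
have [||c c01] := @MVT_segment R F dF 0 1 ler01.
- by move=> t; rewrite in_itv /= => /andP[t0 t1]; apply: FF; rewrite !ltW.
- apply: continuous_in_subspaceT => t; rewrite inE /= in_itv /= => /FF [dFt _].
  by apply/differentiable_continuous/derivable1_diffP.
rewrite subr0 mulr1 => E.
have E2 : F 1 - F 0 = cmod (u 1 - u 0) ^+ 2.
  by rewrite /F sqr_cmod /v; case: (u 1) (u 0) => [a b] [c' d] /=; ring.
have : cmod (u 1 - u 0) ^+ 2 <= cmod (u 1 - u 0) * M.
  rewrite -E2 E.
  have -> : dF c = complex.Re (v * du c) by rewrite ReM.
  rewrite (le_trans (Re_le _))// cmodM /v cmodJ ler_wpM2l ?cmod_ge0// HM//.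
have := cmod_ge0 (u 1 - u 0); rewrite le_eqVlt => /orP[/eqP <- _|m0].
  exact: le_trans (cmod_ge0 (du c)) (HM _ c01).
by rewrite expr2 ler_pM2l.
Qed.

Lemma is_derive_mvt f z h (df : R[i] -> R[i]) (M : R) :
  (forall t, 0 <= t <= 1 -> is_derive (z + t%:C * h) (1 : R[i]) f (df (z + t%:C * h))) ->
  (forall t, 0 <= t <= 1 -> cmod (df (z + t%:C * h)) <= M) ->
  cmod (f (z + h) - f z) <= M * cmod h.
Proof.
move=> Hf HM.
have := @pderive_mvt (f \o (fun t => z + t%:C * h)) (fun t => df (z + t%:C * h) * h) (M * cmod h).
rewrite /= mul1r mul0r addr0; apply => t t01.
  by apply: pderive_comp; [exact: Hf|exact: pderive_segment].
by rewrite cmodM ler_wpM2r ?cmod_ge0// HM.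
Qed.

Lemma is_derive_const_eq f : (forall z, is_derive z (1 : R[i]) f 0) ->
  forall z w, f z = f w.
Proof.
move=> Hf z w; apply/eqP; rewrite -subr_eq0 -cmod_eq0 eq_le cmod_ge0 andbT.
have := @is_derive_mvt f w (z - w) (cst 0) 0.
rewrite mul0r (addrC w) subrK; apply => // t _.
by rewrite cmod0.
Qed.

(** At the origin the derivative comes from those of [expR], [cos] and [sin]; the functional
    equation carries it to every other point. *)
Lemma is_derive_cexp z : is_derive z (1 : R[i]) cexp (cexp z).
Proof.
have H0 : is_derive (0 : R[i]) (1 : R[i]) cexp 1.
  apply/is_deriveP => e e0.
  have /is_derive_realP He := is_derive_expR (0 : R).
  have /is_derive_realP Hc := is_derive_cos (0 : R).
  have /is_derive_realP Hs := is_derive_sin (0 : R).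
  (* The two components of the error add up to at most nine times [e / 14 * m]: one for [ea], three
     each for the terms with [cb] and [sb], two for [(a + ea) * b]. *)
  pose e' := Num.min 1 (e / 14).
  have e'0 : 0 < e' by rewrite lt_min ltr01 divr_gt0.
  have [t1 t10 H1] := He e' e'0; have [t2 t20 H2] := Hc e' e'0.
  have [t3 t30 H3] := Hs e' e'0.
  exists (Num.min (Num.min t1 t2) (Num.min t3 e')).
    by rewrite !lt_min t10 t20 t30 ltr01 divr_gt0.
  move=> h; rewrite !lt_min -!andbA => /and5P[h1 h2 h3 h5 h4].
  have {h1 H1} := H1 _ (le_lt_trans (Re_le_cmod h) h1).
  have {h2 H2} := H2 _ (le_lt_trans (Im_le_cmod h) h2).
  have {h3 H3} := H3 _ (le_lt_trans (Im_le_cmod h) h3).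
  rewrite !add0r expR0 cos0 sin0 !subr0 oppr0 mul0r subr0 !mul1r.
  move=> H3 H2 H1.
  have e'1 : e' <= 1 by rewrite ge_min lexx.
  have e'6 : e' <= e / 14 by rewrite ge_min lexx orbT.
  have ha := Re_le_cmod h; have hb := Im_le_cmod h.
  rewrite cexp0 ?mul1r; apply: le_trans (cmod_le_ReIm _) _.
  rewrite /cexp !(ReD, ReN, ReM, ImD, ImN, ImM) /= !mul0r subr0 addr0 oppr0 addr0.
  set a := complex.Re h in H1 ha *; set b := complex.Im h in H2 H3 hb *.
  set m := cmod h in h4 ha hb *.
  pose ea := expR a - 1 - a; pose cb := cos b - 1; pose sb := sin b - b.
  have -> : expR a * cos b - 1 - a = ea + (1 + a + ea) * cb by rewrite /ea /cb; ring.
  have -> : expR a * sin b - b = (a + ea) * b + (1 + a + ea) * sb by rewrite /ea /sb; ring.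
  have m0 : 0 <= m by exact: cmod_ge0.
  have Ea : `|ea| <= e' * m by apply: le_trans H1 _; rewrite ler_wpM2l// ltW.
  have Cb : `|cb| <= e' * m by apply: le_trans H2 _; rewrite ler_wpM2l// ltW.
  have Sb : `|sb| <= e' * m by apply: le_trans H3 _; rewrite ler_wpM2l// ltW.
  apply: le_trans (lerD (ler_normD _ _) (ler_normD _ _)) _; rewrite !normrM.
  have aea : `|a + ea| <= 2 * m.
    by apply: le_trans (ler_normD _ _) _; nra.
  have o3 : `|1 + a + ea| <= 3.
    by rewrite -addrA; apply: le_trans (ler_normD _ _) _; rewrite normr1; lra.
  have : `|a + ea| * `|b| <= 2 * m * (e / 14).
    by apply: ler_pM => //; lra.
  have : `|1 + a + ea| * `|cb| <= 3 * (e' * m) by apply: ler_pM.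
  have : `|1 + a + ea| * `|sb| <= 3 * (e' * m) by apply: ler_pM.
  have : e' * m <= e / 14 * m by rewrite ler_wpM2r.
  have : 0 <= e * m by rewrite mulr_ge0// ltW.
  by lra.
rewrite -(mulr1 (cexp z)); apply/is_deriveP => e e0.
have [|t t0 Ht] := (is_deriveP cexp 0 1).1 H0 (e / cmod (cexp z)).
  by rewrite divr_gt0// cmod_gt0 cexp_neq0.
exists t => // h /Ht; rewrite add0r cexp0 cexpD => H.
rewrite (_ : cexp z * cexp h - _ - _ = cexp z * (cexp h - 1 - 1 * h)); last by ring.
rewrite cmodM (le_trans (ler_wpM2l (cmod_ge0 _) H))// mulrA mulrCA divff ?mulr1//.
by rewrite cmod_eq0 cexp_neq0.
Qed.

End ComplexDerivative.

(** * Integrals of complex-valued functions *)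

Section Integral.
Context {R : realType}.
Implicit Types (u v : R -> R) (a b c t x : R).

Local Notation rint a b u := (\int[@lebesgue_measure R]_(t in `[a, b]) (u t)).

Definition rcts_on a b u := forall t, a <= t <= b -> {for t, continuous u}.

Lemma rcts_within a b u : rcts_on a b u -> {within `[a, b], continuous u}.
Proof.
move=> uc; apply: continuous_in_subspaceT => t.
by rewrite inE /= in_itv /= => /uc.
Qed.

Lemma rcts_integrable a b u : rcts_on a b u ->
  (@lebesgue_measure R).-integrable `[a, b] (EFin \o u).
Proof.
by move=> uc; apply: continuous_compact_integrable;
  [exact: segment_compact|exact: rcts_within].
Qed.

Lemma eq_rint a b u v : (forall t, a <= t <= b -> u t = v t) -> rint a b u = rint a b v.
Proof. by move=> uv; apply: eq_Rintegral => t; rewrite inE /= in_itv /= => /uv. Qed.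

Lemma rintD a b u v : rcts_on a b u -> rcts_on a b v ->
  rint a b (fun t => u t + v t) = rint a b u + rint a b v.
Proof. by move=> uc vc; rewrite RintegralD//; exact: rcts_integrable. Qed.

Lemma rintB a b u v : rcts_on a b u -> rcts_on a b v ->
  rint a b (fun t => u t - v t) = rint a b u - rint a b v.
Proof. by move=> uc vc; rewrite RintegralB//; exact: rcts_integrable. Qed.

Lemma rintZ a b k u : rcts_on a b u ->
  rint a b (fun t => k * u t) = k * rint a b u.
Proof. by move=> uc; rewrite RintegralZl//; exact: rcts_integrable. Qed.

Lemma rint_cst a b k : a <= b -> rint a b (fun=> k) = k * (b - a).
Proof.
move=> ab; rewrite (@Rintegral_cst _ _ _ _ _ _ k)//= lebesgue_measure_itv /= lte_fin.
by move: ab; rewrite le_eqVlt => /orP[/eqP ->|->]; rewrite ?ltxx ?subrr.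
Qed.

Lemma le_rint a b u v : rcts_on a b u -> rcts_on a b v ->
  (forall t, a <= t <= b -> u t <= v t) -> rint a b u <= rint a b v.
Proof.
move=> uc vc uv; by apply: le_Rintegral => //; exact: rcts_integrable.
Qed.

Lemma rint_FTC a b u v : a <= b ->
  (forall t, a <= t <= b -> is_derive t (1 : R) v (u t)) ->
  rcts_on a b u -> rint a b u = v b - v a.
Proof.
rewrite le_eqVlt => /orP[/eqP <- _ _|ab vu uc].
  by rewrite set_itv1 Rintegral_set1 subrr.
have vc t : a <= t <= b -> {for t, continuous v}.
  by move=> /vu [? _]; apply/differentiable_continuous/derivable1_diffP.
rewrite /Rintegral (@continuous_FTC2 _ u v)//.
- exact: rcts_within.
- split.
  + by move=> t; rewrite in_itv /= => /andP[t1 t2]; have [] := vu t; rewrite ?ltW.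
  + by apply: cvg_at_right_filter; apply: vc; rewrite lexx ltW.
  + by apply: cvg_at_left_filter; apply: vc; rewrite lexx ltW.
- move=> t; rewrite in_itv /= => /andP[t1 t2].
  by rewrite derive1E; have [] := vu t; rewrite ?ltW.
Qed.

Lemma rint_add a b c u : a <= c <= b -> rcts_on a b u ->
  rint a b u = rint a c u + rint c b u.
Proof.
move=> /andP[ac cb] uc.
have ui := rcts_integrable uc.
have := @Rintegral_itvB R u (BLeft a) (BRight b) c ui.
rewrite !bnd_simp => /(_ ac cb) E.
have {}ui : (@lebesgue_measure R).-integrable `]c, b] (EFin \o u).
  apply: integrableS ui => //; move=> t /=; rewrite !in_itv /= => /andP[ct ->].
  by rewrite (le_trans ac (ltW ct)).
have := @Rintegral_itv_obnd_cbnd R c (BRight b) u ui.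
by rewrite -E => <-; rewrite addrC subrK.
Qed.

End Integral.

Notation rint a b u := (\int[lebesgue_measure]_(t in `[a, b]) (u t)).

Section ComplexIntegral.
Context {R : realType}.
Implicit Types (u v : R -> R[i]) (a b c t x e : R).

Definition ccts u t := {for t, continuous (fun x => complex.Re (u x))} /\
  {for t, continuous (fun x => complex.Im (u x))}.

Lemma real_ctsP (u : R -> R) t : {for t, continuous u} <->
  forall e, 0 < e -> exists2 d : R, 0 < d &
    forall h : R, `|h| < d -> `|u (t + h) - u t| < e.
Proof.
split=> [/cvgrPdist_lt H e /H /nbhs_ballP[/= d d0 Hd]|H].
  exists d => // h hd; rewrite distrC; apply: Hd.
  by rewrite -ball_normE /= opprD addrA subrr sub0r normrN.
apply/cvgrPdist_lt => e /H [d d0 Hd]; apply/nbhs_ballP; exists d => //= y.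
by rewrite /ball_ /= distrC => /Hd; rewrite (addrC t) subrK distrC.
Qed.

Lemma cctsP u t : ccts u t <-> forall e, 0 < e -> exists2 d : R, 0 < d &
    forall h : R, `|h| < d -> cmod (u (t + h) - u t) < e.
Proof.
split=> [[/real_ctsP H1 /real_ctsP H2] e e0|H].
  have [|d1 d10 Hd1] := H1 (e / 2); first by rewrite divr_gt0.
  have [|d2 d20 Hd2] := H2 (e / 2); first by rewrite divr_gt0.
  exists (Num.min d1 d2); first by rewrite lt_min d10.
  move=> h; rewrite lt_min => /andP[/Hd1 h1 /Hd2 h2].
  apply: le_lt_trans (cmod_le_ReIm _) _; rewrite ReD ReN ImD ImN.
  by rewrite [ltRHS](splitr e) ltrD.
split; apply/real_ctsP => e /H [d d0 Hd]; exists d => // h /Hd.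
  by apply: le_lt_trans; rewrite -ReN -ReD Re_le_cmod.
by apply: le_lt_trans; rewrite -ImN -ImD Im_le_cmod.
Qed.

Lemma ccts_cst (z : R[i]) t : ccts (fun=> z) t.
Proof. by split; exact: cst_continuous. Qed.

Lemma cctsD u v t : ccts u t -> ccts v t -> ccts (fun x => u x + v x) t.
Proof.
move=> [u1 u2] [v1 v2]; split.
  rewrite (_ : (fun x => _) = (fun x => complex.Re (u x) + complex.Re (v x))).
    exact: continuousD.
  by apply/funext => x; rewrite ReD.
rewrite (_ : (fun x => _) = (fun x => complex.Im (u x) + complex.Im (v x))).
  exact: continuousD.
by apply/funext => x; rewrite ImD.
Qed.

Lemma cctsM u v t : ccts u t -> ccts v t -> ccts (fun x => u x * v x) t.
Proof.
move=> [u1 u2] [v1 v2]; split.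
  rewrite (_ : (fun x => _) = (fun x => complex.Re (u x) * complex.Re (v x) -
     complex.Im (u x) * complex.Im (v x))).
    by apply: continuousB; exact: continuousM.
  by apply/funext => x; rewrite ReM.
rewrite (_ : (fun x => _) = (fun x => complex.Re (u x) * complex.Im (v x) +
     complex.Im (u x) * complex.Re (v x))).
  by apply: continuousD; exact: continuousM.
by apply/funext => x; rewrite ImM.
Qed.

Lemma cctsN u t : ccts u t -> ccts (fun x => - u x) t.
Proof.
move=> [u1 u2]; split.
  rewrite (_ : (fun x => _) = (fun x => - complex.Re (u x))); first exact: continuousN.
  by apply/funext => x; rewrite ReN.
rewrite (_ : (fun x => _) = (fun x => - complex.Im (u x))); first exact: continuousN.
by apply/funext => x; rewrite ImN.
Qed.

Lemma cctsB u v t : ccts u t -> ccts v t -> ccts (fun x => u x - v x) t.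
Proof. by move=> uc vc; apply: cctsD => //; exact: cctsN. Qed.

Lemma pderive_ccts u t d : pderive u t d -> ccts u t.
Proof.
move=> /pderiveP[[? _] [? _]].
by split; apply/differentiable_continuous/derivable1_diffP.
Qed.

(* The tolerances of the library's continuity on R[i] lie in R[i]; here they are real. *)
Definition ctsC (f : R[i] -> R[i]) (z : R[i]) := forall e, 0 < e ->
  exists2 d : R, 0 < d & forall h, cmod h < d -> cmod (f (z + h) - f z) < e.

Lemma ctsC_ccts f u t : ctsC f (u t) -> ccts u t -> ccts (f \o u) t.
Proof.
move=> fc /cctsP uc; apply/cctsP => e /fc [d1 /uc [d d0 Hd] Hd1].
exists d => // h /Hd /Hd1; by rewrite (addrC (u t)) subrK.
Qed.

Lemma derivable_ctsC f z : derivable f z (1 : R[i]) -> ctsC f z.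
Proof. by move=> /derive1P; exact: is_derive_cts. Qed.

Lemma ccts_cis t : ccts cis t.
Proof. by split; [exact: continuous_cos|exact: continuous_sin]. Qed.

Lemma ccts_circle (z : R[i]) (rho : R) t : ccts (fun x => z + rho%:C * cis x) t.
Proof. exact: pderive_ccts (pderive_cis z rho t). Qed.

Lemma rcts_cmod u t : ccts u t -> {for t, continuous (fun x => cmod (u x))}.
Proof.
move=> /cctsP uc; apply/real_ctsP => e /uc [d d0 Hd]; exists d => // h /Hd.
apply: le_lt_trans; rewrite ler_norml cmod_subl andbT.
by rewrite lerNl opprB cmodBC cmod_subl.
Qed.

Definition cint a b u : R[i] :=
  (rint a b (fun t => complex.Re (u t))) +i* (rint a b (fun t => complex.Im (u t))).

Definition ccts_on a b u := forall t, a <= t <= b -> ccts u t.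

Let re_cts a b u : ccts_on a b u -> rcts_on a b (fun t => complex.Re (u t)).
Proof. by move=> uc t /uc[]. Qed.

Let im_cts a b u : ccts_on a b u -> rcts_on a b (fun t => complex.Im (u t)).
Proof. by move=> uc t /uc[]. Qed.

Lemma eq_cint a b u v : (forall t, a <= t <= b -> u t = v t) -> cint a b u = cint a b v.
Proof.
by move=> uv; apply: eqC; apply: eq_rint => t /uv ->.
Qed.

Lemma cintD a b u v : ccts_on a b u -> ccts_on a b v ->
  cint a b (fun t => u t + v t) = cint a b u + cint a b v.
Proof.
move=> uc vc; apply: eqC; rewrite ?ReD ?ImD /= -rintD; try exact: re_cts; try exact: im_cts.
  by apply: eq_rint => t _; rewrite ReD.
by apply: eq_rint => t _; rewrite ImD.
Qed.

Lemma cintZ a b (k : R[i]) u : ccts_on a b u ->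
  cint a b (fun t => k * u t) = k * cint a b u.
Proof.
move=> uc; have uR := re_cts uc; have uI := im_cts uc.
have Zc (w : R -> R) (l : R) : rcts_on a b w -> rcts_on a b (fun t => l * w t).
  by move=> wc t /wc; apply: continuousM; exact: cst_continuous.
apply: eqC; rewrite ?ReM ?ImM /= -!rintZ//.
  by rewrite -rintB; try exact: Zc; apply: eq_rint => t _; rewrite ReM.
by rewrite -rintD; try exact: Zc; apply: eq_rint => t _; rewrite ImM.
Qed.

Lemma cintB a b u v : ccts_on a b u -> ccts_on a b v ->
  cint a b (fun t => u t - v t) = cint a b u - cint a b v.
Proof.
move=> uc vc; rewrite cintD//; last by move=> t /vc; exact: cctsN.
rewrite -(mulN1r (cint a b v)) -cintZ//; congr (_ + _).
by apply: eq_cint => t _; rewrite mulN1r.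
Qed.

Lemma cint_add a b c u : a <= c <= b -> ccts_on a b u ->
  cint a b u = cint a c u + cint c b u.
Proof.
move=> acb uc; apply: eqC; rewrite ?ReD ?ImD /=; apply: rint_add => //.
  exact: re_cts.
exact: im_cts.
Qed.

Lemma cint_FTC a b u v : a <= b ->
  (forall t, a <= t <= b -> pderive v t (u t)) -> ccts_on a b u ->
  cint a b u = v b - v a.
Proof.
move=> ab vu uc; apply: eqC; rewrite ?ReD ?ImD ?ReN ?ImN /=.
  by apply: (@rint_FTC _ a b _ (fun t => complex.Re (v t))) => // [t /vu/pderiveP[]//|]; exact: re_cts.
by apply: (@rint_FTC _ a b _ (fun t => complex.Im (v t))) => // [t /vu/pderiveP[]//|]; exact: im_cts.
Qed.

Lemma cint_cst a b (k : R[i]) : a <= b -> cint a b (fun=> k) = (b - a)%:C * k.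
Proof.
by move=> ab; apply: eqC; rewrite ?ReM ?ImM /= rint_cst// ?mul0r ?subr0 ?addr0 mulrC.
Qed.

(* rotate the integral onto the positive real axis *)
Lemma cint_le a b u (w : R -> R) : a <= b -> ccts_on a b u -> rcts_on a b w ->
  (forall t, a <= t <= b -> cmod (u t) <= w t) -> cmod (cint a b u) <= rint a b w.
Proof.
move=> ab uc wc uw.
have [->|I0] := eqVneq (cint a b u) 0.
  rewrite cmod0; apply: Rintegral_ge0 => t /=; rewrite in_itv /= => /uw.
  exact: le_trans (cmod_ge0 _).
set I := cint a b u in I0 *.
have E : cmod I ^+ 2 = rint a b (fun t => complex.Re (I^* * u t)).
  transitivity (complex.Re (cint a b (fun t => I^* * u t))); last by [].
  by rewrite cintZ// -/I mulrC mulCJ.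
have m0 : 0 < cmod I by rewrite cmod_gt0.
have : cmod I ^+ 2 <= cmod I * rint a b w.
  rewrite E -rintZ//; apply: le_rint.
  - by apply: re_cts => t /uc; apply: cctsM; exact: ccts_cst.
  - by move=> t /wc; apply: continuousM; exact: cst_continuous.
  - move=> t tab; rewrite (le_trans (Re_le _))// cmodM cmodJ ler_wpM2l ?cmod_ge0//.
    exact: uw.
by rewrite expr2 ler_pM2l.
Qed.

Lemma cint_bound a b u (M : R) : a <= b -> ccts_on a b u ->
  (forall t, a <= t <= b -> cmod (u t) <= M) -> cmod (cint a b u) <= M * (b - a).
Proof.
move=> ab uc uM; rewrite -rint_cst//; apply: cint_le => // t _.
exact: cst_continuous.
Qed.

(** Differentiation under the integral sign: the remainder is quadratic in [h] uniformly in [t], so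
    integrating it over [[a, b]] already gives the expansion at [z]. *)
Lemma is_derive_cint a b (phi : R[i] -> R -> R[i]) (psi : R -> R[i]) (z : R[i]) (L d : R) :
  a <= b -> 0 < d ->
  (forall h, cmod h < d -> ccts_on a b (phi (z + h))) -> ccts_on a b psi ->
  (forall h t, cmod h < d -> a <= t <= b ->
     cmod (phi (z + h) t - phi z t - psi t * h) <= L * cmod h ^+ 2) ->
  is_derive z (1 : R[i]) (fun w => cint a b (phi w)) (cint a b psi).
Proof.
move=> ab d0 phic psic H; apply/is_deriveP => e e0.
pose K := Num.max 1 (L * (b - a)).
have K0 : 0 < K by rewrite lt_max ltr01.
exists (Num.min d (e / K)); first by rewrite lt_min d0 divr_gt0.
move=> h; rewrite lt_min => /andP[hd he].
have pz : ccts_on a b (phi z) by have := phic 0; rewrite addr0; apply; rewrite cmod0.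
have ph := phic h hd.
have psih : ccts_on a b (fun t => h * psi t).
  by move=> t /psic pt; apply: cctsM => //; exact: ccts_cst.
have phz : ccts_on a b (fun t => phi (z + h) t - phi z t).
  by move=> t tab; apply: cctsB; [exact: ph|exact: pz].
rewrite (mulrC (cint a b psi)) -cintZ// -cintB// -cintB//.
apply: le_trans (cint_bound (M := L * cmod h ^+ 2) ab _ _) _.
- by move=> t tab; apply: cctsB; [exact: phz|exact: psih].
- by move=> t tab; rewrite (mulrC h); exact: H.
- have -> : L * cmod h ^+ 2 * (b - a) = (L * (b - a) * cmod h) * cmod h by ring.
  rewrite ler_wpM2r ?cmod_ge0//; apply: le_trans (_ : K * cmod h <= _).
    by rewrite ler_wpM2r ?cmod_ge0// le_max lexx orbT.
  by rewrite mulrC -ler_pdivlMr// ltW.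
Qed.

End ComplexIntegral.

(** * Goursat's theorem and circle means *)

Section DerivativeRules.
Context {R : realType}.
Implicit Types (f g : R[i] -> R[i]) (z c d : R[i]).

Lemma cderD f g z df dg : is_derive z (1 : R[i]) f df -> is_derive z (1 : R[i]) g dg ->
  is_derive z (1 : R[i]) (fun w => f w + g w) (df + dg).
Proof. by move=> ? ?; exact: is_deriveD. Qed.

Lemma cderB f g z df dg : is_derive z (1 : R[i]) f df -> is_derive z (1 : R[i]) g dg ->
  is_derive z (1 : R[i]) (fun w => f w - g w) (df - dg).
Proof. by move=> ? ?; exact: is_deriveB. Qed.

Lemma cderM f g z df dg : is_derive z (1 : R[i]) f df -> is_derive z (1 : R[i]) g dg ->
  is_derive z (1 : R[i]) (fun w => f w * g w) (df * g z + f z * dg).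
Proof.
move=> Hf Hg; have : is_derive z (1 : R[i]) (f * g) (f z *: dg + g z *: df).
  exact: is_deriveM.
by rewrite /GRing.scale /= addrC (mulrC (g z)).
Qed.

Lemma cder_cst c z : is_derive z (1 : R[i]) (fun=> c) 0.
Proof. exact: is_derive_cst. Qed.

Lemma cder_id z : is_derive z (1 : R[i]) (fun w => w) 1.
Proof. exact: is_derive_id. Qed.

Lemma cderZ c f z df : is_derive z (1 : R[i]) f df ->
  is_derive z (1 : R[i]) (fun w => c * f w) (c * df).
Proof. by move=> Hf; have := cderM (cder_cst c z) Hf; rewrite mul0r add0r. Qed.

Lemma cderV f z df : f z != 0 -> is_derive z (1 : R[i]) f df ->
  is_derive z (1 : R[i]) (fun w => (f w)^-1) (- (f z) ^- 2 * df).
Proof.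
move=> f0 [Hf dE]; split; first exact: derivableV.
by rewrite deriveV// dE.
Qed.

Lemma cder_eq f z d d' : is_derive z (1 : R[i]) f d -> d = d' -> is_derive z (1 : R[i]) f d'.
Proof. by move=> + <-. Qed.

Lemma cder_derivable f z d : is_derive z (1 : R[i]) f d -> derivable f z (1 : R[i]).
Proof. by case. Qed.

Lemma cderBid (a : R[i]) z : is_derive z (1 : R[i]) (fun w => w - a) 1.
Proof. by apply: cder_eq (cderB (cder_id z) (cder_cst a z)) _; rewrite subr0. Qed.

Lemma pderiveZ c (u : R -> R[i]) (t : R) d : pderive u t d -> pderive (fun x => c * u x) t (c * d).
Proof.
move=> Hu; apply: (@pderive_comp _ (fun w => c * w)) => //.
by apply: cder_eq (cderZ c (cder_id _)) _; rewrite mulr1.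
Qed.

Lemma pderive_cisN (t : R) : pderive (fun x => cis (- x)) t (- 'i * cis (- t)).
Proof.
apply/pderiveP; split.
  rewrite (_ : (fun x => _) = cos); last by apply/funext => x /=; rewrite cosN.
  by apply: is_derive_eq; rewrite ReM /= cosN sinN; ring.
rewrite (_ : (fun x => _) = (fun x => - sin x)); last by apply/funext => x /=; rewrite sinN.
by apply: is_derive_eq; rewrite ImM /= cosN sinN; ring.
Qed.

End DerivativeRules.

(** * Goursat's theorem for rectangles *)

Section Goursat.
Context {R : realType}.
Implicit Types (u v U : R[i] -> R[i]) (x y s t e : R) (z p : R[i]).

Lemma nested_intervals (a b : nat -> R) :
  (forall n, a n <= a n.+1) -> (forall n, b n.+1 <= b n) -> (forall n, a n <= b n) ->
  exists c : R, forall n, a n <= c <= b n.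
Proof.
move=> ha hb hab.
have ma m n : (m <= n)%N -> a m <= a n.
  elim: n => [|n ih]; first by rewrite leqn0 => /eqP ->.
  by rewrite leq_eqVlt => /orP[/eqP -> //|/ih/le_trans]; apply; exact: ha.
have mb m n : (m <= n)%N -> b n <= b m.
  elim: n => [|n ih]; first by rewrite leqn0 => /eqP ->.
  rewrite leq_eqVlt => /orP[/eqP -> //|/ih]; apply: le_trans; exact: hb.
have ab m n : a m <= b n.
  have [mn|nm] := leqP m n; first exact: le_trans (ma _ _ mn) (hab n).
  exact: le_trans (hab m) (mb _ _ (ltnW nm)).
have hs : has_sup (range a).
  by split; [exists (a 0%N), 0%N | exists (b 0%N) => _ [m _ <-]; exact: ab].
exists (sup (range a)) => n; apply/andP; split.
  by apply: ub_le_sup; [case: hs|exists n].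
by apply: ge_sup; [case: hs|move=> _ [m _ <-]; exact: ab].
Qed.

(** The contour integral over the boundary, counterclockwise: lower and right sides, then upper and
    left sides with reversed sign. *)
Definition rect_int u (x1 x2 y1 y2 : R) : R[i] :=
  cint x1 x2 (fun t => u (t +i* y1)) + 'i * cint y1 y2 (fun t => u (x2 +i* t))
  - cint x1 x2 (fun t => u (t +i* y2)) - 'i * cint y1 y2 (fun t => u (x1 +i* t)).

Definition in_rect (x1 x2 y1 y2 : R) z :=
  x1 <= complex.Re z <= x2 /\ y1 <= complex.Im z <= y2.

Lemma pderive_hline y t : pderive (fun s : R => s +i* y) t 1.
Proof.
move=> e e0; exists 1 => // h _.
rewrite (_ : _ - _ = 0) ?cmod0 ?mulr_ge0 ?(ltW e0)//.
by apply: eqC; rewrite /= ; ring.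
Qed.

Lemma pderive_vline x t : pderive (fun s : R => x +i* s) t 'i.
Proof.
move=> e e0; exists 1 => // h _.
rewrite (_ : _ - _ = 0) ?cmod0 ?mulr_ge0 ?(ltW e0)//.
by apply: eqC; rewrite /= ; ring.
Qed.

Definition cts_rect u x1 x2 y1 y2 := forall z, in_rect x1 x2 y1 y2 z -> ctsC u z.

Lemma cts_rect_h u x1 x2 y1 y2 y : y1 <= y <= y2 -> cts_rect u x1 x2 y1 y2 ->
  ccts_on x1 x2 (fun t => u (t +i* y)).
Proof.
move=> yy uc t tx; apply: (@ctsC_ccts _ u (fun s => s +i* y)); first exact: uc.
exact: pderive_ccts (pderive_hline y t).
Qed.

Lemma cts_rect_v u x1 x2 y1 y2 x : x1 <= x <= x2 -> cts_rect u x1 x2 y1 y2 ->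
  ccts_on y1 y2 (fun t => u (x +i* t)).
Proof.
move=> xx uc t ty; apply: (@ctsC_ccts _ u (fun s => x +i* s)); first exact: uc.
exact: pderive_ccts (pderive_vline x t).
Qed.

Lemma rect_int_splitx u x1 m x2 y1 y2 : x1 <= m <= x2 -> y1 <= y2 ->
  cts_rect u x1 x2 y1 y2 ->
  rect_int u x1 x2 y1 y2 = rect_int u x1 m y1 y2 + rect_int u m x2 y1 y2.
Proof.
move=> xm yy uc; rewrite /rect_int.
rewrite (@cint_add _ x1 x2 m (fun t => u (t +i* y1)))//; last first.
  by apply: cts_rect_h uc; rewrite lexx.
rewrite (@cint_add _ x1 x2 m (fun t => u (t +i* y2)))//; last first.
  by apply: cts_rect_h uc; rewrite lexx andbT.
ring.
Qed.

Lemma rect_int_splity u x1 x2 y1 m y2 : x1 <= x2 -> y1 <= m <= y2 ->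
  cts_rect u x1 x2 y1 y2 ->
  rect_int u x1 x2 y1 y2 = rect_int u x1 x2 y1 m + rect_int u x1 x2 m y2.
Proof.
move=> xx ym uc; rewrite /rect_int.
rewrite (@cint_add _ y1 y2 m (fun t => u (x1 +i* t)))//; last first.
  by apply: cts_rect_v uc; rewrite lexx.
rewrite (@cint_add _ y1 y2 m (fun t => u (x2 +i* t)))//; last first.
  by apply: cts_rect_v uc; rewrite lexx andbT.
ring.
Qed.

(** Each side contributes the difference of [U] at its end points, and these telescope around the
    contour. *)
Lemma rect_int_primitive u U x1 x2 y1 y2 : x1 <= x2 -> y1 <= y2 ->
  cts_rect u x1 x2 y1 y2 ->
  (forall z, in_rect x1 x2 y1 y2 z -> is_derive z (1 : R[i]) U (u z)) ->
  rect_int u x1 x2 y1 y2 = 0.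
Proof.
move=> xx yy uc HU.
have H y : y1 <= y <= y2 ->
    cint x1 x2 (fun t => u (t +i* y)) = U (x2 +i* y) - U (x1 +i* y).
  move=> yy'; apply: (@cint_FTC _ x1 x2 _ (fun t => U (t +i* y))) => //.
    move=> t tx; rewrite -[u _]mulr1.
    by apply: (@pderive_comp _ U); [exact: HU|exact: pderive_hline].
  exact: cts_rect_h uc.
have V x : x1 <= x <= x2 ->
    'i * cint y1 y2 (fun t => u (x +i* t)) = U (x +i* y2) - U (x +i* y1).
  move=> xx'; have c := cts_rect_v xx' uc.
  rewrite -cintZ//; apply: (@cint_FTC _ y1 y2 _ (fun t => U (x +i* t))) => //.
    move=> t tx; rewrite mulrC.
    by apply: (@pderive_comp _ U); [exact: HU|exact: pderive_vline].
  by move=> t /c; apply: cctsM; exact: ccts_cst.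
by rewrite /rect_int !H ?V ?lexx ?xx ?yy//; ring.
Qed.

Lemma rect_intB u v x1 x2 y1 y2 : x1 <= x2 -> y1 <= y2 ->
  cts_rect u x1 x2 y1 y2 -> cts_rect v x1 x2 y1 y2 ->
  rect_int (fun z => u z - v z) x1 x2 y1 y2 = rect_int u x1 x2 y1 y2 - rect_int v x1 x2 y1 y2.
Proof.
move=> xx yy uc vc; rewrite /rect_int !cintB; first ring.
all: first [apply: cts_rect_h uc|apply: cts_rect_h vc|apply: cts_rect_v uc|apply: cts_rect_v vc].
all: by rewrite ?lexx ?andbT.
Qed.

Lemma rect_int_bound u x1 x2 y1 y2 (M : R) : x1 <= x2 -> y1 <= y2 ->
  cts_rect u x1 x2 y1 y2 ->
  (forall z, in_rect x1 x2 y1 y2 z -> cmod (u z) <= M) ->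
  cmod (rect_int u x1 x2 y1 y2) <= M * (2 * ((x2 - x1) + (y2 - y1))).
Proof.
move=> xx yy uc uM.
have H y : y1 <= y <= y2 -> cmod (cint x1 x2 (fun t => u (t +i* y))) <= M * (x2 - x1).
  by move=> yy'; apply: cint_bound => // [|t tx]; [exact: cts_rect_h uc|exact: uM].
have V x : x1 <= x <= x2 -> cmod ('i * cint y1 y2 (fun t => u (x +i* t))) <= M * (y2 - y1).
  move=> xx'; rewrite cmodM (_ : cmod 'i = 1); last first.
    by rewrite cmodE /= expr0n expr1n add0r sqrtr1.
  rewrite mul1r; apply: cint_bound => // [|t tx]; [exact: cts_rect_v uc|exact: uM].
rewrite /rect_int; apply: le_trans (cmodB _ _) _.
have -> : M * (2 * ((x2 - x1) + (y2 - y1))) =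
   M * (x2 - x1) + M * (y2 - y1) + M * (x2 - x1) + M * (y2 - y1) by ring.
apply: lerD; last by apply: V; rewrite lexx.
apply: le_trans (cmodB _ _) _; apply: lerD; last by apply: H; rewrite lexx andbT.
apply: le_trans (cmodD _ _) _; apply: lerD; first by apply: H; rewrite lexx.
by apply: V; rewrite lexx andbT.
Qed.

Lemma ctsCB u v z : ctsC u z -> ctsC v z -> ctsC (fun w => u w - v w) z.
Proof.
move=> uc vc e e0.
have [|d1 d10 H1] := uc (e / 2); first by rewrite divr_gt0.
have [|d2 d20 H2] := vc (e / 2); first by rewrite divr_gt0.
exists (Num.min d1 d2); first by rewrite lt_min d10.
move=> h; rewrite lt_min => /andP[/H1 h1 /H2 h2].
have -> : u (z + h) - v (z + h) - (u z - v z) = (u (z + h) - u z) - (v (z + h) - v z) by ring.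
by apply: le_lt_trans (cmodB _ _) _; lra.
Qed.

(** If the first half of a split carries less than half of the integral, the second carries at least
    half. *)
Let half_of_sum (A B C : R) : 2 * B < A -> A <= B + C -> A <= 2 * C.
Proof. by move=> ? ?; lra. Qed.

Let quad := (R * R * (R * R))%type.
Let J u (q : quad) := rect_int u q.1.1 q.1.2 q.2.1 q.2.2.
Let inq (q : quad) := in_rect q.1.1 q.1.2 q.2.1 q.2.2.
Let ok (q : quad) := q.1.1 <= q.1.2 /\ q.2.1 <= q.2.2.
(** Bisection in the first coordinate, keeping a half that carries at least half of the modulus of
    the integral; [halfy] does the same in the second coordinate. *)
Let halfx u (q : quad) : quad := let m := (q.1.1 + q.1.2) / 2 in
  if cmod (J u q) <= 2 * cmod (J u ((q.1.1, m), q.2)) then ((q.1.1, m), q.2)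
  else ((m, q.1.2), q.2).
Let halfy u (q : quad) : quad := let m := (q.2.1 + q.2.2) / 2 in
  if cmod (J u q) <= 2 * cmod (J u (q.1, (q.2.1, m))) then (q.1, (q.2.1, m))
  else (q.1, (m, q.2.2)).

Let halfxP u q : ok q -> (forall z, inq q z -> ctsC u z) ->
  let q' := halfx u q in
  [/\ ok q', q.1.1 <= q'.1.1, q'.1.2 <= q.1.2 &
      q'.2 = q.2 /\ (q'.1.2 - q'.1.1 = (q.1.2 - q.1.1) / 2 /\
      cmod (J u q) <= 2 * cmod (J u q'))].
Proof.
case: q => [[x1 x2] [y1 y2]] [/= xx yy] uc; rewrite /halfx /=.
set m := (x1 + x2) / 2.
have xm : x1 <= m <= x2 by rewrite /m; apply/andP; split; lra.
have := rect_int_splitx xm yy uc; rewrite -[LHS]/(J u (x1, x2, (y1, y2))) => E.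
case: ifPn => /= [H|]; rewrite /ok /= ?yy; case/andP: xm => x1m mx2.
  by split=> //; split=> //; split=> //; rewrite /m; lra.
rewrite -ltNge => H; split=> //; split=> //; split; first by rewrite /m; lra.
have := cmodD (rect_int u x1 m y1 y2) (rect_int u m x2 y1 y2); rewrite -E.
exact: half_of_sum H.
Qed.

Let halfyP u q : ok q -> (forall z, inq q z -> ctsC u z) ->
  let q' := halfy u q in
  [/\ ok q', q.2.1 <= q'.2.1, q'.2.2 <= q.2.2 &
      q'.1 = q.1 /\ (q'.2.2 - q'.2.1 = (q.2.2 - q.2.1) / 2 /\
      cmod (J u q) <= 2 * cmod (J u q'))].
Proof.
case: q => [[x1 x2] [y1 y2]] [/= xx yy] uc; rewrite /halfy /=.
set m := (y1 + y2) / 2.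
have ym : y1 <= m <= y2 by rewrite /m; apply/andP; split; lra.
have := rect_int_splity xx ym uc; rewrite -[LHS]/(J u (x1, x2, (y1, y2))) => E.
case: ifPn => /= [H|]; rewrite /ok /= ?xx; case/andP: ym => y1m my2.
  by split=> //; split=> //; split=> //; rewrite /m; lra.
rewrite -ltNge => H; split=> //; split=> //; split; first by rewrite /m; lra.
have := cmodD (rect_int u x1 x2 y1 m) (rect_int u x1 x2 m y2); rewrite -E.
exact: half_of_sum H.
Qed.

(** Bisecting both coordinates costs a factor 4 in the integral and halves the sides. The rectangles
    shrink to a point [p]. The affine part of [u] at [p] has a primitive and drops out, and what
    remains is at most [e'] times the diameter on a contour of comparable length, so both factors
    shrink by 2 and compensate the 4. *)
Lemma goursat u x1 x2 y1 y2 : x1 <= x2 -> y1 <= y2 ->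
  (forall z, in_rect x1 x2 y1 y2 z -> derivable u z (1 : R[i])) ->
  rect_int u x1 x2 y1 y2 = 0.
Proof.
move=> xx yy du.
have uc0 z : in_rect x1 x2 y1 y2 z -> ctsC u z by move=> /du; exact: derivable_ctsC.
pose q n := iter n (fun q => halfy u (halfx u q)) ((x1, x2), (y1, y2)).
pose sub (a b : quad) := [/\ b.1.1 <= a.1.1, a.1.2 <= b.1.2, b.2.1 <= a.2.1 & a.2.2 <= b.2.2].
have subin a b z : sub a b -> inq a z -> inq b z.
  by move=> [h1 h2 h3 h4] [/andP[k1 k2] /andP[k3 k4]]; split; apply/andP; split; lra.
have key n : [/\ ok (q n), sub (q n) ((x1, x2), (y1, y2)),
    (q n).1.2 - (q n).1.1 = (x2 - x1) / 2 ^+ n,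
    (q n).2.2 - (q n).2.1 = (y2 - y1) / 2 ^+ n &
    cmod (rect_int u x1 x2 y1 y2) <= 4 ^+ n * cmod (J u (q n))] /\ sub (q n.+1) (q n).
  have step k : ok (q k) -> sub (q k) ((x1, x2), (y1, y2)) ->
     [/\ ok (q k.+1), sub (q k.+1) (q k),
       (q k.+1).1.2 - (q k.+1).1.1 = ((q k).1.2 - (q k).1.1) / 2,
       (q k.+1).2.2 - (q k.+1).2.1 = ((q k).2.2 - (q k).2.1) / 2 &
       cmod (J u (q k)) <= 4 * cmod (J u (q k.+1))].
    move=> okq sq; rewrite /q iterS -/(q k).
    have uc z : inq (q k) z -> ctsC u z by move=> /(subin _ _ _ sq); exact: uc0.
    have [ok' hx1 hx2 [hy [hw hJ]]] := halfxP okq uc.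
    have uc' z : inq (halfx u (q k)) z -> ctsC u z.
      move=> zi; apply: uc; apply: subin zi; split=> //; by rewrite hy.
    have [ok'' kx1 kx2 [ky [kw kJ]]] := halfyP ok' uc'.
    split=> //.
    - by split; rewrite ?ky// -hy.
    - by rewrite ky.
    - by rewrite kw hy.
    - by lra.
  elim: n => [|n [[okq sq wq hq Jq] s1]].
    have ok0 : ok (q 0%N) by [].
    have s0 : sub (q 0%N) ((x1, x2), (y1, y2)) by split => /=.
    have [_ ss _ _ _] := step _ ok0 s0.
    by split=> //; split=> //; rewrite expr0 ?divr1 ?mul1r.
  have [ok1 _ w1 h1 J1] := step n okq sq.
  have s2 : sub (q n.+1) ((x1, x2), (y1, y2)).
    by case: sq s1 => a1 a2 a3 a4 [c1 c2 c3 c4]; split; [exact: le_trans c1|exact: le_trans c2 _|exact: le_trans c3|exact: le_trans c4 _].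
  have [_ s3 _ _ _] := step n.+1 ok1 s2.
  split=> //; split=> //.
  - by rewrite w1 wq exprSr invfM mulrA.
  - by rewrite h1 hq exprSr invfM mulrA.
  - apply: le_trans Jq _; rewrite exprSr -mulrA ler_wpM2l// exprn_ge0//.
have [|||px Hpx] := @nested_intervals (fun n => (q n).1.1) (fun n => (q n).1.2).
- by move=> n; have [_ []] := key n.
- by move=> n; have [_ []] := key n.
- by move=> n; have [[[]]] := key n.
have [|||py Hpy] := @nested_intervals (fun n => (q n).2.1) (fun n => (q n).2.2).
- by move=> n; have [_ []] := key n.
- by move=> n; have [_ []] := key n.
- by move=> n; have [[[]]] := key n.
pose p := px +i* py.
have pq n : inq (q n) p by split; [exact: Hpx|exact: Hpy].
have /derive1P dp := du p (pq 0%N).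
set d := u^`()%classic p in dp.
pose D := (x2 - x1) + (y2 - y1).
have D0 : 0 <= D by rewrite /D; lra.
apply/eqP; rewrite -cmod_eq0 eq_le cmod_ge0 andbT; apply/ler_addgt0Pl => e e0.
rewrite addr0.
(* After [n] steps the estimate is [4 ^+ n * (e' * (D / 2 ^+ n)) * (2 * (D / 2 ^+ n)) = e' * (2 * D
   * D)]; the added 1 keeps the denominator positive when [D = 0]. *)
pose e' := e / (2 * D * D + 1).
have e'0 : 0 < e' by rewrite divr_gt0// ltr_wpDl// !mulr_ge0.
have [r r0 Hr] := (is_deriveP u p d).1 dp e' e'0.
have [n Hn] : exists n, D / 2 ^+ n < r.
  exists (Num.bound (D / r)); rewrite ltr_pdivrMr ?exprn_gt0// mulrC -ltr_pdivrMr//.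
  exact: upper_nthrootP.
have [[okq sq wq hq Jq] _] := key n.
apply: le_trans Jq _.
(* The affine part has an explicit quadratic primitive, hence a vanishing contour integral. *)
pose aff := fun z => u p + d * (z - p).
have dU z : is_derive z (1 : R[i])
    (fun z => u p * z + d / 2 * ((z - p) * (z - p))) (aff z).
  apply: cder_eq (cderD (cderZ (u p) (cder_id z))
    (cderZ (d / 2) (cderM (cderBid p z) (cderBid p z)))) _.
  by rewrite /aff; field.
have affc z : ctsC aff z.
  have H := cderD (cder_cst (u p) z) (cderZ d (cderBid p z)).
  exact: is_derive_cts H.
have uc z : inq (q n) z -> ctsC u z by move=> /(subin _ _ _ sq); exact: uc0.
have [ox oy] := okq.
have -> : J u (q n) = rect_int (fun z => u z - aff z)
   (q n).1.1 (q n).1.2 (q n).2.1 (q n).2.2.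
  rewrite rect_intB//.
  by rewrite (rect_int_primitive ox oy _ (fun z _ => dU z)) ?subr0// => z _; exact: affc.
apply: le_trans (_ : 4 ^+ n * (e' * (D / 2 ^+ n) * (2 * (D / 2 ^+ n))) <= _).
  rewrite ler_wpM2l ?exprn_ge0//.
  have -> : D / 2 ^+ n = ((q n).1.2 - (q n).1.1) + ((q n).2.2 - (q n).2.1).
    by rewrite wq hq -mulrDl.
  apply: rect_int_bound => // z [/andP[z1 z2] /andP[z3 z4]].
    by apply: ctsCB; [apply: uc; split; apply/andP|exact: affc].
  have [/andP[p1 p2] /andP[p3 p4]] := pq n.
  have zp : cmod (z - p) <= ((q n).1.2 - (q n).1.1) + ((q n).2.2 - (q n).2.1).
    apply: le_trans (cmod_le_ReIm _) _; rewrite ReD ReN ImD ImN.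
    by apply: lerD; rewrite ler_norml; apply/andP; split; rewrite /= in p1 p2 p3 p4 *; clear -p1 p2 p3 p4 z1 z2 z3 z4; lra.
  have := Hr (z - p); rewrite (addrC p) subrK.
  have -> : u z - u p - d * (z - p) = u z - aff z by rewrite /aff; ring.
  have zr : cmod (z - p) < r by apply: le_lt_trans zp _; rewrite wq hq -mulrDl.
  by move=> /(_ zr) /le_trans; apply; rewrite ler_wpM2l// ltW.
have -> : 4 ^+ n * (e' * (D / 2 ^+ n) * (2 * (D / 2 ^+ n))) = e' * (2 * D * D).
  have -> : 4 ^+ n = 2 ^+ n * 2 ^+ n :> R by rewrite -exprMn; congr (_ ^+ n); ring.
  by field; rewrite expf_neq0.
rewrite /e' mulrAC ler_pdivrMr ?ltr_wpDl ?mulr_ge0//.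
by rewrite ler_wpM2l ?lerDl// ltW.
Qed.

End Goursat.

(** * Circle means of holomorphic functions *)

Section CircleMean.
Context {R : realType}.
Implicit Types (f k : R[i] -> R[i]) (a b z w h : R[i]) (r rho e t : R).

(* the logarithmic coordinate w = a + exp(s + i t) turns an annulus into a rectangle *)
Lemma circle_int_const k a (rr rho1 rho2 : R) : 0 < rho1 -> rho1 <= rho2 -> rho2 < rr ->
  (forall z, 0 < cmod (z - a) < rr -> derivable k z (1 : R[i])) ->
  cint 0 (2 * pi) (fun t => k (a + rho1%:C * cis t)) =
  cint 0 (2 * pi) (fun t => k (a + rho2%:C * cis t)).
Proof.
move=> r10 r12 r2 dk.
have r20 : 0 < rho2 by exact: lt_le_trans r12.
pose u := k \o (fun w => a + cexp w).
have pi0 : 0 <= 2 * pi :> R by rewrite mulr_ge0// pi_ge0.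
have du z : in_rect (ln rho1) (ln rho2) 0 (2 * pi) z -> derivable u z (1 : R[i]).
  move=> [/andP[z1 z2] _].
  have [d dk'] : exists d, is_derive (a + cexp z) (1 : R[i]) k d.
    exists (k^`()%classic (a + cexp z)); apply/derive1P/dk.
    rewrite addrC addKr cmod_cexp expR_gt0 /=; apply: le_lt_trans r2.
    by rewrite -(lnK (x := rho2)) ?posrE// ler_expR.
  exact: (cder_derivable (@is_derive_ccomp _ k (fun w => a + cexp w) z _ _ dk'
    (cderD (cder_cst a z) (is_derive_cexp z)))).
have := goursat _ pi0 du; rewrite ler_ln ?posrE// => /(_ r12).
rewrite /rect_int.
have -> : (fun t => u (t +i* (2 * pi))) = (fun t => u (t +i* 0)).
  apply/funext => t; rewrite /u /= !cexp_real_imag cis2pi cis0//.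
have E rho : 0 < rho -> (fun t => u (ln rho +i* t)) = (fun t => k (a + rho%:C * cis t)).
  by move=> rho0; apply/funext => t; rewrite /u /= cexp_real_imag lnK.
rewrite (E _ r10) (E _ r20) => /eqP.
rewrite (_ : _ - _ = 'i * (cint 0 (2 * pi) (fun t => k (a + rho2%:C * cis t)) -
   cint 0 (2 * pi) (fun t => k (a + rho1%:C * cis t)))); last by ring.
rewrite mulf_eq0 subr_eq0 => /orP[/eqP|/eqP //].
by move=> /(congr1 (@complex.Im R)) /= /eqP; rewrite oner_eq0.
Qed.

(** By [circle_int_const] the radius may shrink until the integrand is uniformly close to its limit
    [l] at the puncture. Only the punctured disc enters, so difference quotients are allowed. *)
Lemma circle_int_lim k a (rr rho : R) l : 0 < rho -> rho < rr ->
  (forall z, 0 < cmod (z - a) < rr -> derivable k z (1 : R[i])) ->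
  (forall e : R, 0 < e -> exists2 d : R, 0 < d &
     forall z, 0 < cmod (z - a) < d -> cmod (k z - l) < e) ->
  cint 0 (2 * pi) (fun t => k (a + rho%:C * cis t)) = (2 * pi)%:C * l.
Proof.
move=> rho0 rhor dk kl.
have pi0 : 0 < 2 * pi :> R by rewrite mulr_gt0// pi_gt0.
have mc (x : R) t : 0 < x -> cmod (a + x%:C * cis t - a) = x.
  by move=> x0; rewrite addrC addKr cmodM cmod_cis mulr1 cmod_real gtr0_norm.
have kc (x : R) : 0 < x < rr -> ccts_on 0 (2 * pi) (fun t => k (a + x%:C * cis t)).
  move=> /andP[x0 xr] t _; apply: (@ctsC_ccts _ k (fun t => a + x%:C * cis t)).
    by apply: derivable_ctsC; apply: dk; rewrite mc// x0.
  exact: ccts_circle.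
apply/eqP; rewrite -subr_eq0 -cmod_eq0 eq_le cmod_ge0 andbT; apply/ler_addgt0Pl => e e0.
rewrite addr0.
have [d d0 Hd] := kl (e / (2 * pi)) (divr_gt0 e0 pi0).
pose x := Num.min rho (d / 2).
have x0 : 0 < x by rewrite lt_min rho0 divr_gt0.
have xrho : x <= rho by rewrite ge_min lexx.
have xd : x < d by rewrite gt_min; apply/orP; right; lra.
rewrite -(circle_int_const x0 xrho rhor dk).
have -> : (2 * pi)%:C * l = cint 0 (2 * pi) (fun=> l).
  by rewrite cint_cst ?ltW// subr0.
rewrite -cintB; last 2 first.
- by apply: kc; rewrite x0 (le_lt_trans xrho).
- by move=> t _; exact: ccts_cst.
apply: le_trans (cint_bound (M := e / (2 * pi)) (ltW pi0) _ _) _.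
- move=> t tt; apply: cctsB; last exact: ccts_cst.
  by apply: kc => //; rewrite x0 (le_lt_trans xrho).
- by move=> t _; apply/ltW/Hd; rewrite mc// x0.
- by rewrite subr0 divfK// gt_eqF.
Qed.

Definition holo f a rr := forall z, cmod (z - a) < rr -> derivable f z (1 : R[i]).

Lemma mean_value f a rr rho : 0 < rho -> rho < rr -> holo f a rr ->
  cint 0 (2 * pi) (fun t => f (a + rho%:C * cis t)) = (2 * pi)%:C * f a.
Proof.
move=> rho0 rhor hf; apply: (circle_int_lim rho0 rhor).
  by move=> z /andP[_]; exact: hf.
move=> e e0; have [|d d0 Hd] := @derivable_ctsC _ f a _ e e0.
  by apply: hf; rewrite subrr cmod0 (lt_trans rho0).
by exists d => // z /andP[_ /Hd]; rewrite (addrC a) subrK.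
Qed.

(** The difference quotient at [a] has the limit [f'(a)] at the puncture, so its mean is known; the
    remaining term [f a / (rho cis t)] integrates to zero because [cis (- t)] has a periodic
    primitive. *)
Lemma derivative_formula f a rr rho : 0 < rho -> rho < rr -> holo f a rr ->
  cint 0 (2 * pi) (fun t => f (a + rho%:C * cis t) * (rho%:C * cis t)^-1) =
  (2 * pi)%:C * f^`()%classic a.
Proof.
move=> rho0 rhor hf.
have rc t : rho%:C * cis t != 0.
  by rewrite -cmod_gt0 cmodM cmod_cis mulr1 cmod_real gtr0_norm.
have da : derivable f a (1 : R[i]) by apply: hf; rewrite subrr cmod0 (lt_trans rho0).
pose k z := (f z - f a) / (z - a).
have : cint 0 (2 * pi) (fun t => k (a + rho%:C * cis t)) = (2 * pi)%:C * f^`()%classic a.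
  apply: (circle_int_lim rho0 rhor).
    move=> z /andP[za zr]; apply: derivableM; last first.
      by apply: derivableV; [rewrite -cmod_gt0|apply: derivableB; [exact: derivable_id|exact: derivable_cst]].
    by apply: derivableB; [exact: hf|exact: derivable_cst].
  move=> e e0.
  have [//|d d0 Hd] := (is_deriveP f a _).1 (derive1P da) (e / 2); first by rewrite divr_gt0.
  exists d => // z /andP[z0 zd]; have := Hd _ zd; rewrite (addrC a) subrK => H.
  have za : z - a != 0 by rewrite -cmod_gt0.
  rewrite /k (_ : _ - _ = (f z - f a - f^`()%classic a * (z - a)) / (z - a)); last by field.
  rewrite cmodM cmodV ltr_pdivrMr// (le_lt_trans H)// ltr_pM2r//; lra.
move=> <-.
have cc (u : R[i] -> R[i]) : holo u a rr -> ccts_on 0 (2 * pi) (fun t => u (a + rho%:C * cis t)).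
  move=> hu t _; apply: (@ctsC_ccts _ u (fun t => a + rho%:C * cis t)); last exact: ccts_circle.
  apply: derivable_ctsC; apply: hu.
  by rewrite addrC addKr cmodM cmod_cis mulr1 cmod_real gtr0_norm.
have ci t : ccts (fun t => (rho%:C * cis t)^-1) t.
  rewrite (_ : (fun t => _) = (fun t => rho^-1%:C * (cis (- t)))).
    apply: cctsM; first exact: ccts_cst.
    split; rewrite /=.
      rewrite (_ : (fun x => _) = cos); first exact: continuous_cos.
      by apply/funext => x; rewrite cosN.
    rewrite (_ : (fun x => _) = (fun x => - sin x)).
      by apply: continuousN; exact: continuous_sin.
    by apply/funext => x; rewrite sinN.
  by apply/funext => x; rewrite invfM cisN fmorphV.
have c0 : cint 0 (2 * pi) (fun t => (rho%:C * cis t)^-1) = 0.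
  rewrite (@cint_FTC _ _ _ _ (fun t => 'i / rho%:C * cis (- t))).
  - by rewrite oppr0 cisN cis2pi cis0 invr1 subrr.
  - by rewrite mulr_ge0// pi_ge0.
  - move=> t _; have := pderiveZ ('i / rho%:C) (pderive_cisN t).
    rewrite (_ : 'i / rho%:C * (- 'i * cis (- t)) = (rho%:C * cis t)^-1)// cisN invfM.
    rewrite mulrA; congr (_ * _); rewrite mulrAC mulrN -expr2 sqr_i opprK mul1r//.
  - by move=> t _; exact: ci.
rewrite -[LHS]subr0 -(mulr0 (f a)) -c0 -cintZ; last by move=> t _; exact: ci.
rewrite -cintB.
- by apply: eq_cint => t _; rewrite /k addrAC subrr add0r; ring.
- by move=> t tt; apply: cctsM; [exact: cc|exact: ci].
- by move=> t tt; apply: cctsM; [exact: ccts_cst|exact: ci].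
Qed.

End CircleMean.

(** * Holomorphic functions on a disc *)

Section Disc.
Context {R : realType}.
Implicit Types (f g : R[i] -> R[i]) (a z w h : R[i]) (r rr rho M : R).

Definition rctsC (v : R[i] -> R) z := forall e : R, 0 < e ->
  exists2 d : R, 0 < d & forall h, cmod h < d -> `|v (z + h) - v z| < e.

(** Polar coordinates present the closed disc as a continuous image of the compact rectangle [[0, r]
    x [0, 2 pi]], where the extreme value theorem applies. *)
Lemma disc_max (v : R[i] -> R) a r : 0 <= r ->
  (forall z, cmod (z - a) <= r -> rctsC v z) ->
  exists2 z0, cmod (z0 - a) <= r & forall z, cmod (z - a) <= r -> v z <= v z0.
Proof.
move=> r0 vc.
pose P (p : R * R) := a + p.1%:C * cis p.2.
pose K := `[0, r]%classic `*` `[0, 2 * pi]%classic : set (R * R).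
have PK p : K p -> cmod (P p - a) <= r.
  move=> [] /=; rewrite !in_itv /= => /andP[p0 pr] _.
  by rewrite /P (addrC a) addrK cmodM cmod_cis mulr1 cmod_real ger0_norm.
have Kc : compact K by apply: compact_setX; exact: segment_compact.
have K0 : K !=set0.
  exists (0, 0); split; rewrite /= in_itv /= lexx //= mulr_ge0// pi_ge0//.
have vPc : {within K, continuous (v \o P)}.
  apply: continuous_in_subspaceT => p; rewrite inE => /PK pa.
  apply/cvgrPdist_lt => e e0; have [d d0 Hd] := vc _ pa e e0.
  have c1 : {for p, continuous (fun q : R * R => q.1 * cos q.2)}.
    apply: continuousM; first exact: cvg_fst.
    by apply: (continuous_comp (f := snd) (g := cos)); [exact: cvg_snd|exact: continuous_cos].
  have c2 : {for p, continuous (fun q : R * R => q.1 * sin q.2)}.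
    apply: continuousM; first exact: cvg_fst.
    by apply: (continuous_comp (f := snd) (g := sin)); [exact: cvg_snd|exact: continuous_sin].
  have d2 : 0 < d / 2 by rewrite divr_gt0.
  move/cvgrPdist_lt : c1 => /(_ _ d2) n1; move/cvgrPdist_lt : c2 => /(_ _ d2) n2.
  near=> q.
  have q1 : `|p.1 * cos p.2 - q.1 * cos q.2| < d / 2 by near: q.
  have q2 : `|p.1 * sin p.2 - q.1 * sin q.2| < d / 2 by near: q.
  have := Hd (P q - P p); rewrite (addrC (P p)) subrK distrC; apply.
  apply: le_lt_trans (cmod_le_ReIm _) _.
  rewrite /P !(ReD, ImD, ReN, ImN, ReM, ImM) /= !mul0r !subr0 !addr0.
  rewrite opprD addrACA subrr add0r opprD addrACA subrr add0r.
  by rewrite distrC [X in _ + X]distrC [ltRHS](splitr d) ltrD.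
have [p pK Hp] := compact_EVT_max K0 Kc vPc.
exists (P p); first by apply: PK; rewrite inE in pK.
move=> z za; have [t /andP[t0 t2] zE] := polar (z - a).
have -> : z = P (cmod (z - a), t) by rewrite /P /= -zE addrC subrK.
apply: Hp; rewrite inE; split; rewrite /= in_itv /=; first by rewrite cmod_ge0.
by rewrite t0 ltW.
Unshelve. all: by end_near.
Qed.

Lemma ctsC_cmod f z : ctsC f z -> rctsC (fun w => cmod (f w)) z.
Proof.
move=> fc e /fc [d d0 Hd]; exists d => // h /Hd; apply: le_lt_trans.
by rewrite ler_norml cmod_subl andbT lerNl opprB cmodBC cmod_subl.
Qed.

Lemma holo_bounded f a rr r : 0 <= r -> r < rr -> holo f a rr ->
  exists2 M, 0 <= M & forall z, cmod (z - a) <= r -> cmod (f z) <= M.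
Proof.
move=> r0 rrr hf; have [|z0 _ Hz] := @disc_max (fun z => cmod (f z)) a r r0.
  by move=> z zr; apply/ctsC_cmod/derivable_ctsC/hf/(le_lt_trans zr).
by exists (cmod (f z0)); [exact: cmod_ge0|].
Qed.

Lemma circle_cmod (a : R[i]) (rho t : R) : 0 <= rho -> cmod (a + rho%:C * cis t - a) = rho.
Proof. by move=> r0; rewrite addrAC subrr add0r cmodM cmod_cis mulr1 cmod_real ger0_norm. Qed.

Lemma holo_sub f a rr b r : holo f a rr -> cmod (b - a) + r <= rr -> holo f b r.
Proof.
move=> hf H z zb; apply: hf; apply: lt_le_trans H.
have -> : z - a = (b - a) + (z - b) by ring.
by apply: le_lt_trans (cmodD _ _) _; rewrite ltrD2l.
Qed.

Lemma holo_ccts_circle f a rr rho t : 0 <= rho -> rho < rr -> holo f a rr ->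
  ccts (fun x => f (a + rho%:C * cis x)) t.
Proof.
move=> r0 rrr hf; apply: (@ctsC_ccts _ f (fun t => a + rho%:C * cis t)); last exact: ccts_circle.
by apply: derivable_ctsC; apply: hf; rewrite circle_cmod.
Qed.

Lemma ccts_circle_inv (rho t : R) : ccts (fun t => (rho%:C * cis t)^-1 : R[i]) t.
Proof.
have -> : (fun t => (rho%:C * cis t)^-1) = (fun t => (rho%:C)^-1 * (cis (- t))) :> (R -> R[i]).
  by apply/funext => x; rewrite invfM cisN.
by apply: cctsM; [exact: ccts_cst|exact: pderive_ccts (pderive_cisN t)].
Qed.

Lemma cmod_circle_inv (rho t : R) : 0 < rho -> cmod ((rho%:C * cis t)^-1) = rho^-1.
Proof. by move=> r0; rewrite cmodV cmodM cmod_cis mulr1 cmod_real gtr0_norm. Qed.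

Lemma twopi_gt0 : 0 < 2 * pi :> R.
Proof. by rewrite mulr_gt0// pi_gt0. Qed.

Lemma cauchy_estimate f a rr rho M : 0 < rho -> rho < rr -> holo f a rr ->
  (forall z, cmod (z - a) = rho -> cmod (f z) <= M) -> cmod (f^`()%classic a) <= M / rho.
Proof.
move=> r0 rrr hf fM; have p0 := twopi_gt0.
have := derivative_formula r0 rrr hf => /(congr1 cmod).
rewrite cmodM cmod_real gtr0_norm// => E.
rewrite -(ler_pM2l p0) -E (_ : 2 * pi * (M / rho) = M / rho * (2 * pi - 0)); last by rewrite subr0 mulrC.
apply: cint_bound; first exact: ltW.
  move=> t _; apply: cctsM; last exact: ccts_circle_inv.
  exact: holo_ccts_circle (ltW r0) rrr hf.
move=> t _; rewrite cmodM cmod_circle_inv// ler_wpM2r ?invr_ge0 ?(ltW r0)//.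
by apply: fM; rewrite circle_cmod// ltW.
Qed.

Lemma holo_derive f a rr z : holo f a rr -> cmod (z - a) < rr ->
  is_derive z (1 : R[i]) f (f^`()%classic z).
Proof. by move=> hf /hf; exact: derive1P. Qed.

Lemma segment_in_disc a z h r (t : R) : 0 <= t <= 1 ->
  cmod (z - a) + cmod h <= r -> cmod (z + t%:C * h - a) <= r.
Proof.
move=> /andP[t0 t1]; apply: le_trans; rewrite addrAC.
apply: le_trans (cmodD _ _) _; rewrite lerD2l cmodM cmod_real ger0_norm//.
by rewrite ler_piMl// cmod_ge0.
Qed.

Lemma holo_lipschitz f a rr r z h M : holo f a rr -> r < rr ->
  (forall w, cmod (w - a) <= r -> cmod (f^`()%classic w) <= M) ->
  cmod (z - a) + cmod h <= r -> cmod (f (z + h) - f z) <= M * cmod h.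
Proof.
move=> hf rrr fM zh; apply: (@is_derive_mvt _ f z h (f^`()%classic)) => t t01.
  by apply: (holo_derive hf); apply: le_lt_trans rrr; exact: segment_in_disc.
by apply: fM; exact: segment_in_disc.
Qed.

(** Regularity of [f'] is not yet available, so its Lipschitz constant comes from Cauchy's estimate
    for the difference [w |-> f (w + h) - f w], itself of size O(|h|). The quadratic bound then
    follows from the mean value inequality. All constants are uniform on the disc of radius [r]. *)
Lemma taylor1 f a rr r : 0 <= r -> r < rr -> holo f a rr ->
  exists L eta : R, [/\ 0 < eta, r + eta < rr, 0 <= L &
    forall z h, cmod (z - a) <= r -> cmod h < eta ->
    [/\ cmod (f (z + h) - f z) <= L * cmod h,
        cmod (f^`()%classic (z + h) - f^`()%classic z) <= L * cmod h &
        cmod (f (z + h) - f z - f^`()%classic z * h) <= L * cmod h ^+ 2]].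
Proof.
move=> r0 rrr hf.
(* The gap is cut into four collars of width [d]: [f] is bounded up to [r + 3 * d], [f'] up to
   [r + 2 * d], differences of [f] are controlled up to [r + d], and the last collar keeps
   everything inside the open disc. *)
pose d := (rr - r) / 4; have d0 : 0 < d by rewrite divr_gt0// subr_gt0.
have d4 : rr = r + 4 * d by rewrite /d mulrC divfK// addrC subrK.
have r3 : 0 <= r + 3 * d by lra.
have r4 : r + 3 * d < rr by lra.
have [M M0 HM] := holo_bounded r3 r4 hf.
have HM1 w : cmod (w - a) <= r + 2 * d -> cmod (f^`()%classic w) <= M / d.
  move=> wr; apply: (@cauchy_estimate f w (2 * d)); [exact: d0|lra| |].
    by apply: holo_sub hf _; lra.
  move=> z zw; apply: HM; have -> : z - a = (z - w) + (w - a) by ring.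
  by apply: le_trans (cmodD _ _) _; rewrite zw; lra.
have hb : holo f a (r + 2 * d) by apply: holo_sub hf _; rewrite subrr cmod0; lra.
have L1 z h : cmod (z - a) <= r + d -> cmod h < d -> cmod (f (z + h) - f z) <= M / d * cmod h.
  by move=> zr hd; apply: (@holo_lipschitz f a rr (r + 2 * d)) => //; lra.
have L2 z h : cmod (z - a) <= r -> cmod h < d ->
    cmod (f^`()%classic (z + h) - f^`()%classic z) <= M / d * cmod h / (d / 2).
  move=> zr hd.
  have D w : cmod (w - z) < d -> is_derive w (1 : R[i]) (fun w => f (w + h) - f w)
      (f^`()%classic (w + h) - f^`()%classic w).
    move=> wz; have wa : cmod (w - a) < r + d.
      have -> : w - a = (w - z) + (z - a) by ring.
      by apply: le_lt_trans (cmodD _ _) _; lra.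
    apply: cderB; last by apply: (holo_derive hf); lra.
    have Hs : is_derive w (1 : R[i]) (fun w => w + h) 1.
      by apply: cder_eq (cderD (cder_id w) (cder_cst h w)) _; rewrite addr0.
    apply: cder_eq (@is_derive_ccomp _ f (fun w => w + h) w _ _ _ Hs) _; last exact: mulr1.
    apply: (holo_derive hf); rewrite addrAC; apply: le_lt_trans (cmodD _ _) _; lra.
  rewrite -(is_derive_derive1 (D z _)); last by rewrite subrr cmod0.
  apply: (@cauchy_estimate _ z d); [lra|lra| |].
    by move=> w /D; exact: cder_derivable.
  move=> w wz; apply: L1 => //; have -> : w - a = (w - z) + (z - a) by ring.
  by apply: le_trans (cmodD _ _) _; rewrite wz; lra.
pose L := M / d + M / d / (d / 2).
have Md : 0 <= M / d by rewrite divr_ge0// ltW.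
have Mdd : 0 <= M / d / (d / 2) by rewrite divr_ge0// ltW// divr_gt0.
exists L, d; split; [exact: d0|lra|by rewrite addr_ge0|].
have L2' z h : cmod (z - a) <= r -> cmod h < d ->
    cmod (f^`()%classic (z + h) - f^`()%classic z) <= L * cmod h.
  move=> zr hd; apply: le_trans (L2 z h zr hd) _.
  by rewrite mulrAC ler_wpM2r ?cmod_ge0// /L lerDr.
move=> z h zr hd; split; [|exact: L2'|].
  by apply: le_trans (L1 z h _ hd) _; [lra|rewrite ler_wpM2r ?cmod_ge0// /L lerDl].
pose F w := f w - f^`()%classic z * w.
have := @is_derive_mvt _ F z h (fun w => f^`()%classic w - f^`()%classic z) (L * cmod h).
have -> : F (z + h) - F z = f (z + h) - f z - f^`()%classic z * h by rewrite /F; ring.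
rewrite -mulrA -expr2; apply => t t01.
  apply: cderB; last by apply: cder_eq (cderZ _ (cder_id _)) _; rewrite mulr1.
  by apply: (holo_derive hf); apply: le_lt_trans (segment_in_disc t01 (lexx _)) _; lra.
have th : cmod (t%:C * h) <= cmod h.
  by case/andP: t01 => t0 t1; rewrite cmodM cmod_real ger0_norm// ler_piMl// cmod_ge0.
apply: le_trans (L2' z (t%:C * h) zr (le_lt_trans th hd)) _.
by rewrite ler_wpM2l// addr_ge0.
Qed.

Lemma cder_near f g z d (eta : R) : 0 < eta ->
  (forall h, cmod h < eta -> f (z + h) = g (z + h)) ->
  is_derive z (1 : R[i]) g d -> is_derive z (1 : R[i]) f d.
Proof.
move=> eta0 fg /is_deriveP Hg; apply/is_deriveP => e /Hg [t t0 Ht].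
exists (Num.min t eta); first by rewrite lt_min t0.
move=> h; rewrite lt_min => /andP[/Ht + /fg ->].
by have := fg 0; rewrite addr0 => ->; rewrite ?cmod0.
Qed.

Lemma holo_ctsC_derive f a rr z : holo f a rr -> cmod (z - a) < rr -> ctsC f^`()%classic z.
Proof.
move=> hf zr; have [L [eta [e0 _ L0 H]]] := taylor1 (cmod_ge0 _) zr hf.
move=> e ep; exists (Num.min eta (e / (L + 1))).
  by rewrite lt_min e0 divr_gt0// ltr_wpDl.
move=> h; rewrite lt_min ltr_pdivlMr ?ltr_wpDl// => /andP[h1 h2].
have [_ H2 _] := H z h (lexx _) h1; apply: le_lt_trans H2 _.
by have := cmod_ge0 h; nra.
Qed.

(** The mean of [f (w + c) / c] over a small circle of values [c] is [f'(w)]; differentiating in [w]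
    under the integral sign, with the quadratic remainder of [taylor1], shows that [f'] is
    differentiable. *)
Lemma holo_derivative f a rr : holo f a rr -> holo f^`()%classic a rr.
Proof.
move=> hf z zr.
pose rho := (rr - cmod (z - a)) / 3.
have rho0 : 0 < rho by rewrite divr_gt0// subr_gt0.
have rE : rr = cmod (z - a) + 3 * rho by rewrite /rho mulrC divfK// addrC subrK.
pose phi w t := f (w + rho%:C * cis t) * (rho%:C * cis t)^-1.
pose psi t := f^`()%classic (z + rho%:C * cis t) * (rho%:C * cis t)^-1.
have [||L [eta [e0 e1 L0 HL]]] := @taylor1 f a rr (cmod (z - a) + rho) _ _ hf.
- by rewrite addr_ge0 ?cmod_ge0// ltW.
- by lra.
have pi0 := ltW twopi_gt0.
have near_z h : cmod h < rho -> holo f (z + h) (2 * rho).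
  move=> hr; apply: holo_sub hf _; rewrite addrAC.
  by have := cmodD (z - a) h; lra.
have za t : cmod (z + rho%:C * cis t - a) <= cmod (z - a) + rho.
  have -> : z + rho%:C * cis t - a = (z - a) + (z + rho%:C * cis t - z) by ring.
  by apply: le_trans (cmodD _ _) _; rewrite circle_cmod// ltW.
have H : is_derive z (1 : R[i]) (fun w => cint 0 (2 * pi) (phi w)) (cint 0 (2 * pi) psi).
  apply: (@is_derive_cint _ _ _ phi psi z (L / rho) (Num.min rho eta)) => //.
  - by rewrite lt_min rho0.
  - move=> h; rewrite lt_min => /andP[hr _] t _; rewrite /phi.
    apply: cctsM; last exact: ccts_circle_inv.
    by apply: (holo_ccts_circle _ (ltW rho0) _ (near_z h hr)); lra.
  - move=> t _; apply: cctsM; last exact: ccts_circle_inv.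
    apply: (@ctsC_ccts _ f^`()%classic (fun t => z + rho%:C * cis t)); last exact: ccts_circle.
    by apply: (holo_ctsC_derive hf); apply: le_lt_trans (za t) _; lra.
  - move=> h t; rewrite lt_min => /andP[_ he] _; rewrite /phi /psi.
    set c := rho%:C * cis t.
    have -> : f (z + h + c) / c - f (z + c) / c - f^`()%classic (z + c) / c * h =
      (f (z + c + h) - f (z + c) - f^`()%classic (z + c) * h) / c.
      by rewrite (addrAC z h c); ring.
    rewrite cmodM cmod_circle_inv// mulrAC ler_wpM2r ?invr_ge0 ?(ltW rho0)//.
    by have [_ _] := HL (z + c) h (za t) he.
apply: (@cder_derivable _ _ _ ((2 * pi)%:C^-1 * cint 0 (2 * pi) psi)).
apply: (@cder_near _ (fun w => (2 * pi)%:C^-1 * cint 0 (2 * pi) (phi w)) _ _ rho) => //.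
  move=> h hr; have r2 : rho < 2 * rho by lra.
  rewrite (derivative_formula rho0 r2 (near_z h hr)) mulrA mulVf ?mul1r//.
  by rewrite -cmod_gt0 cmod_real gtr0_norm// twopi_gt0.
Qed.

Lemma pderiveM (u v : R -> R[i]) (t : R) du dv : pderive u t du -> pderive v t dv ->
  pderive (fun x => u x * v x) t (du * v t + u t * dv).
Proof.
move=> /pderiveP[u1 u2] /pderiveP[v1 v2]; apply/pderiveP; split.
  rewrite (_ : (fun x => _) = (fun x => complex.Re (u x) * complex.Re (v x) -
     complex.Im (u x) * complex.Im (v x))); last by apply/funext => x; rewrite ReM.
  by apply: is_derive_eq; rewrite !(ReD, ReM) /GRing.scale /=; ring.
rewrite (_ : (fun x => _) = (fun x => complex.Re (u x) * complex.Im (v x) +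
     complex.Im (u x) * complex.Re (v x))); last by apply/funext => x; rewrite ImM.
by apply: is_derive_eq; rewrite !(ImD, ImM) /GRing.scale /=; ring.
Qed.

(** Integrate along the segment from [a] to [z]. Differentiating under the integral sign gives
    [q + t (z - a) q'], the derivative in [t] of [t q (a + t (z - a))], which integrates to
    [q z]. *)
Lemma holo_primitive q a rr : holo q a rr ->
  exists G, forall z, cmod (z - a) < rr -> is_derive z (1 : R[i]) G (q z).
Proof.
move=> hq.
exists (fun z => cint 0 1 (fun t => q (a + t%:C * (z - a)) * (z - a))) => z zr.
have inz (t : R) : 0 <= t <= 1 -> cmod (a + t%:C * (z - a) - a) <= cmod (z - a).
  by move=> t01; apply: segment_in_disc => //; rewrite subrr cmod0 add0r.
have [L [eta [e0 e1 L0 HL]]] := @taylor1 q a rr (cmod (z - a)) (cmod_ge0 _) zr hq.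
pose psi (t : R) := 1 * q (a + t%:C * (z - a)) + t%:C * (q^`()%classic (a + t%:C * (z - a)) * (z - a)).
have qc (t : R) : 0 <= t <= 1 -> ccts (fun t => q^`()%classic (a + t%:C * (z - a))) t.
  move=> t01; apply: (@ctsC_ccts _ q^`()%classic (fun t => a + t%:C * (z - a))).
    by apply: (holo_ctsC_derive hq); exact: le_lt_trans (inz t t01) zr.
  exact: pderive_ccts (pderive_segment _ _ t).
have qc0 w (t : R) : cmod (w - a) < rr -> 0 <= t <= 1 -> ccts (fun t => q (a + t%:C * (w - a))) t.
  move=> wr t01; apply: (@ctsC_ccts _ q (fun t => a + t%:C * (w - a))).
    apply: derivable_ctsC; apply: hq; apply: le_lt_trans wr.
    by apply: segment_in_disc => //; rewrite subrr cmod0 add0r.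
  exact: pderive_ccts (pderive_segment _ _ t).
have tc (t : R) : ccts (fun t => t%:C) t.
  have := pderive_ccts (pderive_segment 0 1 t).
  by under eq_fun do rewrite add0r mulr1.
have psic : ccts_on 0 1 psi.
  move=> t t01; apply: cctsD; apply: cctsM => //.
  - exact: ccts_cst.
  - exact: qc0.
  - by apply: cctsM; [exact: qc|exact: ccts_cst].
have -> : q z = cint 0 1 psi.
  rewrite (@cint_FTC _ 0 1 psi (fun t => t%:C * q (a + t%:C * (z - a))))//.
    by rewrite mul0r subr0 !mul1r (addrC a) subrK.
  move=> t t01; apply: pderiveM.
    have := pderive_segment 0 1 t.
    by under eq_fun do rewrite add0r mulr1.
  apply: (@pderive_comp _ q); last exact: pderive_segment.
  by apply: (holo_derive hq); exact: le_lt_trans (inz t t01) zr.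
apply: (@is_derive_cint _ 0 1 (fun z t => q (a + t%:C * (z - a)) * (z - a)) psi z
   (L * cmod (z - a) + L) eta) => //.
  move=> h he t t01; apply: cctsM; last exact: ccts_cst.
  apply: qc0 => //; rewrite addrAC; apply: le_lt_trans (cmodD _ _) _; lra.
move=> h t he t01; set zeta := a + t%:C * (z - a).
have th : cmod (t%:C * h) <= cmod h.
  by case/andP: t01 => t0 t1; rewrite cmodM cmod_real ger0_norm// ler_piMl// cmod_ge0.
have [H1 _ H2] := HL zeta (t%:C * h) (inz t t01) (le_lt_trans th he).
have -> : a + t%:C * (z + h - a) = zeta + t%:C * h by rewrite /zeta; ring.
rewrite (_ : _ - _ = (q (zeta + t%:C * h) - q zeta - q^`()%classic zeta * (t%:C * h)) * (z - a)
   + (q (zeta + t%:C * h) - q zeta) * h); last by rewrite /psi -/zeta; ring.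
apply: le_trans (cmodD _ _) _; rewrite !cmodM mulrDl; apply: lerD.
  rewrite mulrAC ler_wpM2r ?cmod_ge0//; apply: le_trans H2 _.
  by rewrite ler_wpM2l// ler_pXn2r// nnegrE cmod_ge0.
rewrite expr2 mulrA ler_wpM2r ?cmod_ge0//; apply: le_trans H1 _.
by rewrite ler_wpM2l.
Qed.

Lemma holo_const f a rr : (forall z, cmod (z - a) < rr -> is_derive z (1 : R[i]) f 0) ->
  forall z, cmod (z - a) < rr -> f z = f a.
Proof.
move=> Hf z zr; apply/eqP; rewrite -subr_eq0 -cmod_eq0 eq_le cmod_ge0 andbT.
have := @is_derive_mvt _ f a (z - a) (cst 0) 0.
rewrite mul0r (addrC a (z - a)) subrK; apply => t t01; last by rewrite cmod0.
apply: Hf; apply: le_lt_trans zr; apply: segment_in_disc => //.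
by rewrite subrr cmod0 add0r.
Qed.

End Disc.

(** * Entire functions *)

Section EntireFunctions.
Context {R : realType}.
Implicit Types (f g : R[i] -> R[i]) (a b z w h c : R[i]) (r rr rho M : R).

Lemma entire_holo f a rr : entire f -> holo f a rr.
Proof. by move=> ef z _; exact: ef. Qed.

Lemma entire_is_derive f z : entire f -> is_derive z (1 : R[i]) f (f^`()%classic z).
Proof. by move=> ef; exact: derive1P. Qed.

Lemma entire_derivative f : entire f -> entire f^`()%classic.
Proof.
move=> ef z; have := @holo_derivative _ f z 1 (entire_holo ef).
by apply; rewrite subrr cmod0.
Qed.

Lemma entire_derive1n f n : entire f -> entire f^`(n)%classic.
Proof.
move=> ef; elim: n => [//|n ih]; rewrite derive1nS; exact: entire_derivative.
Qed.

Lemma eq_entire f g : f =1 g -> entire f -> entire g.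
Proof. by move=> fg ef; rewrite (_ : g = f)//; apply/funext => z. Qed.

Lemma entireD f g : entire f -> entire g -> entire (fun z => f z + g z).
Proof. by move=> ef eg z; exact: cder_derivable (cderD (entire_is_derive z ef) (entire_is_derive z eg)). Qed.

Lemma entireB f g : entire f -> entire g -> entire (fun z => f z - g z).
Proof. by move=> ef eg z; exact: cder_derivable (cderB (entire_is_derive z ef) (entire_is_derive z eg)). Qed.

Lemma entireM f g : entire f -> entire g -> entire (fun z => f z * g z).
Proof. by move=> ef eg z; exact: cder_derivable (cderM (entire_is_derive z ef) (entire_is_derive z eg)). Qed.

Lemma entire_cst c : entire (fun=> c).
Proof. by move=> z; exact: cder_derivable (cder_cst c z). Qed.

Lemma entire_id : entire (fun z : R[i] => z).
Proof. by move=> z; exact: cder_derivable (cder_id z). Qed.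

Lemma entire_prod (I : Type) (s : seq I) (F : I -> R[i] -> R[i]) :
  (forall i, entire (F i)) -> entire (fun z => \prod_(i <- s) F i z).
Proof.
move=> eF; elim: s => [|i s ih].
  by apply: (@eq_entire (fun=> 1)) => [z|]; [rewrite big_nil|exact: entire_cst].
have H := entireM (eF i) ih.
by apply: (@eq_entire (fun z => F i z * \prod_(j <- s) F j z)) => [z|]; [rewrite big_cons|exact: H].
Qed.

Lemma entire_sum (I : Type) (s : seq I) (F : I -> R[i] -> R[i]) :
  (forall i, entire (F i)) -> entire (fun z => \sum_(i <- s) F i z).
Proof.
move=> eF; elim: s => [|i s ih].
  by apply: (@eq_entire (fun=> 0)) => [z|]; [rewrite big_nil|exact: entire_cst].
have H := entireD (eF i) ih.
by apply: (@eq_entire (fun z => F i z + \sum_(j <- s) F j z)) => [z|]; [rewrite big_cons|exact: H].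
Qed.

Lemma entire_cexp c : entire (fun z => cexp (c * z)).
Proof.
move=> z; apply: cder_derivable.
exact: (@is_derive_ccomp _ cexp (fun w => c * w) z _ _ (is_derive_cexp _) (cderZ c (cder_id z))).
Qed.

Lemma is_derive_cexpZ c z : is_derive z (1 : R[i]) (fun w => cexp (c * w)) (c * cexp (c * z)).
Proof.
apply: cder_eq (@is_derive_ccomp _ cexp (fun w => c * w) z _ _ (is_derive_cexp _) (cderZ c (cder_id z))) _.
by rewrite mulr1 mulrC.
Qed.

Lemma entire_ctsC f z : entire f -> ctsC f z.
Proof. by move=> ef; exact: derivable_ctsC. Qed.

(** Supplies the derivative of the quotient [(f z - f a) / (z - a)] at its removable point [a]. *)
Lemma taylor2 f a : entire f -> exists L eta : R, [/\ 0 < eta, 0 <= L &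
  forall h, cmod h < eta -> cmod (f (a + h) - f a - f^`()%classic a * h
     - f^`()%classic^`()%classic a / 2 * h ^+ 2) <= L * cmod h ^+ 3].
Proof.
move=> ef.
have [L [eta [e0 _ L0 HL]]] := taylor1 (lexx 0) ltr01 (@entire_holo _ a 1 (entire_derivative ef)).
exists L, eta; split=> // h he.
set d1 := f^`()%classic a; set d2 := f^`()%classic^`()%classic a.
pose F w := f w - d1 * (w - a) - d2 / 2 * ((w - a) * (w - a)).
have := @is_derive_mvt _ F a h (fun w => f^`()%classic w - d1 - d2 * (w - a)) (L * cmod h ^+ 2).
have -> : F (a + h) - F a = f (a + h) - f a - d1 * h - d2 / 2 * h ^+ 2 by rewrite /F; ring.
rewrite (_ : L * cmod h ^+ 2 * cmod h = L * cmod h ^+ 3); last by ring.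
apply => t t01.
  apply: cder_eq (cderB (cderB (entire_is_derive _ ef) (cderZ d1 (cderBid a _)))
    (cderZ (d2 / 2) (cderM (cderBid a _) (cderBid a _)))) _.
  by field.
have th : cmod (t%:C * h) <= cmod h.
  by case/andP: t01 => t0 t1; rewrite cmodM cmod_real ger0_norm// ler_piMl// cmod_ge0.
have [|_ _] := HL a (t%:C * h) _ (le_lt_trans th he); first by rewrite subrr cmod0.
rewrite -/d1 -/d2 (_ : a + t%:C * h - a = t%:C * h); last by rewrite addrAC subrr add0r.
move=> H; apply: le_trans H _.
by rewrite ler_wpM2l// ler_pXn2r// nnegrE cmod_ge0.
Qed.

(** The quotient is completed at [a] by [f'(a)]; its derivative there is [f''(a) / 2], read off the
    second-order expansion. *)
Lemma entire_divide f a : entire f -> f a = 0 ->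
  exists2 g, entire g & forall z, f z = (z - a) * g z.
Proof.
move=> ef fa.
exists (fun z => if z == a then f^`()%classic a else f z / (z - a)); last first.
  move=> z; case: eqP => [->|/eqP za]; first by rewrite fa subrr mul0r.
  by rewrite mulrC divfK// subr_eq0.
move=> z; have [->{z}|za] := eqVneq z a; last first.
  have za0 : z - a != 0 by rewrite subr_eq0.
  have H := cderM (entire_is_derive z ef) (@cderV _ (fun w => w - a) z 1 za0 (cderBid a z)).
  have e0 : 0 < cmod (z - a) by rewrite cmod_gt0.
  apply: (cder_derivable (cder_near e0 _ H)) => h hz; case: eqP => // zha; move: hz.
  by rewrite -zha opprD addrA subrr add0r cmodN ltxx.
have [L [eta [e0 L0 HL]]] := taylor2 a ef.
apply: (@cder_derivable _ _ _ (f^`()%classic^`()%classic a / 2)); apply/is_deriveP => e ep.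
exists (Num.min eta (e / (L + 1))); first by rewrite lt_min e0 divr_gt0// ltr_wpDl.
move=> h; rewrite lt_min ltr_pdivlMr ?ltr_wpDl// => /andP[h1 h2].
rewrite eqxx; have [|ha] := eqVneq (a + h) a.
  move=> /eqP; rewrite -subr_eq0 addrAC subrr add0r => /eqP ->.
  by rewrite subrr mulr0 subrr cmod0 mulr0.
have h0 : h != 0 by apply: contraNneq ha => ->; rewrite addr0.
have := HL h h1; rewrite fa subr0.
set d1 := f^`()%classic a; set d2 := f^`()%classic^`()%classic a => {}HL.
have -> : f (a + h) / (a + h - a) - d1 - d2 / 2 * h =
   (f (a + h) - d1 * h - d2 / 2 * h ^+ 2) / h.
  by rewrite (addrAC a) subrr add0r; field.
have hp : 0 < cmod h by rewrite cmod_gt0.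
rewrite cmodM cmodV ler_pdivrMr//; apply: le_trans HL _.
have -> : L * cmod h ^+ 3 = (L * cmod h) * cmod h * cmod h by ring.
by rewrite !ler_wpM2r// ?(ltW hp)//; nra.
Qed.

(** [G] is a primitive of [g' / g], normalised so that [cexp (G a) = g a]; then [g * cexp (- G)] has
    zero derivative and equals 1 at [a]. *)
Lemma holo_log g a rr : holo g a rr -> (forall z, cmod (z - a) < rr -> g z != 0) ->
  exists2 G, (forall z, cmod (z - a) < rr -> is_derive z (1 : R[i]) G (g^`()%classic z / g z)) &
    forall z, cmod (z - a) < rr -> cexp (G z) = g z.
Proof.
move=> hg g0; have [rr0|rr0] := ltP 0 rr; last first.
  by exists g => z zr; have := le_lt_trans (cmod_ge0 (z - a)) zr; rewrite ltNge rr0.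
have aa : cmod (a - a) < rr by rewrite subrr cmod0.
have hq : holo (fun z => g^`()%classic z * (g z)^-1) a rr.
  move=> z zr; apply: cder_derivable.
  have dg' := holo_derive (holo_derivative hg) zr.
  exact: (cderM dg' (cderV (g0 z zr) (holo_derive hg zr))).
have [G HG] := holo_primitive hq.
have [w0 w0E] := cexp_surj (g0 a aa).
exists (fun z => G z + (w0 - G a)).
  by move=> z zr; apply: cder_eq (cderD (HG z zr) (cder_cst _ z)) _; rewrite addr0.
move=> z zr.
pose k z := g z * cexp (- 1 * (G z + (w0 - G a))).
have Hk w : cmod (w - a) < rr -> is_derive w (1 : R[i]) k 0.
  move=> wr; have d1 := cderD (HG w wr) (cder_cst (w0 - G a) w).
  have d2 := @is_derive_ccomp _ cexp _ w _ _ (is_derive_cexp _) (cderZ (-1) d1).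
  apply: cder_eq (cderM (holo_derive hg wr) d2) _.
  by rewrite /=; field; exact: g0.
have := holo_const Hk zr; rewrite /k addrC (addrC (G a)) subrK !mulN1r.
rewrite (addrC (w0 - G a)) !cexpN w0E divff ?g0// => /eqP.
by rewrite -(inj_eq (mulIf (cexp_neq0 (G z + (w0 - G a))))) divfK ?cexp_neq0// mul1r => /eqP ->.
Qed.

Lemma ln_cmod_cexp z : ln (cmod (cexp z)) = complex.Re z.
Proof. by rewrite cmod_cexp expRK. Qed.

Lemma Re_cint (x y : R) (u : R -> R[i]) : complex.Re (cint x y u) = rint x y (fun t => complex.Re (u t)).
Proof. by []. Qed.

Lemma Re_realM (x : R) z : complex.Re (x%:C * z) = x * complex.Re z.
Proof. by rewrite ReM /= mul0r subr0. Qed.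

(** [ln |g|] is the real part of a holomorphic logarithm, to which the mean value property
    applies. *)
Lemma mean_ln g a rr rho : 0 < rho -> rho < rr -> holo g a rr ->
  (forall z, cmod (z - a) < rr -> g z != 0) ->
  rint 0 (2 * pi) (fun t => ln (cmod (g (a + rho%:C * cis t)))) = 2 * pi * ln (cmod (g a)).
Proof.
move=> r0 rrr hg g0; have [G HG GE] := holo_log hg g0.
have hG : holo G a rr by move=> z /HG; exact: cder_derivable.
have aa : cmod (a - a) < rr by rewrite subrr cmod0 (lt_trans r0).
rewrite -(GE a aa) ln_cmod_cexp -Re_realM -(mean_value r0 rrr hG) Re_cint.
apply: eq_rint => t _; rewrite -GE ?ln_cmod_cexp//.
by rewrite circle_cmod// ltW.
Qed.

Lemma cint_cisN : cint 0 (2 * pi) (fun t => cis (- t)) = 0 :> R[i].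
Proof.
rewrite (@cint_FTC _ _ _ _ (fun t => 'i * cis (- t))).
- by rewrite oppr0 cisN cis2pi cis0 invr1 subrr.
- exact: ltW (twopi_gt0).
- move=> t _; have := pderiveZ 'i (pderive_cisN t).
  by rewrite mulrA mulrN -expr2 sqr_i opprK mul1r.
- by move=> t _; exact: pderive_ccts (pderive_cisN t).
Qed.

(** With [G] a logarithm of [g], the quotient [g' / g] at [a] is [G'(a)], which is [1 / rho] times
    the first Fourier coefficient of [2 Re G] on the circle. Replacing [Re G] by [Re G - A] leaves
    it unchanged and makes the density of one sign, so its modulus is at most [1 / rho] times the
    mean of [2 (A - Re G)], which the mean value property evaluates. *)
Lemma borel_caratheodory g a rr rho (A : R) : 0 < rho -> rho < rr -> holo g a rr ->
  (forall z, cmod (z - a) < rr -> g z != 0) ->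
  (forall z, cmod (z - a) = rho -> ln (cmod (g z)) <= A) ->
  cmod (g^`()%classic a / g a) <= 2 / rho * (A - ln (cmod (g a))).
Proof.
move=> r0 rrr hg g0 gA; have [G HG GE] := holo_log hg g0.
have hG : holo G a rr by move=> z /HG; exact: cder_derivable.
have aa : cmod (a - a) < rr by rewrite subrr cmod0 (lt_trans r0).
have p0 := @twopi_gt0 R; have p0' := ltW p0.
set q := g^`()%classic a / g a.
pose Gc t := G (a + rho%:C * cis t).
have Gcc t : ccts Gc t by exact: holo_ccts_circle (ltW r0) rrr hG.
have cN (t : R) : ccts (fun t => cis (- t)) t by exact: pderive_ccts (pderive_cisN t).
have E1 : cint 0 (2 * pi) (fun t => cis (- t) * Gc t) = (2 * pi * rho)%:C * q.
  have := derivative_formula r0 rrr hG; rewrite (is_derive_derive1 (HG a aa)) -/q => E.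
  have -> : (2 * pi * rho)%:C * q = rho%:C * ((2 * pi)%:C * q) by rewrite rmorphM /=; ring.
  rewrite -E -cintZ; last first.
    by move=> t _; apply: cctsM; [exact: Gcc|exact: ccts_circle_inv].
  apply: eq_cint => t _; rewrite -/(Gc t) invfM cisN.
  have rc : rho%:C != 0 by rewrite -cmod_gt0 cmod_real gtr0_norm.
  by field; rewrite rc cis_neq0.
have E2 : cint 0 (2 * pi) (fun t => cis t * Gc t) = 0.
  have hk : holo (fun z => G z * (z - a)) a rr.
    by move=> z zr; exact: cder_derivable (cderM (HG z zr) (cderBid a z)).
  have := mean_value r0 rrr hk; rewrite subrr !mulr0 => E.
  have rc : rho%:C != 0 by rewrite -cmod_gt0 cmod_real gtr0_norm.
  apply: (mulfI rc); rewrite mulr0 -E -cintZ.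
    by apply: eq_cint => t _; rewrite addrAC subrr add0r -/(Gc t); ring.
  by move=> t _; apply: cctsM; [exact: ccts_cis|exact: Gcc].
pose v t := complex.Re (Gc t).
have vc t : {for t, continuous v} by have [] := Gcc t.
have vcC t : ccts (fun t => (v t)%:C) t by split => //=; exact: cst_continuous.
(* the conjugate of E2 removes the imaginary part of Gc from E1 *)
have E3 : cint 0 (2 * pi) (fun t => cis (- t) * (2 * v t)%:C) = (2 * pi * rho)%:C * q.
  have E2' : cint 0 (2 * pi) (fun t => cis (- t) * (Gc t)^*) = 0.
    have -> : cint 0 (2 * pi) (fun t => cis (- t) * (Gc t)^*) =
        (cint 0 (2 * pi) (fun t => cis t * Gc t))^*.
      have H t : cis (- t) * (Gc t)^* = (cis t * Gc t)^* by rewrite rmorphM /= conj_cis.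
      apply: eqC => /=.
        by apply: eq_rint => t _; rewrite H; case: (cis t * Gc t).
      rewrite -mulN1r -rintZ; last first.
        by move=> t _; have [] := cctsM (ccts_cis t) (Gcc t).
      by apply: eq_rint => t _; rewrite H mulN1r; case: (cis t * Gc t).
    by rewrite E2; apply: eqC; rewrite /= ?oppr0.
  have Gj t : ccts (fun t => (Gc t)^*) t.
    have [c1 c2] := Gcc t; split.
      by rewrite (_ : (fun x => _) = (fun x => complex.Re (Gc x)))//; apply/funext => x; case: (Gc x).
    rewrite (_ : (fun x => _) = (fun x => - complex.Im (Gc x))); first exact: continuousN.
    by apply/funext => x; case: (Gc x).
  rewrite -E1 -[RHS]addr0 -E2' -cintD; last 2 first.
  - by move=> t _; apply: cctsM.
  - by move=> t _; apply: cctsM.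
  apply: eq_cint => t _; rewrite -mulrDr; congr (_ * _).
  by apply: eqC; rewrite ?ReD ?ImD /v; case: (Gc t) => x y /=; ring.
have E4 : cint 0 (2 * pi) (fun t => cis (- t) * (2 * (v t - A))%:C) = (2 * pi * rho)%:C * q.
  rewrite -E3 -[RHS]subr0 -(mulr0 (2 * A)%:C) -cint_cisN -cintZ//.
  rewrite -cintB; last 2 first.
  - move=> t _; apply: cctsM => //; rewrite (_ : (fun x => _) = (fun x => 2%:C * (v x)%:C)).
      by apply: cctsM => //; exact: ccts_cst.
    by apply/funext => x; rewrite rmorphM.
  - by move=> t _; apply: cctsM => //; exact: ccts_cst.
  apply: eq_cint => t _; rewrite mulrBr rmorphB /=; ring.
have vA t : v t <= A.
  have ct : cmod (a + rho%:C * cis t - a) = rho by rewrite circle_cmod// ltW.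
  by have := gA _ ct; rewrite -GE ?ct// ln_cmod_cexp.
have vAc t : {for t, continuous (fun t => 2 * (A - v t))}.
  by apply: continuousM; [exact: cst_continuous|apply: continuousB => //; exact: cst_continuous].
have : cmod (cint 0 (2 * pi) (fun t => cis (- t) * (2 * (v t - A))%:C)) <=
   rint 0 (2 * pi) (fun t => 2 * (A - v t)).
  apply: cint_le => //.
  - move=> t _; apply: cctsM => //; split => /=; last exact: cst_continuous.
    by apply: continuousM; [exact: cst_continuous|apply: continuousB => //; exact: cst_continuous].
  - move=> t _; rewrite cmodM cmod_cis mul1r cmod_real normrM ger0_norm// distrC ger0_norm// subr_ge0//.
rewrite E4 cmodM cmod_real gtr0_norm; last by rewrite !mulr_gt0// pi_gt0.
rewrite rintZ; last by move=> t _; apply: continuousB => //; exact: cst_continuous.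
rewrite rintB//; last by move=> t _; exact: cst_continuous.
rewrite rint_cst// subr0.
have -> : rint 0 (2 * pi) v = 2 * pi * ln (cmod (g a)).
  by rewrite -(GE a aa) ln_cmod_cexp -Re_realM -(mean_value r0 rrr hG) Re_cint.
have -> : 2 * (A * (2 * pi) - 2 * pi * ln (cmod (g a))) =
   2 * pi * rho * (2 / rho * (A - ln (cmod (g a)))).
  by field; rewrite gt_eqF.
by rewrite ler_pM2l// !mulr_gt0// pi_gt0.
Qed.

Lemma Re_mean_le f a rr rho (B : R) : 0 < rho -> rho < rr -> holo f a rr ->
  (forall z, cmod (z - a) = rho -> complex.Re (f z) <= B) -> complex.Re (f a) <= B.
Proof.
move=> r0 rrr hf fB; have p0 := @twopi_gt0 R.
rewrite -(ler_pM2l p0) -Re_realM -(mean_value r0 rrr hf) Re_cint.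
have -> : 2 * pi * B = rint 0 (2 * pi) (fun=> B) by rewrite rint_cst ?ltW// subr0 mulrC.
apply: le_rint.
- by move=> t _; have [] := @holo_ccts_circle _ f a rr rho t (ltW r0) rrr hf.
- by move=> t _; exact: cst_continuous.
- by move=> t _; apply: fB; rewrite circle_cmod// ltW.
Qed.

(* a maximum of |f|^2 + e |z - a|^2 cannot be interior, since its mean over a
   small circle exceeds its value at the centre *)
Lemma max_principle f a rr r M : 0 <= M -> r < rr -> holo f a rr ->
  (forall z, cmod (z - a) = r -> cmod (f z) <= M) ->
  forall z, cmod (z - a) <= r -> cmod (f z) <= M.
Proof.
move=> M0 rrr hf fM z zr; have r0 : 0 <= r by exact: le_trans (cmod_ge0 _) zr.
rewrite -(@ler_pXn2r _ 2) ?nnegrE ?cmod_ge0//.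
apply/ler_addgt0Pr => e e0.
pose ep := e / (r ^+ 2 + 1).
have r21 : 0 < r ^+ 2 + 1 by rewrite ltr_wpDl// sqr_ge0.
have ep0 : 0 < ep by rewrite divr_gt0.
pose v w := cmod (f w) ^+ 2 + ep * cmod (w - a) ^+ 2.
have [|z0 z0r Hz0] := @disc_max _ v a r r0.
  move=> w wr.
  have c1 : ctsC (fun w => f w * f w) w.
    apply: is_derive_cts (cderM _ _); first exact: (holo_derive hf (le_lt_trans wr rrr)).
    exact: (holo_derive hf (le_lt_trans wr rrr)).
  have c2 : ctsC (fun w => (w - a) * (w - a)) w.
    exact: is_derive_cts (cderM (cderBid a w) (cderBid a w)).
  have {}c1 := ctsC_cmod c1; have {}c2 := ctsC_cmod c2.
  move=> t t0; have [|d1 d10 H1] := c1 (t / 2); first by rewrite divr_gt0.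
  have [|d2 d20 H2] := c2 (t / 2 / ep); first by rewrite !divr_gt0.
  exists (Num.min d1 d2); first by rewrite lt_min d10.
  move=> h; rewrite lt_min => /andP[/H1 k1 /H2 k2].
  move: k1 k2; rewrite /v !cmodM -!expr2 => k1; rewrite (ltr_pdivlMr _ _ ep0) => k2.
  rewrite opprD addrACA -mulrBr [ltRHS](splitr t).
  apply: le_lt_trans (ler_normD _ _) _; apply: ltrD => //.
  by rewrite normrM (gtr0_norm ep0) mulrC.
suff Hv : v z0 <= M ^+ 2 + e.
  have vz := le_trans (Hz0 z zr) Hv; apply: le_trans vz.
  by rewrite /v lerDl; apply: mulr_ge0; [exact: ltW|exact: sqr_ge0].
have epr : ep * r ^+ 2 <= e.
  rewrite /ep mulrAC ler_pdivrMr// ler_wpM2l ?ltW// ltrDl ltr01//.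
move: z0r; rewrite le_eqVlt => /orP[/eqP z0r|z0r].
  by rewrite /v z0r lerD// ler_pXn2r ?nnegrE ?cmod_ge0// fM.
exfalso.
pose d := (r - cmod (z0 - a)); have d0 : 0 < d by rewrite subr_gt0.
pose w0 := z0 - a.
(* Rotating by [la] turns [f ^+ 2] at [z0] into its modulus, so the real part of [la * f ^+ 2]
   touches [|f| ^ 2] there from below. The real part of [k * (w - z0)], where [k] is [2 * ep] times
   the conjugate of [w0], is the first-order part of [ep * cmod (w - a) ^+ 2]; its second-order part
   [ep * d ^+ 2] gives the contradiction. *)
have [la la1 laE] : exists2 l : R[i], cmod l = 1 & l * (f z0 ^+ 2) = (cmod (f z0) ^+ 2)%:C.
  have [t _ fE] := polar (f z0 ^+ 2); exists (cis (- t)); first exact: cmod_cis.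
  by rewrite fE -cmodX mulrCA -cisD addNr cis0 mulr1.
pose k : R[i] := (2 * ep * complex.Re w0) -i* (2 * ep * complex.Im w0).
pose F w := la * (f w * f w) + k * (w - z0).
have hF : holo F z0 (rr - cmod (z0 - a)).
  move=> w wz; have wr : cmod (w - a) < rr.
    have -> : w - a = (w - z0) + (z0 - a) by ring.
    by apply: le_lt_trans (cmodD _ _) _; lra.
  have df := holo_derive hf wr.
  exact: cder_derivable (cderD (cderZ la (cderM df df)) (cderZ k (cderBid z0 w))).
have : complex.Re (F z0) <= cmod (f z0) ^+ 2 - ep * d ^+ 2.
  apply: (Re_mean_le (rho := d) d0 _ hF); first by rewrite /d; lra.
  move=> w wd.
  have := Hz0 w; have -> : w - a = w0 + (w - z0) by rewrite /w0; ring.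
  have wr : cmod (w0 + (w - z0)) <= r by apply: le_trans (cmodD _ _) _; rewrite wd /w0 /d; lra.
  move=> /(_ wr); rewrite /v.
  have -> : w - a = w0 + (w - z0) by rewrite /w0; ring.
  rewrite -/w0 [cmod (w0 + _) ^+ 2]sqr_cmod [cmod w0 ^+ 2]sqr_cmod.
  have E : complex.Re (w - z0) ^+ 2 + complex.Im (w - z0) ^+ 2 = d ^+ 2 by rewrite -sqr_cmod wd.
  have Re1 : complex.Re (la * (f w * f w)) <= cmod (f w) ^+ 2.
    by apply: le_trans (Re_le _) _; rewrite !cmodM la1 mul1r expr2.
  rewrite /F [complex.Re (_ + k * _)]ReD [complex.Re (k * _)]ReM /=.
  rewrite !(ReD w0) !(ImD w0) -E.
  move: (complex.Re (w - z0)) (complex.Im (w - z0)) (complex.Re w0) (complex.Im w0) Re1.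
  move: (complex.Re _) (cmod (f w)) (cmod (f z0)) => A B C x y x0 y0; nra.
rewrite /F subrr mulr0 addr0 -expr2 laE /=.
have : 0 < ep * d ^+ 2 by rewrite mulr_gt0// exprn_gt0.
lra.
Qed.

End EntireFunctions.

(** * Zeros and their multiplicities *)

Section Zeros.
Context {R : realType}.
Implicit Types (f g : R[i] -> R[i]) (a b z w : R[i]) (s : seq R[i]) (r t M D : R).

Definition lin_prod s z : R[i] := \prod_(a <- s) (z - a).

Lemma lin_prod_cons a s z : lin_prod (a :: s) z = (z - a) * lin_prod s z.
Proof. by rewrite /lin_prod big_cons. Qed.

Lemma cmod_lin_prod s z : cmod (lin_prod s z) = \prod_(a <- s) cmod (z - a).
Proof. by rewrite /lin_prod cmod_prod. Qed.

Lemma prod_le_pow s (F : R[i] -> R) (x : R) : (forall a, a \in s -> 0 <= F a <= x) ->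
  \prod_(a <- s) F a <= x ^+ size s.
Proof.
elim: s => [|a s ih] H; first by rewrite big_nil expr0.
have /andP[h1 h2] := H a (mem_head _ _).
rewrite big_cons exprS; apply: ler_pM => //; last first.
  by apply: ih => b bs; apply: H; rewrite inE bs orbT.
rewrite big_seq; apply: prodr_ge0 => b bs.
by have := H b; rewrite inE bs orbT => /(_ isT) /andP[].
Qed.

Lemma pow_le_prod s (F : R[i] -> R) (x : R) : 0 <= x -> (forall a, a \in s -> x <= F a) ->
  x ^+ size s <= \prod_(a <- s) F a.
Proof.
move=> x0; elim: s => [|a s ih] H; first by rewrite big_nil expr0.
rewrite big_cons exprS; apply: ler_pM => //; first exact: exprn_ge0.
  exact: H (mem_head _ _).
by apply: ih => b bs; apply: H; rewrite inE bs orbT.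
Qed.

Lemma entire_lin_prod s : entire (lin_prod s).
Proof.
apply: entire_prod => a; apply: entireB; [exact: entire_id|exact: entire_cst].
Qed.

Lemma lin_prod_neq0 s z : z \notin s -> lin_prod s z != 0.
Proof.
move=> zs; rewrite /lin_prod prodf_seq_neq0; apply/allP => a as_ /=.
by rewrite subr_eq0; apply: contraNneq zs => ->.
Qed.

(** Every zero in [s] is within [D] of [z0], while on the circle of radius [3 * D] each linear
    factor has modulus at least [2 * D]; the maximum principle for [g] turns each zero into a gain
    of 2. *)
Lemma factor_bound f g s z0 (R0 : R) D M : entire g ->
  (forall z, f z = lin_prod s z * g z) -> (forall a, a \in s -> cmod a <= R0) ->
  0 < D -> R0 + cmod z0 <= D -> 0 <= M ->
  (forall z, cmod (z - z0) = 3 * D -> cmod (f z) <= M) ->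
  2 ^+ size s * cmod (f z0) <= M.
Proof.
move=> eg fg sR D0 RD M0 fM.
have D2 : 0 < 2 * D by rewrite mulr_gt0.
have sa a : a \in s -> cmod (z0 - a) <= D.
  by move=> /sR aR; apply: le_trans (cmodB _ _) _; lra.
have g0 : cmod (g z0) <= M / (2 * D) ^+ size s.
  apply: (@max_principle _ g z0 (3 * D + 1) (3 * D)) => //.
  - by rewrite divr_ge0// exprn_ge0// ltW.
  - by lra.
  - move=> z zz; rewrite ler_pdivlMr ?exprn_gt0//.
    apply: le_trans (fM z zz); rewrite fg cmodM mulrC cmod_lin_prod.
    rewrite ler_wpM2r ?cmod_ge0//; apply: pow_le_prod => [|a as_]; first exact: ltW.
    have := cmod_subl (z - z0) (a - z0).
    rewrite (_ : z - z0 - (a - z0) = z - a); last by ring.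
    by have := sa a as_; rewrite zz cmodBC; lra.
  - by rewrite subrr cmod0; lra.
rewrite fg cmodM cmod_lin_prod.
apply: le_trans (_ : 2 ^+ size s * (D ^+ size s * (M / (2 * D) ^+ size s)) <= _).
  rewrite ler_wpM2l ?exprn_ge0//; apply: ler_pM => //.
  - by apply: prodr_ge0 => a _; exact: cmod_ge0.
  - exact: cmod_ge0.
  - by apply: prod_le_pow => a /sa ->; rewrite cmod_ge0.
rewrite mulrA -exprMn mulrCA divff ?mulr1// expf_neq0// gt_eqF//.
Qed.

(** Dividing out zeros in [A] one at a time must stop, since [n] divisions would give
    [2 ^+ n * cmod (f z0) <= M] with [M] independent of [n]. Finiteness and multiplicities of the
    zeros come out together. *)
Lemma factor_zeros f (A : R[i] -> Prop) (R0 : R) z0 : entire f -> f z0 != 0 ->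
  (forall a, A a -> cmod a <= R0) ->
  exists s g, [/\ entire g, forall z, f z = lin_prod s z * g z,
    forall a, a \in s -> A a & forall a, A a -> g a != 0].
Proof.
move=> ef fz0 AR.
pose good s g := [/\ entire g, forall z, f z = lin_prod s z * g z & forall a, a \in s -> A a].
apply: contrapT => H.
have step n : exists s g, good s g /\ size s = n.
  elim: n => [|n [s [g [[eg fg sA] sn]]]].
    by exists [::], f; split=> //; split=> // z; rewrite /lin_prod big_nil mul1r.
  have [a Aa ga] : exists2 a, A a & g a = 0.
    apply: contrapT => K; apply: H; exists s, g; split=> // a Aa.
    by apply/negP => /eqP ga; apply: K; exists a.
  have [g' eg' gg'] := entire_divide eg ga.
  exists (a :: s), g'; split; last by rewrite /= sn.
  split=> // [z|b]; first by rewrite lin_prod_cons fg gg'; ring.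
  by rewrite inE => /orP[/eqP ->//|/sA].
pose D := `|R0| + cmod z0 + 1.
have D0 : 0 < D by rewrite ltr_wpDl// addr_ge0// cmod_ge0.
have DD : R0 + cmod z0 <= D by rewrite /D; have := ler_norm R0; lra.
have D3 : 0 <= 3 * D by rewrite mulr_ge0// ltW.
have Dl : 3 * D < 3 * D + 1 by lra.
have [M M0 HM] := holo_bounded D3 Dl (@entire_holo _ f z0 _ ef).
have fp : 0 < cmod (f z0) by rewrite cmod_gt0.
have [s [g [[eg fg sA] sn]]] := step (Num.bound (M / cmod (f z0))).
have : 2 ^+ size s * cmod (f z0) <= M.
  apply: (factor_bound eg fg) D0 DD M0 _; first by move=> a /sA /AR.
  by move=> z zz; apply: HM; rewrite zz.
rewrite leNgt; apply/negP/negPn; rewrite -ltr_pdivrMr// sn.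
exact: upper_nthrootP.
Qed.

Lemma leastP (P : set nat) n : P n -> (forall m, P m -> (n <= m)%N) -> least P = n.
Proof.
move=> Pn Hn; rewrite /least; apply: xget_unique; first by split.
by move=> m [Pm Hm]; apply/eqP; rewrite eqn_leq Hn// Hm.
Qed.

(** Leibniz' rule with a linear factor; at [n = 0] the coefficient [n%:R] removes the term with the
    truncated [n.-1]. *)
Lemma derive1n_linM a g n z : entire g ->
  (fun w => (w - a) * g w)^`(n)%classic z = (z - a) * g^`(n)%classic z + n%:R * g^`(n.-1)%classic z.
Proof.
move=> eg; elim: n z => [|n ih] z; first by rewrite !derive1n0 mul0r addr0.
rewrite derive1nS; apply: is_derive_derive1.
have -> : (fun w => (w - a) * g w)^`(n)%classic =
   (fun z => (z - a) * g^`(n)%classic z + n%:R * g^`(n.-1)%classic z).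
  by apply/funext => w; exact: ih.
have dg m w : is_derive w (1 : R[i]) g^`(m)%classic (g^`(m.+1)%classic w).
  by rewrite derive1nS; apply: entire_is_derive; exact: entire_derive1n.
apply: cder_eq (cderD (cderM (cderBid a z) (dg n z)) (cderZ n%:R (dg n.-1 z))) _.
case: n {ih} => [|n] /=; first by rewrite !mul0r; ring.
by rewrite -[n.+2%:R]natr1 [(_ + 1) * _]mulrDl !mul1r -[in LHS]addrA [in LHS]addrC [in RHS]addrA.
Qed.

Definition vanish_order f z n := f^`(n)%classic z != 0 /\ forall m, (m < n)%N -> f^`(m)%classic z = 0.

Lemma vanish_orderE f z n : vanish_order f z n -> zero_order f z = n.
Proof.
move=> [fn fm]; apply: leastP => // m; rewrite /= leqNgt => fm0.
by apply/negP => /fm mE; rewrite mE eqxx in fm0.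
Qed.

Lemma vanish_order_linM a g z n : entire g -> vanish_order g z n ->
  vanish_order (fun w => (w - a) * g w) z ((z == a) + n)%N.
Proof.
move=> eg [gn gm]; have [zE|za] := eqVneq z a.
  split=> [|[|m] mn]; rewrite derive1n_linM// zE subrr mul0r add0r /= ?mul0r//.
    by rewrite mulf_neq0// ?pnatr_eq0// -zE.
  by rewrite -zE gm ?mulr0.
split=> [|m mn]; rewrite derive1n_linM//.
  case: n gn gm => [|n] gn gm; rewrite /= ?mul0r ?addr0 ?mulf_neq0// ?subr_eq0//.
  by rewrite gm// mulr0 addr0 mulf_neq0// subr_eq0.
rewrite gm// mulr0 add0r; case: m mn => [|m] mn; rewrite ?mul0r//=.
by rewrite gm ?mulr0// ltnW.
Qed.

Lemma vanish_order_lin_prod s g z : entire g -> g z != 0 ->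
  vanish_order (fun w => lin_prod s w * g w) z (count_mem z s).
Proof.
move=> eg gz; elim: s => [|a s ih] /=.
  split=> //; rewrite derive1n0 /lin_prod big_nil mul1r//.
have H := vanish_order_linM a (entireM (@entire_lin_prod s) eg) ih.
rewrite (_ : (fun w => lin_prod (a :: s) w * g w) = (fun w => (w - a) * (lin_prod s w * g w))).
  by rewrite eq_sym.
by apply/funext => w; rewrite lin_prod_cons mulrA.
Qed.

Lemma zero_order_lin_prod f s g z : entire g -> (forall z, f z = lin_prod s z * g z) ->
  g z != 0 -> zero_order f z = count_mem z s.
Proof.
move=> eg fg gz; apply: vanish_orderE.
rewrite (_ : f = (fun w => lin_prod s w * g w)); first exact: vanish_order_lin_prod.
by apply/funext.
Qed.

Lemma sum_count_undup (T : eqType) (l : seq T) (P : pred T) :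
  (\sum_(i <- undup l | P i) count_mem i l)%N = count P l.
Proof.
rewrite -sum1_count -[RHS]big_undup_iterop_count; apply: eq_bigr => z _.
by elim: (count_mem z l) => // -[|n] //= <-; rewrite add1n.
Qed.

(** On the closed disc the multiplicities are the occurrence counts in [s], so the finitely
    supported sum becomes a plain count over the list. *)
Lemma unint_count_lin_prod f s g r t : entire g -> (forall z, f z = lin_prod s z * g z) ->
  (forall z, cmod z <= r -> g z != 0) -> t <= r ->
  unint_count (zero_order f) t = count (fun a => cmod a <= t) s.
Proof.
move=> eg fg g0 tr; rewrite /unint_count.
have -> : [set z : R[i] | cmod z <= t] = [set` (fun z : R[i] => cmod z <= t)].
  by apply/seteqP; split.
transitivity (\sum_(z \in [set` (fun z : R[i] => cmod z <= t)]) count_mem z s)%R.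
  apply: eq_fsbigr => z; rewrite inE /= => zt.
  by apply: (zero_order_lin_prod eg fg); apply: g0; exact: le_trans tr.
rewrite -(@bigfs _ _ _ _ (undup s) (fun z : R[i] => cmod z <= t)).
- exact: sum_count_undup.
- exact: undup_uniq.
- by move=> z _; rewrite mem_undup => /count_memPn.
Qed.

(** Contribution to the integrated counting function of a single zero of modulus [b]. *)
Lemma rint_step (b r : R) : 0 < b -> 0 < r ->
  (@lebesgue_measure R).-integrable `]0, r] (EFin \o (fun t => if b <= t then t^-1 else 0)) /\
  \int[@lebesgue_measure R]_(t in `]0, r]) (if b <= t then t^-1 else 0) = Num.max 0 (ln (r / b)).
Proof.
move=> b0 r0.
have E : (fun t => if b <= t then t^-1 else 0) = (fun t => t^-1) \_ `[b, +oo[ :> (R -> R).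
  by apply/funext => t; rewrite patchE mem_setE in_itv /= andbT.
have S : `]0, r]%classic `&` `[b, +oo[%classic = `[b, r]%classic :> set R.
  apply/seteqP; split => t /=; rewrite !in_itv /= ?andbT.
    by move=> [/andP[_ ->] ->].
  by move=> /andP[bt ->]; rewrite bt (lt_le_trans b0).
have ic : rcts_on b r (fun t : R => t^-1).
  move=> t /andP[bt _]; apply: (inv_continuous (K := R)).
  by rewrite gt_eqF// (lt_le_trans b0).
split.
  rewrite E -restrict_EFin; apply/integrable_restrict => //; rewrite S.
  exact: rcts_integrable.
rewrite E -Rintegral_mkcondr S.
have [br|rb] := leP b r.
  have -> : rint b r (fun t : R => t^-1) = ln r - ln b.
    apply: rint_FTC => // t /andP[bt _].
    by apply: is_derive1_ln; rewrite (lt_le_trans b0).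
  by rewrite -ln_div ?posrE// max_r// ln_ge0// ler_pdivlMr// mul1r.
rewrite set_itv_ge -?leNgt ?bnd_simp -?ltNge// Rintegral_set0 max_l//.
by rewrite ln_le0// ler_pdivrMr// mul1r ltW.
Qed.

End Zeros.

(** * Means over circles *)

Section CircleMeans.
Context {R : realType}.
Implicit Types (f g : R[i] -> R[i]) (a z w : R[i]) (s : seq R[i]) (r t x y : R).

(** With the positive part taken inside the logarithm, monotonicity, continuity and product bounds
    reduce to those of [ln] on [[1, +oo[]. *)
Lemma lnpE x : lnp x = ln (Num.max 1 x).
Proof.
rewrite /lnp; have [x1|x1] := leP x 1.
  by rewrite ln1 max_l// ln_le0.
by rewrite max_r// ltW// ln_gt0.
Qed.

Lemma lnp_ge0 x : 0 <= lnp x.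
Proof. by rewrite /lnp le_max lexx. Qed.

Lemma ln_le_lnp x : ln x <= lnp x.
Proof. by rewrite /lnp le_max lexx orbT. Qed.

Lemma le_lnp x y : x <= y -> lnp x <= lnp y.
Proof.
move=> xy; rewrite !lnpE ler_ln ?posrE ?lt_max ?ltr01// ge_max !le_max lexx /=.
by rewrite xy orbT.
Qed.

Lemma lnp0 x : x <= 1 -> lnp x = 0.
Proof. by move=> x1; rewrite lnpE max_l ?ln1. Qed.

Lemma lnpM x y : 0 <= x -> 0 <= y -> lnp (x * y) <= lnp x + lnp y.
Proof.
move=> x0 y0; rewrite !lnpE -lnM ?posrE ?lt_max ?ltr01// ler_ln ?posrE ?mulr_gt0 ?lt_max ?ltr01//.
rewrite ge_max; apply/andP; split.
  by rewrite -[leLHS]mulr1 ler_pM// le_max lexx.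
by apply: ler_pM => //; rewrite le_max lexx orbT.
Qed.

Lemma lnpD x y : 0 <= x -> 0 <= y -> lnp (x + y) <= lnp x + lnp y + ln 2.
Proof.
move=> x0 y0; rewrite !lnpE -!lnM ?posrE ?mulr_gt0 ?lt_max ?ltr01//.
rewrite ler_ln ?posrE ?mulr_gt0 ?lt_max ?ltr01//.
have hx : 1 <= Num.max 1 x by rewrite le_max lexx.
have hy : 1 <= Num.max 1 y by rewrite le_max lexx.
have kx : x <= Num.max 1 x by rewrite le_max lexx orbT.
have ky : y <= Num.max 1 y by rewrite le_max lexx orbT.
by rewrite ge_max; apply/andP; split; nra.
Qed.

Lemma lnpX x n : 0 <= x -> lnp (x ^+ n) <= n%:R * lnp x.
Proof.
move=> x0; elim: n => [|n ih]; first by rewrite expr0 mul0r lnp0.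
rewrite exprS -natr1 mulrDl mul1r addrC.
by apply: le_trans (lnpM x0 (exprn_ge0 _ x0)) _; rewrite lerD2l.
Qed.

Lemma lnp_expR x : 0 <= x -> lnp (expR x) = x.
Proof. by move=> x0; rewrite /lnp expRK max_r. Qed.

Lemma lnp_inv x : 0 < x -> lnp x^-1 = Num.max (ln x) 0 - ln x.
Proof.
move=> x0; rewrite /lnp lnV ?posrE//.
have [l0|l0] := leP 0 (ln x).
  by rewrite subrr max_l// oppr_le0.
by rewrite sub0r max_r// oppr_ge0 ltW.
Qed.

(** Each term is at most the exponential of the whole sum of the [lnp (F i)], so [n] terms cost a
    single [lnp n] instead of one [ln 2] per addition. The O(log r) bound for sums over O(r) zeros
    depends on this. *)
Lemma lnp_sum (T : eqType) (l : seq T) (F : T -> R) : (forall i, 0 <= F i) ->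
  lnp (\sum_(i <- l) F i) <= lnp (size l)%:R + \sum_(i <- l) lnp (F i).
Proof.
move=> F0; pose S := \sum_(i <- l) lnp (F i).
have SF i : i \in l -> F i <= expR S.
  move=> il; apply: le_trans (_ : expR (lnp (F i)) <= _).
    rewrite lnpE lnK ?posrE ?lt_max ?ltr01// le_max lexx orbT//.
  rewrite ler_expR /S (big_rem _ il) /= lerDl sumr_ge0// => j _; exact: lnp_ge0.
have S0 : 0 <= S by apply: sumr_ge0 => j _; exact: lnp_ge0.
have : \sum_(i <- l) F i <= (size l)%:R * expR S.
  have -> : (size l)%:R * expR S = \sum_(i <- l) expR S.
    by rewrite big_const_seq count_predT iter_addr_0 mulr_natl.
  by rewrite !big_seq; apply: ler_sum => i; exact: SF.
move=> /le_lnp /le_trans; apply; rewrite -/S.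
by apply: le_trans (lnpM _ (expR_ge0 _)) _ => //; rewrite lnp_expR.
Qed.

Lemma rcts_ln (u : R -> R) t : {for t, continuous u} -> 0 < u t ->
  {for t, continuous (fun x => ln (u x))}.
Proof.
move=> uc u0; apply: (@continuous_comp _ _ _ u (@ln R)) => //.
exact: continuous_ln.
Qed.

Lemma rcts_lnp (u : R -> R) t : {for t, continuous u} ->
  {for t, continuous (fun x => lnp (u x))}.
Proof.
move=> uc; rewrite (_ : (fun x => _) = (fun x => ln ((cst 1 \max u) x))); last first.
  by apply/funext => x; rewrite lnpE.
apply: rcts_ln; last by rewrite /= lt_max ltr01.
by apply: continuous_max => //; exact: cst_continuous.
Qed.

Lemma rcts_sum_in (T : eqType) (l : seq T) (F : T -> R -> R) t :
  (forall i, i \in l -> {for t, continuous (F i)}) ->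
  {for t, continuous (fun x => \sum_(i <- l) F i x)}.
Proof.
elim: l => [_|i l ih Fc].
  rewrite (_ : (fun x => _) = cst 0); first exact: cst_continuous.
  by apply/funext => x; rewrite big_nil.
rewrite (_ : (fun x => _) = (fun x => F i x + \sum_(j <- l) F j x)).
  apply: continuousD; first exact: Fc (mem_head _ _).
  by apply: ih => j jl; apply: Fc; rewrite inE jl orbT.
by apply/funext => x; rewrite big_cons.
Qed.

Lemma rint_sum (T : eqType) (l : seq T) (F : T -> R -> R) (b c : R) : b <= c ->
  (forall i, i \in l -> rcts_on b c (F i)) ->
  rint b c (fun t => \sum_(i <- l) F i t) = \sum_(i <- l) rint b c (F i).
Proof.
move=> bc; elim: l => [_|i l ih Fc].
  rewrite big_nil (@eq_rint _ b c _ (fun=> 0)); last by move=> t _; rewrite big_nil.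
  by rewrite rint_cst// mul0r.
have Fi : rcts_on b c (F i) by exact: Fc (mem_head _ _).
have Fl j : j \in l -> rcts_on b c (F j) by move=> jl; apply: Fc; rewrite inE jl orbT.
rewrite big_cons -ih// -rintD//; last first.
  by move=> t tt; apply: rcts_sum_in => j /Fl; apply.
by apply: eq_rint => t _; rewrite big_cons.
Qed.

(** The integral in the angle without the factor [(2 * pi)^-1]; this is why [2 * pi] accompanies the
    values below. *)
Definition cmean (u : R[i] -> R) r : R := rint 0 (2 * pi) (fun t => u (r%:C * cis t)).

Definition circ_cts (u : R[i] -> R) r :=
  forall t, {for t, continuous (fun t => u (r%:C * cis t))}.

Lemma cmod_circ r t : 0 <= r -> cmod (r%:C * cis t) = r.
Proof. by move=> r0; rewrite cmodM cmod_cis mulr1 cmod_real ger0_norm. Qed.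

Lemma circ_ccts f r t : ctsC f (r%:C * cis t) -> ccts (fun t => f (r%:C * cis t)) t.
Proof.
move=> fc; apply: (@ctsC_ccts _ f (fun t => r%:C * cis t)) => //.
by apply: cctsM; [exact: ccts_cst|exact: ccts_cis].
Qed.

Lemma circ_cts_ln f r : 0 <= r -> (forall z, cmod z = r -> ctsC f z) ->
  (forall z, cmod z = r -> f z != 0) -> circ_cts (fun z => ln (cmod (f z))) r.
Proof.
move=> r0 fc f0 t; apply: rcts_ln; last by rewrite cmod_gt0 f0// cmod_circ.
by apply: rcts_cmod; apply: circ_ccts; apply: fc; rewrite cmod_circ.
Qed.

Lemma circ_cts_lnp f r : 0 <= r -> (forall z, cmod z = r -> ctsC f z) ->
  circ_cts (fun z => lnp (cmod (f z))) r.
Proof.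
move=> r0 fc t; apply: rcts_lnp.
by apply: rcts_cmod; apply: circ_ccts; apply: fc; rewrite cmod_circ.
Qed.

Lemma cmeanD u v r : circ_cts u r -> circ_cts v r ->
  cmean (fun z => u z + v z) r = cmean u r + cmean v r.
Proof. by move=> uc vc; apply: rintD => t _; [exact: uc|exact: vc]. Qed.

Lemma cmeanB u v r : circ_cts u r -> circ_cts v r ->
  cmean (fun z => u z - v z) r = cmean u r - cmean v r.
Proof. by move=> uc vc; apply: rintB => t _; [exact: uc|exact: vc]. Qed.

Lemma cmeanZ (k : R) u r : circ_cts u r ->
  cmean (fun z => k * u z) r = k * cmean u r.
Proof. by move=> uc; apply: rintZ => t _; exact: uc. Qed.

Lemma cmean_cst (k : R) r : cmean (fun=> k) r = 2 * pi * k.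
Proof. by rewrite /cmean rint_cst ?subr0 ?(ltW (twopi_gt0))// mulrC. Qed.

Lemma le_cmean u v r : 0 <= r -> circ_cts u r -> circ_cts v r ->
  (forall z, cmod z = r -> u z <= v z) -> cmean u r <= cmean v r.
Proof.
move=> r0 uc vc uv; apply: le_rint => t _; [exact: uc|exact: vc|].
by apply: uv; rewrite cmod_circ.
Qed.

Lemma eq_cmean u v r : 0 <= r -> (forall z, cmod z = r -> u z = v z) -> cmean u r = cmean v r.
Proof. by move=> r0 uv; apply: eq_rint => t _; apply: uv; rewrite cmod_circ. Qed.

Lemma cmean_sum (T : eqType) (l : seq T) (F : T -> R[i] -> R) r :
  (forall i, i \in l -> circ_cts (F i) r) ->
  cmean (fun z => \sum_(i <- l) F i z) r = \sum_(i <- l) cmean (F i) r.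
Proof.
move=> Fc; apply: rint_sum => [|i il t _]; first exact: ltW (twopi_gt0).
exact: Fc.
Qed.

Lemma circ_ctsD u v r : circ_cts u r -> circ_cts v r -> circ_cts (fun z => u z + v z) r.
Proof. by move=> uc vc t; apply: continuousD; [exact: uc|exact: vc]. Qed.

Lemma circ_ctsB u v r : circ_cts u r -> circ_cts v r -> circ_cts (fun z => u z - v z) r.
Proof. by move=> uc vc t; apply: continuousB; [exact: uc|exact: vc]. Qed.

Lemma circ_ctsZ (k : R) u r : circ_cts u r -> circ_cts (fun z => k * u z) r.
Proof. by move=> uc t; apply: continuousM; [exact: cst_continuous|exact: uc]. Qed.

Lemma circ_cts_cst (k : R) r : circ_cts (fun=> k) r.
Proof. by move=> t; exact: cst_continuous. Qed.

Lemma circ_cts_sum (T : eqType) (l : seq T) (F : T -> R[i] -> R) r :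
  (forall i, i \in l -> circ_cts (F i) r) -> circ_cts (fun z => \sum_(i <- l) F i z) r.
Proof. by move=> Fc t; apply: rcts_sum_in => i il; exact: Fc. Qed.

Lemma cmean_ln g rr r : 0 < r -> r < rr -> holo g 0 rr ->
  (forall z, cmod z < rr -> g z != 0) ->
  cmean (fun z => ln (cmod (g z))) r = 2 * pi * ln (cmod (g 0)).
Proof.
move=> r0 rrr hg g0.
rewrite -(mean_ln r0 rrr hg) => [|z]; last by rewrite subr0; exact: g0.
by apply: eq_rint => t _; rewrite add0r.
Qed.

Lemma entire_affine (a b : R[i]) : entire (fun z => a - b * z).
Proof.
apply: entireB; first exact: entire_cst.
by apply: entireM; [exact: entire_cst|exact: entire_id].
Qed.

Lemma cmod_reflect r a t : cmod (r%:C * cis t - a) = cmod (r%:C - a^* * cis t).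
Proof.
rewrite -cmodJ rmorphB rmorphM /= conj_cis cisN.
rewrite -[LHS]mul1r -(cmod_cis t) -cmodM mulrBr mulrCA divff ?cis_neq0// mulr1.
by rewrite (mulrC (cis t)); congr (cmod (_ - _)); apply: eqC; rewrite /= ?oppr0.
Qed.

(* the reflected linear factor [x - a^* z] is zero-free near the unit disc *)
Lemma cmean_reflect (x : R) a (r : R) : cmod a < x ->
  rint 0 (2 * pi) (fun t => ln (cmod (x%:C - a^* * cis t))) = 2 * pi * ln x.
Proof.
move=> ax; have x0 : 0 < x by exact: le_lt_trans (cmod_ge0 a) ax.
(* Strictly above 1, and [cmod a * rr <= x], so the reflected factor has no zero in the disc of
   radius [rr]. *)
pose rr := 2 * x / (x + cmod a).
have xa : 0 < x + cmod a by rewrite ltr_pwDl// cmod_ge0.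
have rr1 : 1 < rr by rewrite ltr_pdivlMr// mul1r; lra.
have E := @mean_ln _ (fun z => x%:C - a^* * z) 0 rr 1 ltr01 rr1.
have -> : x = cmod (x%:C - a^* * 0) by rewrite mulr0 subr0 cmod_real gtr0_norm.
rewrite mulr0 subr0 in E *; rewrite cmod_real in E *; rewrite gtr0_norm// in E *.
rewrite -E.
- by apply: eq_rint => t _; rewrite add0r mul1r.
- by apply: entire_holo; exact: entire_affine.
- move=> z; rewrite subr0 => zr; rewrite subr_eq0; apply/eqP => /(congr1 cmod).
  rewrite cmod_real gtr0_norm// cmodM cmodJ => xE.
  move: zr; rewrite ltr_pdivlMr//; have := cmod_ge0 z; have := cmod_ge0 a; nra.
Qed.

(** For [cmod a > r] the factor is zero-free on a disc containing the circle; for [cmod a < r] it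
    has the same modulus on the circle as its reflection, which is zero-free. *)
Lemma cmean_ln_linear r a : 0 < r -> cmod a != r ->
  cmean (fun z => ln (cmod (z - a))) r = 2 * pi * ln (Num.max r (cmod a)).
Proof.
move=> r0; rewrite neq_lt => /orP[ar|ra].
  rewrite max_l ?ltW// -(cmean_reflect r ar).
  by apply: eq_rint => t _; rewrite cmod_reflect.
rewrite max_r ?ltW// (@cmean_ln _ (cmod a))//.
- by rewrite sub0r cmodN.
- by move=> z za; rewrite subr_eq0; apply: contraTneq za => ->; rewrite ltxx.
Qed.

(** Pushing [a] outwards along its ray moves it away from every [z] with [cmod z <= cmod a], because
    the inner product of [z] and [a] is at most [cmod a ^+ 2]. *)
Lemma cmod_sub_far z a (k : R) : 0 <= k -> cmod z <= cmod a ->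
  cmod (z - a) <= cmod (z - (1 + k)%:C * a).
Proof.
move=> k0 za; rewrite -ler_sqr ?nnegrE ?cmod_ge0//.
have : complex.Re z * complex.Re a + complex.Im z * complex.Im a <= cmod a ^+ 2.
  have -> : complex.Re z * complex.Re a + complex.Im z * complex.Im a = complex.Re (z * a^*).
    by rewrite ReM; case: (a) => x y /=; ring.
  apply: le_trans (Re_le _) _; rewrite cmodM cmodJ expr2 ler_wpM2r ?cmod_ge0//.
rewrite !sqr_cmod; case: z a {za} => [zx zy] [ax ay] /= H; rewrite -subr_ge0.
rewrite (_ : _ - _ = k ^+ 2 * (ax ^+ 2 + ay ^+ 2) +
   2 * k * (ax ^+ 2 + ay ^+ 2 - (zx * ax + zy * ay))); last by ring.
by rewrite addr_ge0// !mulr_ge0 ?sqr_ge0 ?subr_ge0// addr_ge0 ?sqr_ge0.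
Qed.

Lemma ln_succ_sub (x : R) : 0 < x -> ln (x + 1) - ln x <= x^-1.
Proof.
move=> x0; rewrite -ln_div ?posrE ?addr_gt0// mulrDl divff ?gt_eqF// mul1r.
apply: le_ln1Dx; apply: lt_trans (_ : 0 < _); rewrite ?ltrN10// invr_gt0//.
Qed.

(* [log^+ (1 / |z - a|) = max (log |z - a|, 0) - log |z - a|], and the maximum is
   at most [log |k|] for a zero-free [k] with [|k 0| = max (r, |a|) + 1] *)
Lemma cmean_lnp_inv r a : 1 <= r -> cmod a != r ->
  cmean (fun z => lnp (cmod (z - a)^-1)) r <= 2 * pi / r.
Proof.
move=> r1 ar; have r0 : 0 < r by exact: lt_le_trans r1.
have p0 := @twopi_gt0 R.
have za z : cmod z = r -> z - a != 0.
  by move=> zr; rewrite subr_eq0; apply: contraNneq ar => <-; rewrite zr.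
have lc : circ_cts (fun z => ln (cmod (z - a))) r.
  apply: circ_cts_ln => //; first exact: ltW.
  by move=> z _; exact: is_derive_cts (cderBid a z).
have pc : circ_cts (fun z => lnp (cmod (z - a)^-1)) r.
  apply: circ_cts_lnp; first exact: ltW.
  move=> z zr; apply: is_derive_cts.
  exact: (@cderV _ (fun w => w - a) z 1 (za z zr) (cderBid a z)).
suff [K Kc [Km K1]] : exists2 K : R -> R, rcts_on 0 (2 * pi) K &
    rint 0 (2 * pi) K = 2 * pi * ln (Num.max r (cmod a) + 1) /\
    forall t, Num.max (ln (cmod (r%:C * cis t - a))) 0 <= K t.
  have : cmean (fun z => lnp (cmod (z - a)^-1)) r <=
      rint 0 (2 * pi) K - cmean (fun z => ln (cmod (z - a))) r.
    rewrite /cmean -rintB//.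
    apply: le_rint => [t _|t tt|t _]; first exact: pc.
      by apply: continuousB; [exact: Kc|exact: lc].
    have zr := cmod_circ t (ltW r0).
    by rewrite cmodV lnp_inv ?cmod_gt0 ?za// lerD2r.
  move=> /le_trans; apply; rewrite Km cmean_ln_linear// -mulrBr.
  rewrite (ler_wpM2l (ltW p0))//.
  have m0 : 0 < Num.max r (cmod a) by rewrite lt_max r0.
  apply: le_trans (ln_succ_sub m0) _.
  by rewrite lef_pV2 ?posrE// le_max lexx.
have [ra|ra] := ltP r (cmod a).
  have a0 : 0 < cmod a by exact: lt_trans ra.
  (* [c] is [a] pushed outwards by 1. On the circle [z - c] is therefore at least as large as
     [z - a] in modulus, and at least 1. *)
  pose c := a * (1 + (cmod a)^-1)%:C.
  have cm : cmod c = cmod a + 1.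
    rewrite cmodM cmod_real gtr0_norm ?addr_gt0 ?invr_gt0//.
    by rewrite mulrDr mulr1 divff// gt_eqF.
  have zc z : cmod z < cmod a + 1 -> z - c != 0.
    by move=> zz; rewrite subr_eq0; apply: contraTneq zz => ->; rewrite cm ltxx.
  have hc : holo (fun z => z - c) 0 (cmod a + 1).
    by apply: entire_holo; apply: entireB; [exact: entire_id|exact: entire_cst].
  have rc : r < cmod a + 1 by lra.
  exists (fun t => ln (cmod (r%:C * cis t - c))).
    move=> t _; apply: (circ_cts_ln (f := fun z => z - c)); first exact: ltW.
      by move=> z _; exact: is_derive_cts (cderBid c z).
    by move=> z zr; apply: zc; rewrite zr.
  split; first by rewrite -/(cmean (fun z => ln (cmod (z - c))) r) (cmean_ln r0 rc)// sub0r cmodN cm.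
  move=> t; have zr := cmod_circ t (ltW r0); rewrite ge_max; apply/andP; split.
    have zc' : 0 < cmod (r%:C * cis t - c) by rewrite cmod_gt0 zc// zr.
    rewrite ler_ln ?posrE//; last by rewrite cmod_gt0 za.
    rewrite /c (mulrC a).
    by apply: cmod_sub_far; rewrite ?invr_ge0 ?cmod_ge0// zr ltW.
  apply: ln_ge0; have := cmod_subl c (r%:C * cis t).
  by rewrite cm cmodBC zr; lra.
have {}ar : cmod a < r by rewrite lt_neqAle ar ra.
(* For [cmod a < r] the reflected factor of [a], with [r] enlarged to [r + 1], serves as [k]. *)
have kn t : 1 <= cmod ((r + 1)%:C - a^* * cis t).
  have := cmod_subl (r + 1)%:C (a^* * cis t).
  rewrite cmod_real cmodM cmodJ cmod_cis mulr1 gtr0_norm; last by lra.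
  lra.
exists (fun t => ln (cmod ((r + 1)%:C - a^* * cis t))).
  move=> t _; apply: rcts_ln; last by apply: lt_le_trans (kn t).
  apply: rcts_cmod; apply: cctsB; first exact: ccts_cst.
  by apply: cctsM; [exact: ccts_cst|exact: ccts_cis].
split.
  by rewrite (cmean_reflect r) ?max_l ?(ltW ar)//; lra.
move=> t; have zr := cmod_circ t (ltW r0); rewrite ge_max ln_ge0// andbT.
rewrite ler_ln ?posrE//; [|by rewrite cmod_gt0 za|by apply: lt_le_trans (kn t)].
rewrite cmod_reflect cmodBC [leRHS]cmodBC.
have -> : (r + 1)%:C = (1 + r^-1)%:C * r%:C :> R[i].
  by rewrite -rmorphM /= mulrDl mul1r mulVf// gt_eqF.
apply: cmod_sub_far; first by rewrite invr_ge0 ltW.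
by rewrite cmodM cmodJ cmod_cis mulr1 cmod_real gtr0_norm// ltW.
Qed.

End CircleMeans.

(** * Jensen's formula and the logarithmic derivative *)

Section JensenLogDerivative.
Context {R : realType}.
Implicit Types (f g : R[i] -> R[i]) (a z w : R[i]) (s : seq R[i]) (r t x y B : R).

Lemma ln_prod s (F : R[i] -> R) : (forall a, a \in s -> 0 < F a) ->
  ln (\prod_(a <- s) F a) = \sum_(a <- s) ln (F a).
Proof.
elim: s => [_|a s ih H]; first by rewrite !big_nil ln1.
have H' b : b \in s -> 0 < F b by move=> bs; apply: H; rewrite inE bs orbT.
rewrite !big_cons lnM ?posrE; first by rewrite ih.
  exact: H (mem_head _ _).
by rewrite big_seq; apply: prodr_gt0 => b; exact: H'.
Qed.

Lemma count_step s t : 0 < t ->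
  ((count (fun a => cmod a <= t) s)%:R - (count_mem 0 s)%:R) / t =
  \sum_(a <- [seq a <- s | a != 0]) (if cmod a <= t then t^-1 else 0).
Proof.
move=> t0; elim: s => [|a s ih] /=; first by rewrite big_nil subrr mul0r.
rewrite !natrD opprD addrACA mulrDl ih; have [->|a0] /= := eqVneq a 0.
  by rewrite cmod0 (ltW t0) subrr mul0r add0r.
rewrite subr0 big_cons; congr (_ + _).
by case: ifP => _; rewrite ?mul1r ?mul0r.
Qed.

Lemma rint_count_step s r : 0 < r -> (forall a, a \in s -> a != 0) ->
  let F := (fun t => \sum_(a <- s) (if cmod a <= t then t^-1 else 0)) in
  (@lebesgue_measure R).-integrable `]0, r] (EFin \o F) /\
  \int[@lebesgue_measure R]_(t in `]0, r]) F t = \sum_(a <- s) Num.max 0 (ln (r / cmod a)).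
Proof.
move=> r0; elim: s => [_|a s ih s0] /=.
  rewrite (_ : (fun t => _) = (fun=> 0)); last by apply/funext => t; rewrite big_nil.
  split; last by rewrite big_nil Rintegral_cst// mul0r.
  exact: integrable0.
have [|i1 E1] := ih _; first by move=> b bs; apply: s0; rewrite inE bs orbT.
have a0 : 0 < cmod a by rewrite cmod_gt0 s0// mem_head.
have [i2 E2] := rint_step a0 r0.
rewrite (_ : (fun t => _) = (fun t => (if cmod a <= t then t^-1 else 0) +
   \sum_(a <- s) (if cmod a <= t then t^-1 else 0))); last first.
  by apply/funext => t; rewrite big_cons.
split; last by rewrite RintegralD// E1 E2 big_cons.
pose u t := if cmod a <= t then t^-1 else 0.
pose v t := \sum_(b <- s) (if cmod b <= t then t^-1 else 0).
suff : (@lebesgue_measure R).-integrable `]0, r] ((EFin \o u) \+ (EFin \o v))%E by [].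
exact: integrableD.
Qed.

Lemma N_zeros_lin_prod f s g r : entire g -> (forall z, f z = lin_prod s z * g z) ->
  (forall z, cmod z <= r -> g z != 0) -> 0 < r ->
  N_zeros r f = \sum_(a <- [seq a <- s | a != 0]) Num.max 0 (ln (r / cmod a)) +
    (count_mem 0 s)%:R * ln r.
Proof.
move=> eg fg g0 r0; rewrite /N_zeros /int_count.
have n0 : unint_count (zero_order f) 0 = count_mem 0 s.
  rewrite (unint_count_lin_prod eg fg g0) ?ltW//.
  by apply: eq_count => a; rewrite /= -cmod_eq0 eq_le cmod_ge0 andbT.
rewrite n0; congr (_ + _).
have [|_ <-] := @rint_count_step [seq a <- s | a != 0] r r0.
  by move=> a; rewrite mem_filter => /andP[].
apply: eq_Rintegral => t; rewrite inE /= in_itv /= => /andP[t0 tr].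
by rewrite (unint_count_lin_prod eg fg g0)// count_step.
Qed.

Lemma zero_split f z0 : entire f -> f z0 != 0 ->
  exists m f1, [/\ entire f1, f1 0 != 0 & forall z, f z = z ^+ m * f1 z].
Proof.
move=> ef f0; have [|s [g [eg fg sA gA]]] := @factor_zeros _ f (fun a => a = 0) 0 z0 ef f0.
  by move=> a ->; rewrite cmod0.
exists (size s), g; split=> //; first exact: gA.
move=> z; rewrite fg; congr (_ * _).
elim: s sA {fg} => [|a s ih] sA; first by rewrite /lin_prod big_nil expr0.
rewrite lin_prod_cons exprS ih; last by move=> b bs; apply: sA; rewrite inE bs orbT.
by rewrite (sA a (mem_head _ _)) subr0.
Qed.

Lemma lin_prod_cat s1 s2 z : lin_prod (s1 ++ s2) z = lin_prod s1 z * lin_prod s2 z.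
Proof. by rewrite /lin_prod big_cat. Qed.

Lemma lin_prod_nseq0 m z : lin_prod (nseq m 0) z = z ^+ m.
Proof.
elim: m => [|m ih] /=; first by rewrite /lin_prod big_nil expr0.
by rewrite lin_prod_cons ih exprS subr0.
Qed.

(** [f1 0] is the leading Taylor coefficient of [f] at the origin. Each factor of [f] has a known
    mean, and [ln (max r |a|)] splits into the term [max 0 (ln (r / |a|))] of the counting function
    and [ln |a|]; the latter terms together with [ln |g 0|] rebuild [ln |f1 0|]. *)
Lemma jensen f m f1 r : entire f1 -> f1 0 != 0 -> (forall z, f z = z ^+ m * f1 z) ->
  0 < r -> (forall z, cmod z = r -> f z != 0) ->
  cmean (fun z => ln (cmod (f z))) r = 2 * pi * (N_zeros r f + ln (cmod (f1 0))).
Proof.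
move=> ef1 f10 ff1 r0 fr.
(* Zeros are divided out up to [r + 1], so that [g] is zero-free on an open disc containing the
   circle; those beyond [r] add 0 to the counting function. *)
have [//|s [g [eg fg sA gA]]] := @factor_zeros _ f1 (fun a => cmod a <= r + 1) (r + 1) 0 ef1 f10.
have f1z a : a \in s -> f1 a = 0.
  move=> as_; rewrite fg; apply/eqP; rewrite mulf_eq0; apply/orP; left.
  rewrite /lin_prod prodf_seq_eq0; apply/hasP; exists a => //=; by rewrite subrr.
have s0 a : a \in s -> a != 0 by move=> /f1z; apply: contra_eqN => /eqP ->.
have sr a : a \in s -> cmod a != r.
  move=> as_; apply/eqP => /fr /eqP; rewrite ff1 (f1z a as_) mulr0; exact.
have gr z : cmod z <= r -> g z != 0 by move=> zr; apply: gA; lra.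
have fs z : f z = lin_prod (nseq m 0 ++ s) z * g z.
  by rewrite ff1 fg lin_prod_cat lin_prod_nseq0 mulrA.
have flt : [seq a <- nseq m 0 ++ s | a != 0] = s.
  rewrite filter_cat (_ : [seq a <- nseq m 0 | a != 0] = [::]) /=.
    by apply/all_filterP/allP.
  by apply/eqP; rewrite -size_eq0 size_filter count_nseq eqxx.
have cnt : count_mem 0 (nseq m 0 ++ s) = m.
  rewrite count_cat count_nseq /= eqxx mul1n; have /count_memPn -> : 0 \notin s.
    by apply/negP => /s0; rewrite eqxx.
  by rewrite addn0.
rewrite (N_zeros_lin_prod eg fs gr r0) flt cnt.
have r0' := ltW r0.
have lc a : a \in s -> circ_cts (fun z => ln (cmod (z - a))) r.
  move=> as_; apply: circ_cts_ln => // z zr; first exact: is_derive_cts (cderBid a z).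
  by rewrite subr_eq0; apply: contraNneq (sr a as_) => <-; rewrite zr.
have gc : circ_cts (fun z => ln (cmod (g z))) r.
  by apply: circ_cts_ln => // z zr; [exact: entire_ctsC|apply: gr; rewrite zr].
have -> : cmean (fun z => ln (cmod (f z))) r =
  cmean (fun z => m%:R * ln r + (\sum_(a <- s) ln (cmod (z - a)) + ln (cmod (g z)))) r.
  apply: eq_cmean => // z zr.
  have sz a : a \in s -> 0 < cmod (z - a).
    move=> as_; rewrite cmod_gt0 subr_eq0; apply: contraNneq (sr a as_) => <-; by rewrite zr.
  rewrite ff1 fg !cmodM cmodX zr cmod_lin_prod.
  have P0 : 0 < \prod_(a <- s) cmod (z - a) by rewrite big_seq; apply: prodr_gt0.
  have g0 : 0 < cmod (g z) by rewrite cmod_gt0 gr// zr.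
  rewrite lnM ?posrE ?exprn_gt0 ?mulr_gt0// lnM ?posrE// ln_prod// lnXn// mulr_natl//.
rewrite cmeanD; last 2 first.
- exact: circ_cts_cst.
- by apply: circ_ctsD => //; exact: circ_cts_sum.
rewrite cmeanD//; last exact: circ_cts_sum.
rewrite cmean_cst cmean_sum// (@cmean_ln _ g (r + 1))//; last 2 first.
- by lra.
- by move=> z zr; apply: gA; rewrite ltW.
rewrite fg cmodM cmod_lin_prod.
have a0 a : a \in s -> 0 < cmod (0 - a) by move=> /s0; rewrite sub0r cmodN cmod_gt0.
rewrite lnM ?posrE; last 2 first.
- by rewrite big_seq; apply: prodr_gt0.
- by rewrite cmod_gt0 gr// cmod0.
rewrite ln_prod//.
suff -> : \sum_(a <- s) cmean (fun z => ln (cmod (z - a))) r =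
   2 * pi * (\sum_(a <- s) Num.max 0 (ln (r / cmod a))) + 2 * pi * (\sum_(a <- s) ln (cmod (0 - a))).
  ring.
rewrite -mulrDr -big_split /= mulr_sumr !big_seq; apply: eq_bigr => a as_.
rewrite cmean_ln_linear ?sr//; congr (_ * _).
have ap : 0 < cmod a by have := a0 a as_; rewrite sub0r cmodN.
rewrite sub0r cmodN ln_div ?posrE//.
have [ra|ra] := leP r (cmod a).
  by rewrite max_l ?add0r// subr_le0 ler_ln ?posrE.
by rewrite max_r ?subrK// subr_ge0 ler_ln ?posrE// ltW.
Qed.

Lemma N_zeros_ge0 f z0 r : entire f -> f z0 != 0 -> 1 <= r -> 0 <= N_zeros r f.
Proof.
move=> ef f0 r1; have [//|s [g [eg fg sA gA]]] := @factor_zeros _ f (fun a => cmod a <= r) r z0 ef f0.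
rewrite (N_zeros_lin_prod eg fg gA) ?(lt_le_trans _ r1)//.
rewrite addr_ge0// ?mulr_ge0 ?ln_ge0// sumr_ge0// => a _; by rewrite le_max lexx.
Qed.

Lemma logder_lin_prod f s g z : entire g -> (forall z, f z = lin_prod s z * g z) ->
  f z != 0 -> f^`()%classic z / f z = \sum_(a <- s) (z - a)^-1 + g^`()%classic z / g z.
Proof.
move=> eg; elim: s f => [|a s ih] f fg fz.
  rewrite big_nil add0r (_ : f = g)//; apply/funext => w.
  by rewrite fg /lin_prod big_nil mul1r.
pose h w := lin_prod s w * g w.
have eh : entire h by exact: (entireM (@entire_lin_prod _ s) eg).
have fh w : f w = (w - a) * h w by rewrite fg lin_prod_cons mulrA.
have := fz; rewrite fh mulf_eq0 negb_or => /andP[za hz].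
rewrite big_cons -addrA -(ih h)//.
have -> : f^`()%classic z = h z + (z - a) * h^`()%classic z.
  apply: is_derive_derive1; rewrite (_ : f = (fun w => (w - a) * h w)); last exact/funext.
  by apply: cder_eq (cderM (cderBid a z) (entire_is_derive z eh)) _; rewrite mul1r.
by field; rewrite za hz.
Qed.

Lemma half_le_ln2 : 2^-1 <= ln 2 :> R.
Proof.
have := @le_ln1Dx R (- 2^-1); have -> : 1 + - 2^-1 = 2^-1 :> R by field.
rewrite lnV ?posrE// lerN2; apply.
by rewrite ltrN2 invf_lt1// ltr1n.
Qed.

Lemma ln_le_id x : 0 < x -> ln x <= x.
Proof. by move=> /ln_sublinear/ltW. Qed.

(** At most exponential type; the added 1 absorbs constant factors. *)
Definition exp_bound f B := forall z, cmod (f z) <= expR (B * (cmod z + 1)).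

(** The zeros within [3 * r], O(r) in number, are split off. Each costs [2 * pi / r] by
    [cmean_lnp_inv], so together O(1). For the zero-free factor [g] the Borel-Caratheodory
    inequality at every point of the circle bounds [g' / g] by [X]. The mean of [X] is O(r), and
    concavity of the logarithm turns this into O(log r) for [lnp X]. *)
Lemma logder_mean0 f B : entire f -> f 0 != 0 -> 0 <= B -> exp_bound f B ->
  exists2 C : R, 0 <= C & forall r, 1 <= r -> (forall z, cmod z = r -> f z != 0) ->
    cmean (fun z => lnp (cmod (f^`()%classic z / f z))) r <= C * (1 + ln r).
Proof.
move=> ef f0 B0 fB.
have p0 := @twopi_gt0 R; set p := 2 * pi in p0.
pose L0 := `|ln (cmod (f 0))|.
have L00 : 0 <= L0 by exact: normr_ge0.
(* [C1 * r] will bound the number of zeros and [C2 * r] the mean of [X], up to the factor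
   [2 * pi]. *)
pose C1 := 2 * (10 * B + L0); pose C2 := 2 * (10 * B + L0 + 3 * C1).
have C10 : 0 <= C1 by rewrite /C1 mulr_ge0// addr_ge0// mulr_ge0.
have C20 : 0 <= C2 by rewrite /C2 mulr_ge0// !addr_ge0// mulr_ge0.
have l20 : 0 <= ln 2 :> R by apply: ln_ge0; rewrite ler1n.
exists (p * (ln 2 + lnp C1 + C1 + C2 + 2)).
  by rewrite mulr_ge0 ?(ltW p0)// !addr_ge0// lnp_ge0.
move=> r r1 fr; have r0 : 0 < r by lra.
have r0' := ltW r0.
have lr0 : 0 <= ln r by exact: ln_ge0.
have fp : 0 < cmod (f 0) by rewrite cmod_gt0.
have [//|s [g [eg fg sA gA]]] :=
  @factor_zeros _ f (fun a => cmod a <= 3 * r) (3 * r) 0 ef f0.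
pose n := (size s)%:R : R.
have n0 : 0 <= n by exact: ler0n.
(* [9 * r] is three times the radius [3 * r] of the disc of zeros, as in [factor_bound];
   [9 * r + 1 <= 10 * r] gives the factor 10. *)
have f9 z : cmod z = 9 * r -> cmod (f z) <= expR (10 * B * r).
  move=> zr; apply: le_trans (fB z) _; rewrite ler_expR zr; nra.
have nC1 : n <= C1 * r.
  have : 2 ^+ size s * cmod (f 0) <= expR (10 * B * r).
    apply: (@factor_bound _ f g s 0 (3 * r) (3 * r)) => //; first by lra.
    - by rewrite cmod0 addr0.
    - by move=> z; rewrite subr0 => zr; apply: f9; rewrite zr; ring.
  rewrite -ler_ln ?posrE ?mulr_gt0 ?exprn_gt0 ?expR_gt0// expRK.
  rewrite lnM ?posrE ?exprn_gt0// lnXn// -[_ *+ size s]mulr_natl -/n => H.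
  have := half_le_ln2; have : - L0 <= ln (cmod (f 0)) by rewrite /L0 lerNl -normrN ler_norm.
  rewrite /C1; nra.
have g9 z : cmod z <= 9 * r -> cmod (g z) <= expR (10 * B * r).
  move=> zr; apply: (@max_principle _ g 0 (9 * r + 1) (9 * r)) => //.
  - by lra.
  - move=> w; rewrite subr0 => wr; apply: le_trans (f9 w wr).
    rewrite fg cmodM cmod_lin_prod -[leLHS]mul1r ler_wpM2r ?cmod_ge0//.
    apply: le_trans (_ : (6 * r) ^+ size s <= _).
      by apply: exprn_ege1; lra.
    apply: pow_le_prod => [|a as_]; first by lra.
    by have := cmod_subl w a; have := sA a as_; rewrite wr; lra.
  - by rewrite subr0.
pose A := 10 * B * r.
have lnA z : cmod z <= 3 * r -> ln (cmod (g z)) <= A.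
  move=> zr; rewrite /A -(expRK (10 * B * r)) ler_ln ?posrE ?expR_gt0// ?cmod_gt0 ?gA//.
  by apply: g9; lra.
pose X z := 2 / r * (A - ln (cmod (g z))).
have X0 z : cmod z = r -> 0 <= X z.
  by move=> zr; rewrite mulr_ge0 ?divr_ge0// subr_ge0 lnA// zr; lra.
have gX z : cmod z = r -> cmod (g^`()%classic z / g z) <= X z.
  move=> zr; apply: (@borel_caratheodory _ g z (2 * r) r) => //; first by lra.
  - move=> w wz; apply: gA; have := cmodD (w - z) z; rewrite subrK zr; lra.
  - move=> w wz; apply: lnA; have := cmodD (w - z) z; rewrite subrK zr wz; lra.
have gc : circ_cts (fun z => ln (cmod (g z))) r.
  by apply: circ_cts_ln => // z zr; [exact: entire_ctsC|apply: gA; rewrite zr; lra].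
have Xc : circ_cts X r by apply: circ_ctsZ; apply: circ_ctsB => //; exact: circ_cts_cst.
have mX : cmean X r <= p * C2 * r.
  rewrite cmeanZ; last by apply: circ_ctsB => //; exact: circ_cts_cst.
  rewrite cmeanB//; last exact: circ_cts_cst.
  rewrite cmean_cst (@cmean_ln _ g (2 * r))//; last 2 first.
  - by lra.
  - by move=> z zr; apply: gA; lra.
  (* The crude [ln x <= x] at the zeros costs a factor [r], which is harmless because [X] is used
     through its logarithm only. *)
  have lg : - L0 - n * (3 * r) <= ln (cmod (g 0)).
    have a0 a : a \in s -> 0 < cmod (0 - a).
      move=> as_; rewrite cmod_gt0; apply: contraNneq f0 => za.
      rewrite fg mulf_eq0; apply/orP; left.
      by rewrite /lin_prod prodf_seq_eq0; apply/hasP; exists a => //=; rewrite za.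
    have : - L0 <= ln (cmod (f 0)) by rewrite /L0 lerNl -normrN ler_norm.
    rewrite fg cmodM cmod_lin_prod lnM ?posrE; last 2 first.
    - by rewrite big_seq; apply: prodr_gt0.
    - by rewrite cmod_gt0 gA// cmod0; lra.
    rewrite ln_prod//.
    have : \sum_(a <- s) ln (cmod (0 - a)) <= n * (3 * r).
      have -> : n * (3 * r) = \sum_(a <- s) (3 * r).
        by rewrite big_const_seq count_predT iter_addr_0 -[RHS]mulr_natl.
      rewrite !big_seq; apply: ler_sum => a as_.
      apply: le_trans (ln_le_id (a0 a as_)) _; rewrite sub0r cmodN; exact: sA.
    lra.
  rewrite -/p -mulrBr.
  have -> : 2 / r * (p * (A - ln (cmod (g 0)))) = p * (2 / r * (A - ln (cmod (g 0)))) by ring.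
  rewrite -(mulrA p C2 r) (ler_wpM2l (ltW p0))// mulrAC ler_pdivrMr// /C2 /A.
  have : n * (3 * r) <= C1 * r * (3 * r) by rewrite ler_wpM2r//; lra.
  have : L0 * 1 <= L0 * r * r by rewrite -mulrA ler_wpM2l//; nra.
  have : 10 * B * r <= 10 * B * r * r by rewrite ler_peMr// !mulr_ge0.
  by move: lg; clear; lra.
(* Tangent to the logarithm at scale [r]: [ln x <= ln r + x / r - 1]; the [- 1] pays for the maximum
   with 1, as [1 <= r]. *)
have lnpX' z : cmod z = r -> lnp (X z) <= ln r + X z / r.
  move=> zr; have Xz := X0 z zr; rewrite lnpE.
  have m0 : 0 < Num.max 1 (X z) by rewrite lt_max ltr01.
  rewrite -{1}(divfK (lt0r_neq0 r0) (Num.max 1 (X z))) lnM ?posrE ?divr_gt0// addrC lerD2l.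
  have : ln (1 + (Num.max 1 (X z) / r - 1)) <= Num.max 1 (X z) / r - 1.
    by apply: le_ln1Dx; have := divr_gt0 m0 r0; lra.
  rewrite addrC subrK => /le_trans; apply.
  rewrite lerBlDr -(ler_pM2r r0) mulrDl mul1r !divfK ?(lt0r_neq0 r0)//.
  by rewrite ge_max; apply/andP; split; clear -r1 Xz; lra.
have sr a : a \in s -> cmod a != r.
  move=> as_; apply/eqP => ar; have /eqP := fr a ar; apply.
  rewrite fg /lin_prod; apply/eqP; rewrite mulf_eq0; apply/orP; left.
  by rewrite prodf_seq_eq0; apply/hasP; exists a => //=; rewrite subrr.
have ic a : a \in s -> circ_cts (fun z => lnp (cmod (z - a)^-1)) r.
  move=> as_; apply: circ_cts_lnp => // z zr; apply: is_derive_cts.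
  apply: (@cderV _ (fun w => w - a) z 1 _ (cderBid a z)).
  by rewrite subr_eq0; apply: contraNneq (sr a as_) => <-; rewrite zr.
pose V z := lnp n + \sum_(a <- s) lnp (cmod (z - a)^-1) + (ln r + r^-1 * X z) + ln 2.
have Vc1 : circ_cts (fun z => lnp n + \sum_(a <- s) lnp (cmod (z - a)^-1)) r.
  by apply: circ_ctsD; [exact: circ_cts_cst|exact: circ_cts_sum].
have Vc2 : circ_cts (fun z => ln r + r^-1 * X z) r.
  by apply: circ_ctsD; [exact: circ_cts_cst|exact: circ_ctsZ].
have Vc : circ_cts V r.
  by apply: circ_ctsD; [exact: circ_ctsD|exact: circ_cts_cst].
apply: le_trans (_ : cmean V r <= _).
  apply: le_cmean => //.
    apply: circ_cts_lnp => // z zr; have ef' := entire_derivative ef.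
    exact: is_derive_cts (cderM (entire_is_derive z ef') (cderV (fr z zr) (entire_is_derive z ef))).
  move=> z zr; have E := logder_lin_prod eg fg (fr z zr).
  rewrite [X in lnp (cmod X) <= _]E.
  apply: le_trans (le_lnp (cmodD _ _)) _.
  apply: le_trans (lnpD (cmod_ge0 _) (cmod_ge0 _)) _; rewrite lerD2r; apply: lerD.
    apply: le_trans (le_lnp (cmod_sum _ _ _)) _.
    apply: lnp_sum => a; exact: cmod_ge0.
  by apply: le_trans (le_lnp (gX z zr)) _; rewrite (mulrC r^-1); exact: lnpX'.
rewrite /V cmeanD//; last 2 first.
- exact: circ_ctsD.
- exact: circ_cts_cst.
rewrite cmeanD// cmeanD//; last 2 first.
- exact: circ_cts_cst.
- exact: circ_cts_sum.
rewrite cmeanD//; last 2 first.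
- exact: circ_cts_cst.
- exact: circ_ctsZ.
rewrite !cmean_cst cmean_sum// cmeanZ// -/p.
have S1 : \sum_(a <- s) cmean (fun z => lnp (cmod (z - a)^-1)) r <= p * C1.
  apply: le_trans (_ : \sum_(a <- s) p / r <= _).
    rewrite !big_seq; apply: ler_sum => a as_; exact: cmean_lnp_inv (sr a as_).
  rewrite big_const_seq count_predT iter_addr_0 -[_ *+ size s]mulr_natl -/n mulrCA ler_wpM2l ?(ltW p0)//.
  by rewrite ler_pdivrMr.
have S2 : r^-1 * cmean X r <= p * C2 by rewrite mulrC ler_pdivrMr.
have S3 : lnp n <= lnp C1 + ln r.
  apply: le_trans (le_lnp nC1) _; apply: le_trans (lnpM C10 r0') _.
  by rewrite lerD2l {1}/lnp max_r.
have : p * lnp n <= p * (lnp C1 + ln r) by rewrite ler_wpM2l ?(ltW p0).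
have : 0 <= p * ((ln 2 + lnp C1 + C1 + C2) * ln r).
  by rewrite mulr_ge0 ?(ltW p0)// mulr_ge0// !addr_ge0// lnp_ge0.
by move: S1 S2 p0; clear; lra.
Qed.

(** On the circle of radius [cmod z + 1] the factor [z ^+ m] has modulus at least 1; the maximum
    principle carries the bound inside, and the larger radius is paid for by doubling [B]. *)
Lemma exp_bound_factor f B m f1 : entire f1 -> 0 <= B -> exp_bound f B ->
  (forall z, f z = z ^+ m * f1 z) -> exp_bound f1 (2 * B).
Proof.
move=> ef1 B0 fB ff1 z; have z0 := cmod_ge0 z.
apply: (@max_principle _ f1 0 (cmod z + 2) (cmod z + 1)) => //.
- by lra.
- move=> w; rewrite subr0 => wz.
  apply: le_trans (_ : cmod (f w) <= _).
    rewrite ff1 cmodM cmodX wz ler_peMl ?cmod_ge0// exprn_ege1//; lra.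
  apply: le_trans (fB w) _; rewrite ler_expR wz; nra.
- by rewrite subr0; lra.
Qed.

(** A zero of order [m] at the origin is split off; it adds [m / z] to the logarithmic derivative,
    of modulus at most [m] on circles with [r >= 1]. *)
Lemma logder_mean f B z0 : entire f -> f z0 != 0 -> 0 <= B -> exp_bound f B ->
  exists2 C : R, 0 <= C & forall r, 1 <= r -> (forall z, cmod z = r -> f z != 0) ->
    cmean (fun z => lnp (cmod (f^`()%classic z / f z))) r <= C * (1 + ln r).
Proof.
move=> ef f0 B0 fB; have [m [f1 [ef1 f10 ff1]]] := zero_split ef f0.
have B20 : 0 <= 2 * B by rewrite mulr_ge0.
have [C C0 HC] := logder_mean0 ef1 f10 B20 (exp_bound_factor ef1 B0 fB ff1).
have p0 := ltW (@twopi_gt0 R).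
have l20 : 0 <= ln 2 :> R by apply: ln_ge0; rewrite ler1n.
exists (C + 2 * pi * (lnp m%:R + ln 2)).
  by rewrite addr_ge0// mulr_ge0// addr_ge0// lnp_ge0.
move=> r r1 fr; have r0 : 0 < r by lra.
have f1r z : cmod z = r -> f1 z != 0.
  by move=> /fr; rewrite ff1 mulf_eq0 negb_or => /andP[].
have lc (h : R[i] -> R[i]) : entire h -> (forall z, cmod z = r -> h z != 0) ->
    circ_cts (fun z => lnp (cmod (h^`()%classic z / h z))) r.
  move=> eh hr; apply: circ_cts_lnp; first exact: ltW.
  move=> z zr; have eh' := entire_derivative eh.
  exact: is_derive_cts (cderM (entire_is_derive z eh') (cderV (hr z zr) (entire_is_derive z eh))).
apply: le_trans (_ : cmean (fun z => lnp (cmod (f1^`()%classic z / f1 z)) + (lnp m%:R + ln 2)) r <= _).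
  apply: le_cmean; [exact: ltW|exact: lc|by apply: circ_ctsD; [exact: lc|exact: circ_cts_cst]|].
  move=> z zr.
  have fs w : f w = lin_prod (nseq m 0) w * f1 w by rewrite lin_prod_nseq0.
  have E := logder_lin_prod ef1 fs (fr z zr).
  rewrite [X in lnp (cmod X) <= _]E.
  apply: le_trans (le_lnp (cmodD _ _)) _.
  apply: le_trans (lnpD (cmod_ge0 _) (cmod_ge0 _)) _.
  rewrite addrAC addrC lerD2l lerD2r; apply: le_lnp.
  rewrite big_nseq iter_addr_0 -[_ *+ m]mulr_natl subr0 cmodM cmod_nat.
  by rewrite cmodV zr ler_piMr// invf_le1.
rewrite cmeanD; last 2 first.
- exact: lc.
- exact: circ_cts_cst.
rewrite cmean_cst [leRHS]mulrDl; apply: lerD; first exact: HC.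
by rewrite ler_peMr ?lerDl ?ln_ge0// mulr_ge0// addr_ge0// lnp_ge0.
Qed.

End JensenLogDerivative.

(** * Growth of solutions *)

Section ExponentialGrowth.
Context {R : realType}.
Implicit Types (f g : R[i] -> R[i]) (a z w : R[i]) (r t x y B d : R).

(** Each derivative costs one Cauchy estimate with radius [d / k.+1]; [k.+1] of them fit into the
    collar of width [d]. *)
Lemma derive1n_bound f r d (Y : R) k n : entire f -> 0 < d -> 0 <= Y ->
  (n <= k.+1)%N ->
  (forall w, cmod w <= r + d -> cmod (f w) <= Y) ->
  forall z, cmod z <= r + d - n%:R * (d / k.+1%:R) ->
    cmod (f^`(n)%classic z) <= Y * (k.+1%:R / d) ^+ n.
Proof.
move=> ef d0 Y0; elim: n => [|n IH] nk fY z zr.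
  by rewrite expr0 mulr1; apply: fY; move: zr; rewrite mul0r subr0.
have h0 : 0 < d / k.+1%:R by rewrite divr_gt0 // ltr0n.
have en := @entire_derive1n _ f n ef.
rewrite derive1nS exprSr; set q := k.+1%:R / d; rewrite [leRHS]mulrA.
have -> : Y * q ^+ n * q = Y * q ^+ n / (d / k.+1%:R) by rewrite invf_div.
apply: (@cauchy_estimate _ _ z (d / k.+1%:R + 1) (d / k.+1%:R)) => //.
  by rewrite ltrDl.
move=> w wz; apply: (IH (ltnW nk) fY).
have := cmodD (w - z) z; rewrite subrK wz => h.
apply: (le_trans h); move: zr; rewrite -[n.+1%:R]natr1 mulrDl mul1r.
by move: (d / k.+1%:R) (n%:R * _) => x y; clear; lra.
Qed.

Lemma exp_bound_derivative f B : entire f -> 0 <= B -> exp_bound f B ->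
  exp_bound f^`()%classic (2 * B).
Proof.
move=> ef B0 fB z.
rewrite -[X in _ <= X](divr1).
apply: (@cauchy_estimate _ _ z 2 1) => //; first by rewrite ltr1n.
move=> w wz; apply: (le_trans (fB w)); rewrite ler_expR.
have := cmodD (w - z) z; rewrite subrK wz => h.
have z0 := cmod_ge0 z.
have -> : 2 * B * (cmod z + 1) = B * (2 * (cmod z + 1)) by ring.
by apply: ler_wpM2l => //; lra.
Qed.

Lemma exp_bound_derive1n f B n : entire f -> 0 <= B -> exp_bound f B ->
  exp_bound f^`(n)%classic (2 ^+ n * B).
Proof.
move=> ef B0 fB; elim: n => [|n IH]; first by rewrite expr0 mul1r.
rewrite derive1nS exprS -mulrA.
have en := @entire_derive1n _ f n ef.
have Bn : 0 <= 2 ^+ n * B by rewrite mulr_ge0 // exprn_ge0.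
exact: exp_bound_derivative en Bn IH.
Qed.

Lemma cmod_cexpM_le (c z : R[i]) : cmod (cexp (c * z)) <= expR (cmod c * cmod z).
Proof. by rewrite cmod_cexp ler_expR (le_trans (Re_le _)) // cmodM. Qed.

(* The bootstrap: a bound Y on the larger disc only enters linearly on the
   right, while the left side is cubic in f. *)
Lemma cubic_step f k (a : 'I_k.+1 -> R[i]) (p1 p2 g1 g2 : R[i]) :
  entire f ->
  (forall z, f z ^+ 2 * f^`()%classic z + lin_diff_poly a f z
             = p1 * cexp (g1 * z) + p2 * cexp (g2 * z)) ->
  exists C K : R, [/\ 0 <= C, 0 <= K & forall r d (Y : R),
    0 <= r -> 0 < d -> d <= 1 -> 0 <= Y ->
    (forall w, cmod w <= r + d -> cmod (f w) <= Y) ->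
    forall z, cmod z <= r ->
      cmod (f z) ^+ 3 <= C * (r + 1) * (expR (K * r) + Y * d^-1 ^+ k)].
Proof.
move=> ef feq.
pose A : R := \sum_(j < k.+1) cmod (a j).
have A0 : 0 <= A by apply: sumr_ge0 => j _; apply: cmod_ge0.
pose p := cmod p1 + cmod p2.
have p0 : 0 <= p by rewrite addr_ge0 // cmod_ge0.
pose G := cmod g1 + cmod g2.
have G0 : 0 <= G by rewrite addr_ge0 // cmod_ge0.
pose N : R := k.+1%:R ^+ k.
have N0 : 0 <= N by rewrite exprn_ge0.
have AN0 : 0 <= A * N by rewrite mulr_ge0.
have f00 : 0 <= cmod (f 0) ^+ 3 by rewrite exprn_ge0 // cmod_ge0.
(* The 3 stems from [(f ^ 3)' = 3 f ^ 2 f']; [p] bounds the coefficients of the exponentials,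
   [A * N] those of the linear part after the Cauchy estimates. *)
exists (cmod (f 0) ^+ 3 + 3 * (p + A * N)), G; split=> //; first by lra.
move=> r d Y r0 d0 d1 Y0 fY z zr.
have k0 : (0 : R) < k.+1%:R by rewrite ltr0n.
have dV : 1 <= d^-1 by rewrite invf_ge1.
have fj (j : 'I_k.+1) w : cmod w <= r -> cmod (f^`(j)%classic w) <= Y * (N * d^-1 ^+ k).
  move=> wr; apply: (le_trans (@derive1n_bound f r d Y k j ef d0 Y0 _ fY w _)).
  - exact: (ltnW (ltn_ord j)).
  - apply: (le_trans wr); rewrite -addrA lerDl subr_ge0 mulrCA ger_pMr //.
    by rewrite ler_pdivrMr // mul1r ler_nat ltnW.
  - apply: ler_wpM2l => //; rewrite /N -exprMn.
    apply: ler_weXn2l; last by rewrite -ltnS.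
    by rewrite -[X in X <= _]mulr1 ler_pM // ler1n.
pose E := expR (G * r); pose D := d^-1 ^+ k.
have E1 : 1 <= E by rewrite -expR0 ler_expR mulr_ge0.
have D0 : 0 <= Y * D by rewrite mulr_ge0 // exprn_ge0 // invr_ge0 ltW.
have exple c w : cmod c <= G -> cmod w <= r -> cmod (cexp (c * w)) <= E.
  move=> cG wr; apply: (le_trans (cmod_cexpM_le c w)); rewrite ler_expR.
  by rewrite ler_pM // cmod_ge0.
have bnd w : cmod w <= r -> cmod (f w ^+ 2 * f^`()%classic w) <= p * E + A * N * (Y * D).
  move=> wr; have -> : f w ^+ 2 * f^`()%classic w =
     p1 * cexp (g1 * w) + p2 * cexp (g2 * w) - lin_diff_poly a f w.
    by rewrite -feq addrK.
  apply: (le_trans (cmodB _ _)); apply: lerD.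
    apply: (le_trans (cmodD _ _)); rewrite (cmodM p1) (cmodM p2) mulrDl; apply: lerD.
      by apply: ler_wpM2l; [apply: cmod_ge0|apply: exple => //; rewrite lerDl cmod_ge0].
    by apply: ler_wpM2l; [apply: cmod_ge0|apply: exple => //; rewrite lerDr cmod_ge0].
  apply: (le_trans (cmod_sum _ _ _)).
  have -> : A * N * (Y * D) = \sum_(j < k.+1) cmod (a j) * (Y * (N * D)).
    by rewrite -mulr_suml /A; ring.
  apply: ler_sum => j _; rewrite cmodM; apply: ler_wpM2l; first exact: cmod_ge0.
  exact: fj.
have T0 : 0 <= p * E + A * N * (Y * D).
  by apply: le_trans (bnd 0 _); rewrite ?cmod_ge0 ?cmod0.
have inseg (t : R) : 0 <= t <= 1 -> cmod (0 + t%:C * z) <= r.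
  move=> t01; apply: le_trans zr; rewrite add0r cmodM cmod_real.
  by case/andP: t01 => ? ?; rewrite ger0_norm // ler_piMl // cmod_ge0.
have := @is_derive_mvt _ (fun w => f w * (f w * f w)) 0 z
  (fun w => 3 * (f w ^+ 2 * f^`()%classic w)) (3 * (p * E + A * N * (Y * D))).
move=> mvt.
have {mvt} mv : cmod (f z * (f z * f z) - f 0 * (f 0 * f 0)) <=
   3 * (p * E + A * N * (Y * D)) * cmod z.
  rewrite -[in f z](add0r z); apply: mvt => [t _|t t01].
    set w := (0 + _ * _).
    have h := entire_is_derive w ef.
    by apply: (cder_eq (cderM h (cderM h h))); ring.
  rewrite cmodM (cmod_nat 3); apply: ler_wpM2l => //.
  by apply: bnd; apply: inseg.
have -> : cmod (f z) ^+ 3 = cmod (f z * (f z * f z)) by rewrite !cmodM; ring.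
have s := cmod_subl (f z * (f z * f z)) (f 0 * (f 0 * f 0)).
have f0E : cmod (f 0 * (f 0 * f 0)) = cmod (f 0) ^+ 3 by rewrite !cmodM; ring.
have mv2 : 3 * (p * E + A * N * (Y * D)) * cmod z <=
   3 * (p * E + A * N * (Y * D)) * r.
  by apply: ler_wpM2l => //; rewrite mulr_ge0.
rewrite -/E -/D.
have x1 : 3 * (p * E + A * N * (Y * D)) * r <= 3 * (p + A * N) * (E + Y * D) * (r + 1).
  have -> : 3 * (p + A * N) * (E + Y * D) * (r + 1) =
    3 * (p * E + A * N * (Y * D)) * r +
    (3 * (p * E + A * N * (Y * D)) + 3 * (p * (Y * D) + (A * N) * E) * (r + 1)) by ring.
  rewrite lerDl; apply: addr_ge0; first by rewrite mulr_ge0.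
  apply: mulr_ge0; last by lra.
  apply: mulr_ge0 => //; apply: addr_ge0; apply: mulr_ge0 => //.
  by apply: (le_trans _ E1).
have x2 : cmod (f 0) ^+ 3 <= cmod (f 0) ^+ 3 * ((r + 1) * (E + Y * D)).
  rewrite ler_peMr //.
  rewrite -[X in X <= _]mulr1; apply: ler_pM => //; lra.
have -> : (cmod (f 0) ^+ 3 + 3 * (p + A * N)) * (r + 1) * (E + Y * D) =
  cmod (f 0) ^+ 3 * ((r + 1) * (E + Y * D)) + 3 * (p + A * N) * (E + Y * D) * (r + 1) by ring.
rewrite f0E in s; move: s mv mv2 x1 x2; clear; lra.
Qed.

(** By contradiction: a value above [Y n] on the disc of radius [rad n] forces a value above
    [Y n.+1 = Y n ^+ 2] on the next disc, since otherwise the cubic inequality would bound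
    [cmod (f z) ^+ 3] by less than [Y n ^+ 3]. All discs lie within radius [r0 + 1], where [f] is
    bounded, while [Y n] tends to infinity. *)
Lemma cubic_exp_bound f k (C K : R) : entire f -> 0 <= C -> 0 <= K ->
  (forall r d (Y : R), 0 <= r -> 0 < d -> d <= 1 -> 0 <= Y ->
    (forall w, cmod w <= r + d -> cmod (f w) <= Y) ->
    forall z, cmod z <= r ->
      cmod (f z) ^+ 3 <= C * (r + 1) * (expR (K * r) + Y * d^-1 ^+ k)) ->
  exists2 B, 0 <= B & exp_bound f B.
Proof.
move=> ef C0 K0 step.
have k0 : (0 : R) <= k%:R by [].
(* Large enough that [2 * C + (r0 + 1) + K * (r0 + 1) + k * n.+1 < n.+1 * B * (r0 + 1)] for all [n];
   the terms with [K] and [k] come from the right-hand side of the cubic inequality with [d] equal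
   to [2] to the power [- n.+1]. *)
pose B := 2 * C + K + k%:R + 2.
have B2 : 2 <= B by rewrite /B; lra.
exists B; first by lra.
move=> z0; rewrite leNgt; apply/negP => fz0.
set r0 := cmod z0 in fz0 *.
have r00 : 0 <= r0 by apply: cmod_ge0.
pose Y n := expR (2 ^+ n * (B * (r0 + 1))).
pose rad (n : nat) : R := r0 + 1 - (2 ^+ n)^-1.
have two_gt0 n : (0 : R) < 2 ^+ n by rewrite exprn_gt0.
have radr n : r0 <= rad n <= r0 + 1.
  rewrite /rad; have := @exprn_ege1 _ n (2 : R) (ler1n _ 2) => h.
  have : (2 ^+ n)^-1 <= 1 :> R by rewrite invf_le1.
  have : 0 < (2 ^+ n)^-1 :> R by rewrite invr_gt0.
  by move=> ? ?; apply/andP; split; lra.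
have nle n : n.+1%:R <= 2 ^+ n :> R by rewrite -natrX ler_nat ltn_expl.
have claim n : exists2 z, cmod z <= rad n & Y n < cmod (f z).
  elim: n => [|n [z zr Yz]].
    exists z0; rewrite ?/Y ?expr0 ?mul1r //.
    by rewrite /rad expr0 invr1 addrK.
  apply: contrapT => Hn.
  have dE : rad n.+1 = rad n + (2 ^+ n.+1)^-1.
    rewrite /rad; have := two_gt0 n; rewrite exprS => /lt0r_neq0 h.
    by field.
  have Y1 m : 1 <= Y m.
    rewrite -expR0 ler_expR; apply: mulr_ge0; first by rewrite ltW.
    by apply: mulr_ge0; lra.
  have Y0 m : 0 <= Y m by rewrite expR_ge0.
  have := step (rad n) (2 ^+ n.+1)^-1 (Y n.+1).
  move=> {}step; have {step} : cmod (f z) ^+ 3 <=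
      C * (rad n + 1) * (expR (K * rad n) + Y n.+1 * (2 ^+ n.+1)^-1^-1 ^+ k).
    apply: step => //.
    - by case/andP: (radr n) => ? _; lra.
    - by rewrite invf_le1 // exprn_ege1 // ler1n.
    - move=> w; rewrite -dE => wr; rewrite leNgt; apply/negP => fw.
      by apply: Hn; exists w.
  rewrite invrK; apply/negP; rewrite -ltNge.
  have -> : Y n.+1 = Y n ^+ 2 by rewrite /Y -expRM_natl; congr expR; rewrite exprS; ring.
  apply: (@lt_trans _ _ (Y n ^+ 3)); last first.
    by rewrite ltrXn2r // ?nnegrE ?Y0 ?cmod_ge0.
  have Y2 : 1 <= Y n ^+ 2 by rewrite exprn_ege1.
  apply: (@le_lt_trans _ _ (C * (rad n + 1) * (expR (K * rad n) + (2 ^+ n.+1) ^+ k) * Y n ^+ 2)).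
    rewrite -[X in _ <= X]mulrA; apply: ler_wpM2l.
      by apply: mulr_ge0 => //; case/andP: (radr n) => ? _; lra.
    rewrite mulrDl [X in _ + X]mulrC lerD2r.
    by rewrite ler_peMr // expR_ge0.
  rewrite [Y n ^+ 3]exprS ltr_pM2r; last by apply: (lt_le_trans ltr01).
  have [rl ru] := andP (radr n).
  have e1 : expR (K * rad n) <= expR (K * (r0 + 1) + k%:R * n.+1%:R).
    rewrite ler_expR; apply: (@le_trans _ _ (K * (r0 + 1))); first exact: ler_wpM2l.
    by rewrite lerDl mulr_ge0.
  have e2 : (2 ^+ n.+1) ^+ k <= expR (K * (r0 + 1) + k%:R * n.+1%:R) :> R.
    apply: (@le_trans _ _ (expR (k%:R * n.+1%:R))); last first.
      by rewrite ler_expR lerDr mulr_ge0 //; lra.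
    rewrite -exprM mulnC -natrM -(mulr1 (_ * _)%N%:R) expRM_natl.
    by apply: lerXn2r; rewrite ?nnegrE ?expR_ge0 //; apply: (le_trans _ (expR_ge1Dx 1)); lra.
  set E := expR (K * (r0 + 1) + k%:R * n.+1%:R) in e1 e2.
  have E0 : 0 <= E by rewrite expR_ge0.
  apply: (@le_lt_trans _ _ (C * (r0 + 1 + 1) * (E + E))).
    apply: ler_pM.
    - by apply: mulr_ge0 => //; lra.
    - by apply: addr_ge0; rewrite ?expR_ge0 // !exprn_ge0.
    - by apply: ler_wpM2l => //; lra.
    - exact: lerD.
  have c1 : 2 * C <= expR (2 * C) by apply: le_trans (expR_ge1Dx _); lra.
  have c2 : r0 + 1 + 1 <= expR (r0 + 1) by apply: le_trans (expR_ge1Dx _); lra.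
  apply: (@le_lt_trans _ _ (expR (2 * C) * expR (r0 + 1) * E)).
    have -> : C * (r0 + 1 + 1) * (E + E) = (2 * C * (r0 + 1 + 1)) * E by ring.
    by apply: ler_wpM2r => //; apply: ler_pM => //; lra.
  rewrite /E -!expRD ltr_expR.
  have n1 := nle n.
  have n0 : 1 <= n.+1%:R :> R by rewrite ler1n.
  apply: (@lt_le_trans _ _ (n.+1%:R * (B * (r0 + 1)))); last first.
    by apply: ler_wpM2r => //; apply: mulr_ge0; lra.
  rewrite /B; set m : R := n.+1%:R in n0 *.
  have m1 : 0 <= m - 1 by lra.
  have q1 := mulr_ge0 m1 C0.
  have q2 := mulr_ge0 q1 r00.
  have q3 := mulr_ge0 m1 K0.
  have q4 := mulr_ge0 q3 r00.
  have q5 := mulr_ge0 m1 k0.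
  have q6 := mulr_ge0 (mulr_ge0 k0 r00) m1.
  have q7 := mulr_ge0 m1 r00.
  have q8 := mulr_ge0 C0 r00.
  have q9 := mulr_ge0 k0 r00.
  by move: q1 q2 q3 q4 q5 q6 q7 q8 q9 n0 r00 C0 K0 k0; clear; nra.
have [M M0 fM] := @holo_bounded _ f 0 (r0 + 2) (r0 + 1) ltac:(lra) ltac:(lra) (entire_holo ef).
have [n Mn] : exists n : nat, M < n%:R.
  by exists (Num.bound M); apply: archi_boundP.
have [z zr Yz] := claim n.
have : cmod (f z) <= M.
  by apply: fM; rewrite subr0; apply: (le_trans zr); case/andP: (radr n).
apply/negP; rewrite -ltNge; apply: (lt_trans Mn); apply: le_lt_trans Yz.
apply: le_trans (expR_ge1Dx _); have := nle n; rewrite -natr1 => h.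
have : 2 ^+ n <= 2 ^+ n * (B * (r0 + 1)).
  have B20 : 0 <= B - 2 by lra.
  have q := mulr_ge0 B20 r00.
  have g : 1 <= B * (r0 + 1) by move: q B2 r00; clear; lra.
  by rewrite ler_peMr // (ltW (two_gt0 n)).
by move: h; clear; lra.
Qed.

End ExponentialGrowth.

(** * The characteristic and the order *)

Section CharacteristicOfEntire.
Context {R : realType}.
Implicit Types (f g : R[i] -> R[i]) (a z w : R[i]) (r t x y B : R).

(** Continuity bounds [f] near [a], so the exponent 0 already qualifies. *)
Lemma pole_order_entire f a : entire f -> pole_order f a = 0%N.
Proof.
move=> ef; apply: leastP => //.
have [d d0 dP] := entire_ctsC a ef ltr01.
exists (cmod (f a) + 1); apply: nbhs_dnbhs.
rewrite -filter_from_norm_nbhs; exists d%:C; first by rewrite /= ltcR.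
move=> z /=; rewrite normC_cmod ltcR => zd; rewrite expr0 mul1r.
have := dP (z - a); rewrite cmodBC in zd; rewrite subrKC => /(_ zd) h.
by have := cmodD (f z - f a) (f a); rewrite subrK; move: h; clear; lra.
Qed.

Lemma N_poles_entire f r : entire f -> N_poles r f = 0.
Proof.
move=> ef; rewrite /N_poles /int_count.
have u0 t : unint_count (pole_order f) t = 0%N.
  by apply: fsbig1 => z _; apply: pole_order_entire.
rewrite u0 mul0r addr0.
rewrite (_ : (fun t : R => _) = (fun=> 0)); first by rewrite Rintegral_cst // mul0r.
by apply/funext => t; rewrite u0 subrr mul0r.
Qed.

Lemma characteristic_entire f r : entire f ->
  2 * pi * characteristic r f = cmean (fun z => lnp (cmod (f z))) r.
Proof.
move=> ef; rewrite /characteristic N_poles_entire // addr0 /proximity mulrA.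
by rewrite divff ?mul1r // lt0r_neq0 // twopi_gt0.
Qed.

Lemma characteristic_le f B r : entire f -> 0 <= B -> exp_bound f B -> 0 <= r ->
  characteristic r f <= B * (r + 1).
Proof.
move=> ef B0 fB r0; rewrite -(ler_pM2l (@twopi_gt0 R)) characteristic_entire //.
rewrite -(cmean_cst _ r); apply: le_cmean => //.
- by apply: circ_cts_lnp => // z _; apply: entire_ctsC.
- exact: circ_cts_cst.
move=> z zr; apply: (le_trans (le_lnp (fB z))).
by rewrite zr lnp_expR // mulr_ge0 // addr_ge0.
Qed.

(** Derivatives that vanish identically are exempted; the others have finitely many zeros in each
    disc, so only countably many radii fail the condition. *)
Definition generic_radius f n r := forall i, (i <= n)%N ->
  (exists z, f^`(i)%classic z != 0) -> forall z, cmod z = r -> f^`(i)%classic z != 0.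

Lemma circ_cts_quotient f g r : 0 <= r -> entire f -> entire g ->
  (forall z, cmod z = r -> g z != 0) ->
  circ_cts (fun z => lnp (cmod (f z / g z))) r.
Proof.
move=> r0 ef eg gr; apply: circ_cts_lnp => // z zr.
exact: is_derive_cts (cderM (entire_is_derive z ef) (cderV (gr z zr) (entire_is_derive z eg))).
Qed.

Lemma derive1n_zero f n : entire f -> (forall z, f^`(n)%classic z = 0) ->
  forall z, f^`(n.+1)%classic z = 0.
Proof.
move=> ef f0 z; rewrite derive1nS.
have -> : f^`(n)%classic = fun=> 0 by apply/funext.
exact: is_derive_derive1 (cder_cst 0 z).
Qed.

(** [f^(n+1) / f] is the product of [f^(n+1) / f^(n)] and [f^(n) / f]; the first factor is the
    logarithmic derivative of a function again of exponential type. If [f^(n)] vanishes identically,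
    so does the quotient. *)
Lemma logder_mean_derive1n f B z0 n : entire f -> f z0 != 0 -> 0 <= B -> exp_bound f B ->
  exists2 C : R, 0 <= C & forall r, 1 <= r -> generic_radius f n r ->
    cmean (fun z => lnp (cmod (f^`(n)%classic z / f z))) r <= C * (1 + ln r).
Proof.
move=> ef f0 B0 fB; elim: n => [|n [C C0 HC]].
  exists 0 => // r r1 gr; have r0 : 0 <= r by lra.
  have fr := gr 0%N (leqnn _) (ex_intro _ z0 f0).
  rewrite mul0r -(mulr0 (2 * pi)) -(cmean_cst _ r); apply: le_cmean => //.
  - exact: circ_cts_quotient.
  - exact: circ_cts_cst.
  by move=> z zr; rewrite derive1n0 divff ?fr // cmod1 lnp0.
have [[z1 fz1]|nz] := pselect (exists z, f^`(n)%classic z != 0); last first.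
  have fn0 z : f^`(n)%classic z = 0.
    by apply/eqP; apply: contrapT => h; apply: nz; exists z; apply/negP.
  exists 0 => // r r1 gr; rewrite mul0r -(mulr0 (2 * pi)) -(cmean_cst _ r).
  rewrite (_ : (fun z => _) = (fun=> 0)) //; apply/funext => z.
  by rewrite derive1n_zero // mul0r cmod0 lnp0.
have en := @entire_derive1n _ f n ef.
have Bn : 0 <= 2 ^+ n * B by rewrite mulr_ge0 // exprn_ge0.
have [D D0 HD] := logder_mean en fz1 Bn (exp_bound_derive1n n ef B0 fB).
exists (D + C); first exact: addr_ge0.
move=> r r1 gr; have r0 : 0 <= r by lra.
have fr := gr 0%N (leq0n _) (ex_intro _ z0 f0).
have fnr := gr n (leqnSn n) (ex_intro _ z1 fz1).
have grn : generic_radius f n r by move=> i ni; apply: gr; apply: leqW.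
have en1 := entire_derivative en.
apply: (@le_trans _ _ (cmean (fun z => lnp (cmod ((f^`(n)%classic)^`()%classic z / f^`(n)%classic z)) +
    lnp (cmod (f^`(n)%classic z / f z))) r)).
  apply: le_cmean => //.
  - apply: circ_cts_quotient => //; exact: (@entire_derive1n _ f n.+1).
  - by apply: circ_ctsD; apply: circ_cts_quotient.
  move=> z zr; rewrite derive1nS.
  have -> : (f^`(n)%classic)^`()%classic z / f z =
      ((f^`(n)%classic)^`()%classic z / f^`(n)%classic z) * (f^`(n)%classic z / f z).
    by rewrite mulrA divfK // fnr.
  by rewrite [X in lnp X <= _]cmodM; apply: lnpM; apply: cmod_ge0.
rewrite cmeanD; [|exact: circ_cts_quotient|exact: circ_cts_quotient].
by rewrite [leRHS]mulrDl; apply: lerD; [exact: HD|exact: HC].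
Qed.

Lemma nonzero_of_transcendental f : transcendental_entire f -> exists z, f z != 0.
Proof.
case=> _ tf; apply: contrapT => nz; apply: tf; exists 0 => z; rewrite horner0.
by apply/eqP; apply: contrapT => h; apply: nz; exists z; apply/negP.
Qed.

(** The plane is exhausted by discs of integer radius, each with finitely many zeros. *)
Lemma countable_zero_radii f z0 : entire f -> f z0 != 0 ->
  countable [set r | exists2 z, cmod z = r & f z = 0].
Proof.
move=> ef f0.
apply: (@sub_countable _ _ _ (\bigcup_(n in [set: nat]) [set r | exists2 z, cmod z = r /\ cmod z <= n%:R & f z = 0])).
  apply: subset_card_le => r [z zr fz].
  exists (Num.bound (cmod z)) => //; exists z => //; split=> //.
  by rewrite ltW // archi_boundP // cmod_ge0.
apply: bigcup_countable => // n _.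
have [//|s [g [eg fg sA gA]]] := @factor_zeros _ f (fun a => cmod a <= n%:R) n%:R z0 ef f0.
apply: finite_set_countable.
apply: (@sub_finite_set _ _ [set x | x \in map (@cmod R) s]); last exact: finite_seq.
move=> r [z [zr zn] fz] /=; rewrite -zr; apply: map_f.
apply: contraT => zs; move: fz; rewrite fg => /eqP.
by rewrite mulf_eq0 (negbTE (lin_prod_neq0 zs)) (negbTE (gA z zn)).
Qed.

Lemma countable_nongeneric f n : entire f -> countable [set r | ~ generic_radius f n r].
Proof.
move=> ef.
apply: (@sub_countable _ _ _ (\bigcup_(i in [set i : nat | exists z, f^`(i)%classic z != 0])
   [set r | exists2 z, cmod z = r & f^`(i)%classic z = 0])).
  apply: subset_card_le => r /= nr; apply: contrapT => h; apply: nr => i ni ex z zr.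
  by apply/eqP => fz; apply: h; exists i => //; exists z.
apply: bigcup_countable => // i [z fz].
by apply: (countable_zero_radii _ fz); apply: entire_derive1n.
Qed.

Lemma ln_le_linear (e : R) r : 0 < e -> 0 < r -> ln r <= e * r - ln e.
Proof.
move=> e0 r0; have := ln_le_id (mulr_gt0 e0 r0).
by rewrite lnM ?posrE //; lra.
Qed.

(** In the direction of the conjugate of [g1] the product [g1 * cis t0] is the positive real
    [cmod g1]. As [cmod g2 <= cmod g1], the real part of [g2 * cis t0] reaches it only if
    [g2 = g1]. *)
Lemma exp_sum_direction (g1 g2 : R[i]) : g1 != 0 -> g1 != g2 -> cmod g2 <= cmod g1 ->
  exists2 t0, 0 <= t0 < 2 * pi &
    0 < complex.Re (g1 * cis t0) /\ 0 < complex.Re ((g1 - g2) * cis t0).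
Proof.
move=> g10 g12 g21.
have [t0 t0r E] := polar g1^*.
exists t0 => //.
have c0 : 0 < cmod g1 by rewrite cmod_gt0.
have E1 : g1 * cis t0 = (cmod g1)%:C.
  have h : (cmod g1)%:C * (g1 * cis t0) = (cmod g1)%:C * (cmod g1)%:C.
    rewrite mulrCA; have -> : (cmod g1)%:C = (cmod g1^*)%:C by rewrite cmodJ.
    by rewrite -E mulCJ cmodJ expr2 -rmorphM.
  apply: (mulfI _ h); apply: contraTneq c0 => /(congr1 (@complex.Re R)) /= ->.
  by rewrite ltxx.
rewrite mulrBl E1; split=> //.
rewrite ReD ReN /= subr_gt0 lt_neqAle; apply/andP; split; last first.
  by apply: (le_trans (Re_le _)); rewrite cmodM cmod_cis mulr1.
apply: contra_neq g12 => h.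
have cc : cmod (g2 * cis t0) <= complex.Re (g2 * cis t0).
  by rewrite h cmodM cmod_cis mulr1.
have im0 : complex.Im (g2 * cis t0) = 0.
  have := sqr_cmod (g2 * cis t0); have := cmod_ge0 (g2 * cis t0) => q0 q1.
  apply/eqP; rewrite -sqrf_eq0 eq_le sqr_ge0 andbT.
  by move: c0 h cc q0 q1; clear; nra.
apply: (mulIf (cis_neq0 t0)); rewrite E1; exact: eqC.
Qed.

Lemma entire_exp_sum (p1 p2 g1 g2 : R[i]) :
  entire (fun z => p1 * cexp (g1 * z) + p2 * cexp (g2 * z)).
Proof.
have e1 := entireM (@entire_cst R p1) (@entire_cexp R g1).
have e2 := entireM (@entire_cst R p2) (@entire_cexp R g2).
exact: (entireD e1 e2).
Qed.

(** On a fixed arc starting at [t0] both real parts stay above [d], so the second exponential term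
    is at most half the first once [d * r] exceeds a constant; off the arc [lnp >= 0] suffices. *)
Lemma exp_sum_mean_ge (p1 p2 g1 g2 : R[i]) : p1 != 0 -> g1 != 0 -> g1 != g2 ->
  cmod g2 <= cmod g1 ->
  exists c C : R, 0 < c /\ forall r, 0 <= r ->
    c * r - C <= cmean (fun z => lnp (cmod (p1 * cexp (g1 * z) + p2 * cexp (g2 * z)))) r.
Proof.
move=> p10 g10 g12 g21.
have [t0 /andP[t00 t02] [d1 d2]] := exp_sum_direction g10 g12 g21.
pose d := Num.min (complex.Re (g1 * cis t0)) (complex.Re ((g1 - g2) * cis t0)) / 2.
have d0 : 0 < d by rewrite divr_gt0 // lt_min d1 d2.
pose e := d / (cmod g1 + cmod (g1 - g2) + 1).
have s0 : 0 < cmod g1 + cmod (g1 - g2) + 1.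
  by have := cmod_ge0 g1; have := cmod_ge0 (g1 - g2); lra.
have e0 : 0 < e by rewrite divr_gt0.
have [q q0 qP] := (cctsP (@cis R) t0).1 (ccts_cis t0) e e0.
(* The arc extends to the right of [t0] only and stays inside [[0, 2 * pi]]; it has positive length
   because [t0 < 2 * pi]. *)
pose eta := Num.min (q / 2) (2 * pi - t0).
have eta0 : 0 < eta by rewrite lt_min; apply/andP; split; lra.
have etaq : eta < q by rewrite gt_min; apply/orP; left; lra.
have eta2 : t0 + eta <= 2 * pi by rewrite -lerBrDl ge_min lexx orbT.
have near (g : R[i]) t : t0 <= t <= t0 + eta -> cmod g <= cmod g1 + cmod (g1 - g2) + 1 ->
    2 * d <= complex.Re (g * cis t0) -> d <= complex.Re (g * cis t).
  move=> /andP[ta tb] gs gd.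
  have -> : g * cis t = g * cis t0 + g * (cis t - cis t0) by ring.
  rewrite ReD.
  have h1 : `|complex.Re (g * (cis t - cis t0))| <= d.
    apply: (le_trans (Re_le_cmod _)); rewrite cmodM.
    have := qP (t - t0); rewrite subrKC ger0_norm ?subr_ge0 // => /(_ ltac:(lra)) ce.
    have -> : d = (cmod g1 + cmod (g1 - g2) + 1) * e by rewrite mulrCA divff ?mulr1 // lt0r_neq0.
    by apply: ler_pM; rewrite ?cmod_ge0 // ltW.
  by move: h1 gd; rewrite ler_norml => /andP[+ _]; clear; lra.
have P1 : 0 < cmod p1 by rewrite cmod_gt0.
have P2 : 0 <= cmod p2 := cmod_ge0 p2.
pose K := `|ln (cmod p1 / 2)| + lnp (2 * cmod p2 / cmod p1).
have K0 : 0 <= K by rewrite addr_ge0 // lnp_ge0.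
exists (eta * d), (eta * K); split; first exact: mulr_gt0.
move=> r r0.
have arc t : t0 <= t <= t0 + eta ->
   d * r - K <= lnp (cmod (p1 * cexp (g1 * (r%:C * cis t)) + p2 * cexp (g2 * (r%:C * cis t)))).
  move=> tt.
  have a1 : d <= complex.Re (g1 * cis t).
    apply: near tt _ _; first by have := cmod_ge0 (g1 - g2); lra.
    by rewrite /d mulrC divfK // ge_min lexx.
  have a2 : d <= complex.Re ((g1 - g2) * cis t).
    apply: near tt _ _; first by have := cmod_ge0 g1; lra.
    by rewrite /d mulrC divfK // ge_min lexx orbT.
  (* Below this threshold the claimed lower bound [d * r - K] is not positive. *)
  have [small|big] := lerP (d * r) (lnp (2 * cmod p2 / cmod p1)).
    apply: le_trans (lnp_ge0 _); rewrite /K; have := normr_ge0 (ln (cmod p1 / 2)).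
    by move: small; clear; lra.
  set z := r%:C * cis t.
  have z1 : d * r <= complex.Re (g1 * z).
    by rewrite /z mulrCA Re_realM mulrC; apply: ler_wpM2l.
  have z2 : d * r <= complex.Re ((g1 - g2) * z).
    by rewrite /z mulrCA Re_realM mulrC; apply: ler_wpM2l.
  set u := complex.Re (g1 * z) in z1.
  have h : cmod p1 / 2 * expR (d * r) <= cmod (p1 * cexp (g1 * z) + p2 * cexp (g2 * z)).
    have := cmod_subl (p1 * cexp (g1 * z)) (- (p2 * cexp (g2 * z))).
    rewrite opprK => h; apply: le_trans h; rewrite cmodN (cmodM p1) (cmodM p2).
    rewrite (cmod_cexp (g1 * z)) (cmod_cexp (g2 * z)) -/u.
    have E2 : complex.Re (g2 * z) = u - complex.Re ((g1 - g2) * z).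
      by rewrite mulrBl ReD ReN /u; lra.
    rewrite E2 expRD.
    have b1 : cmod p2 * expR (- complex.Re ((g1 - g2) * z)) <= cmod p1 / 2.
      have [->|p20] := eqVneq (cmod p2) 0; first by rewrite mul0r divr_ge0 // ltW.
      have p2p : 0 < cmod p2 by rewrite lt_neqAle eq_sym p20.
      rewrite expRN ler_pdivrMr ?expR_gt0 //.
      have h2 : ln (2 * cmod p2 / cmod p1) <= complex.Re ((g1 - g2) * z).
        by apply: (le_trans (ln_le_lnp _)); apply: (le_trans (ltW big)).
      have x0 : 0 < 2 * cmod p2 / cmod p1 by rewrite divr_gt0 // mulr_gt0.
      move: h2; rewrite -ler_expR lnK ?posrE // ler_pdivrMr //.
      by clear; lra.
    have b2 : expR (d * r) <= expR u by rewrite ler_expR.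
    have eu := expR_gt0 u.
    apply: (@le_trans _ _ (cmod p1 / 2 * expR u)).
      by apply: ler_wpM2l b2; rewrite divr_ge0 // ltW.
    by move: (ler_wpM2r (ltW eu) b1); clear; lra.
  apply: le_trans (le_lnp h); apply: le_trans (ln_le_lnp _).
  rewrite lnM ?posrE ?expR_gt0 ?divr_gt0 // expRK.
  have := lnp_ge0 (2 * cmod p2 / cmod p1); have := ler_norm (- ln (cmod p1 / 2)).
  by rewrite normrN /K; clear; lra.
set u := fun z => lnp _.
have uc : circ_cts u r.
  by apply: (circ_cts_lnp r0) => z _; exact: (derivable_ctsC (@entire_exp_sum p1 p2 g1 g2 z)).
have cc b c : rcts_on b c (fun t => u (r%:C * cis t)) by move=> t _; apply: uc.
have rge b c k : b <= c -> (forall t, b <= t <= c -> k <= u (r%:C * cis t)) ->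
    k * (c - b) <= rint b c (fun t => u (r%:C * cis t)).
  move=> bc ku; rewrite -rint_cst //; apply: le_rint => // t _; exact: cst_continuous.
have u0 z : 0 <= u z by apply: lnp_ge0.
have i1 := rge 0 t0 0 t00 (fun t _ => u0 _).
have i2 := rge t0 (t0 + eta) (d * r - K) ltac:(lra) (fun t ht => arc t ht).
have i3 := rge (t0 + eta) (2 * pi) 0 eta2 (fun t _ => u0 _).
rewrite /cmean (@rint_add _ 0 (2 * pi) t0) //; last by apply/andP; split; lra.
rewrite (@rint_add _ t0 (2 * pi) (t0 + eta)) //; last by apply/andP; split; lra.
move: i1 i2 i3; rewrite !mul0r; have -> : t0 + eta - t0 = eta by ring.
have -> : eta * d * r - eta * K = (d * r - K) * eta by ring.
clear; lra.
Qed.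

End CharacteristicOfEntire.

(** * Linear growth of the characteristic, the order, and small errors *)

Section OrderOne.
Context {R : realType}.
Implicit Types (f g : R[i] -> R[i]) (a z w : R[i]) (r t x y B : R).

Lemma generic_radius_le f m n r : (m <= n)%N -> generic_radius f n r -> generic_radius f m r.
Proof. by move=> mn gr i im; apply: gr; apply: leq_trans mn. Qed.

Lemma logder_mean_uniform f B z0 n : entire f -> f z0 != 0 -> 0 <= B -> exp_bound f B ->
  exists2 C : R, 0 <= C & forall i, (i <= n)%N ->
    forall r, 1 <= r -> generic_radius f n r ->
    cmean (fun z => lnp (cmod (f^`(i)%classic z / f z))) r <= C * (1 + ln r).
Proof.
move=> ef f0 B0 fB; elim: n => [|n [C C0 HC]].
  have [C C0 HC] := logder_mean_derive1n 0 ef f0 B0 fB.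
  by exists C => // i; rewrite leqn0 => /eqP ->.
have [D D0 HD] := logder_mean_derive1n n.+1 ef f0 B0 fB.
exists (C + D) => [|i]; first exact: addr_ge0.
rewrite leq_eqVlt => /orP[/eqP -> r r1 gr|ni r r1 gr].
  by apply: (le_trans (HD r r1 gr)); rewrite ler_wpM2r ?lerDr // addr_ge0 // ln_ge0.
apply: (le_trans (HC i ni r r1 (generic_radius_le (leqnSn n) gr))).
by rewrite ler_wpM2r ?lerDl // addr_ge0 // ln_ge0.
Qed.

Lemma lin_diff_mean f B z0 k (a : 'I_k.+1 -> R[i]) n : (k <= n)%N ->
  entire f -> f z0 != 0 -> 0 <= B -> exp_bound f B ->
  exists2 C : R, 0 <= C & forall r, 1 <= r -> generic_radius f n r ->
    circ_cts (fun z => lnp (cmod (lin_diff_poly a f z / f z))) r /\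
    cmean (fun z => lnp (cmod (lin_diff_poly a f z / f z))) r <= C * (1 + ln r).
Proof.
move=> kn ef f0 B0 fB.
have [C C0 HC] := logder_mean_uniform n ef f0 B0 fB.
pose D : R := lnp (size (index_enum 'I_k.+1))%:R + \sum_(j < k.+1) lnp (cmod (a j)).
have D0 : 0 <= D by rewrite addr_ge0 ?lnp_ge0 // sumr_ge0 // => j _; apply: lnp_ge0.
have p0 := @twopi_gt0 R.
exists (2 * pi * D + k.+1%:R * C).
  by rewrite addr_ge0 // mulr_ge0 // ltW.
move=> r r1 gr; have r0 : 0 <= r by lra.
have fr := gr 0%N (leq0n _) (ex_intro _ z0 f0).
have eL : entire (fun z => lin_diff_poly a f z).
  apply: entire_sum => j; apply: entireM; first exact: entire_cst.
  exact: entire_derive1n.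
have Lc : circ_cts (fun z => lnp (cmod (lin_diff_poly a f z / f z))) r.
  exact: circ_cts_quotient.
split=> //.
have jc (j : 'I_k.+1) : circ_cts (fun z => lnp (cmod (f^`(j)%classic z / f z))) r.
  by have ej := @entire_derive1n _ f j ef; exact: (circ_cts_quotient r0 ej ef fr).
have sc : circ_cts (fun z => \sum_(j < k.+1) lnp (cmod (f^`(j)%classic z / f z))) r.
  by apply: circ_cts_sum => j _.
apply: (@le_trans _ _ (cmean (fun z => D + \sum_(j < k.+1) lnp (cmod (f^`(j)%classic z / f z))) r)).
  apply: le_cmean => //; first by apply: circ_ctsD => //; exact: circ_cts_cst.
  move=> z zr; rewrite /lin_diff_poly mulr_suml.
  apply: (le_trans (le_lnp (cmod_sum _ _ _))).
  apply: (le_trans (lnp_sum _ _)) => [j|]; first exact: cmod_ge0.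
  rewrite /D -addrA lerD2l -big_split /=; apply: ler_sum => j _.
  rewrite -[X in cmod X]mulrA [X in lnp X <= _](cmodM (a j)).
  by apply: lnpM; apply: cmod_ge0.
rewrite cmeanD //; last exact: circ_cts_cst.
rewrite cmean_cst cmean_sum //.
have S : \sum_(j < k.+1) cmean (fun z => lnp (cmod (f^`(j)%classic z / f z))) r <=
    \sum_(j < k.+1) C * (1 + ln r).
  apply: ler_sum => j _; apply: HC => //; apply: leq_trans kn.
  by rewrite -ltnS.
apply: (le_trans (lerD (lexx _) S)).
have -> : \sum_(j < k.+1) C * (1 + ln r) = k.+1%:R * C * (1 + ln r).
  by rewrite sumr_const card_ord -[LHS]mulr_natl mulrA.
rewrite [leRHS]mulrDl lerD2r.
by apply: ler_peMr; [rewrite mulr_ge0 // ltW|rewrite lerDl ln_ge0].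
Qed.

Lemma cmean_ge0 (u : R[i] -> R) r : (forall z, 0 <= u z) -> 0 <= cmean u r.
Proof. by move=> u0; rewrite /cmean Rintegral_ge0 // => t _; apply: u0. Qed.

Lemma characteristic_ge0 f r : entire f -> 0 <= characteristic r f.
Proof.
move=> ef; rewrite -(pmulr_rge0 _ (@twopi_gt0 R)) characteristic_entire //.
by apply: cmean_ge0 => z; apply: lnp_ge0.
Qed.

(** Writing the left side of the equation as [f ^ 3 (f' / f) + f (Q / f)] gives [lnp |f|] the weight
    [3 + 1 = 4]; the remaining quotients have means O(log r). *)
Lemma characteristic_ge_le f B z0 k (a : 'I_k.+1 -> R[i]) n (p1 p2 g1 g2 : R[i]) :
  (k <= n)%N -> (0 < n)%N ->
  entire f -> f z0 != 0 -> 0 <= B -> exp_bound f B ->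
  p1 != 0 -> g1 != 0 -> g1 != g2 -> cmod g2 <= cmod g1 ->
  (forall z, f z ^+ 2 * f^`()%classic z + lin_diff_poly a f z
             = p1 * cexp (g1 * z) + p2 * cexp (g2 * z)) ->
  exists2 c : R, 0 < c & exists2 r1, 1 <= r1 & forall r, r1 <= r -> generic_radius f n r ->
    c * r <= characteristic r f.
Proof.
move=> kn n0 ef f0 B0 fB p10 g10 g12 g21 feq.
have [c [C [c0 cE]]] := exp_sum_mean_ge p2 p10 g10 g12 g21.
have [C1 C10 H1] := logder_mean_uniform n ef f0 B0 fB.
have [C2 C20 H2] := lin_diff_mean a kn ef f0 B0 fB.
have p0 := @twopi_gt0 R.
have l2 : 0 <= ln 2 :> R by apply: ln_ge0; rewrite ler1n.
have main r : 1 <= r -> generic_radius f n r ->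
    c * r - C <= 4 * (2 * pi * characteristic r f) + (C1 + C2) * (1 + ln r) + 2 * pi * ln 2.
  move=> r1 gr; have r0 : 0 <= r by lra.
  have fr := gr 0%N (leq0n _) (ex_intro _ z0 f0).
  have [Lc Lm] := H2 r r1 gr.
  have Dm := H1 1%N n0 r r1 gr.
  have ef' := entire_derivative ef.
  have Dc : circ_cts (fun z => lnp (cmod (f^`()%classic z / f z))) r.
    exact: circ_cts_quotient.
  have fc : circ_cts (fun z => lnp (cmod (f z))) r.
    by apply: circ_cts_lnp => // z _; apply: entire_ctsC.
  apply: (le_trans (cE r r0)).
  have f1E : f^`(1)%classic = f^`()%classic by rewrite derive1n1.
  rewrite f1E in Dm.
  apply: (@le_trans _ _ (cmean (fun z => (4 * lnp (cmod (f z)) +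
      (lnp (cmod (f^`()%classic z / f z)) + lnp (cmod (lin_diff_poly a f z / f z)))) + ln 2) r)).
    have c1 := circ_ctsD (circ_ctsD (circ_ctsZ (k:=4) fc) (circ_ctsD Dc Lc)) (@circ_cts_cst R (ln 2) r).
    apply: le_cmean => //.
      apply: circ_cts_lnp => // z _.
      exact: (derivable_ctsC (@entire_exp_sum _ p1 p2 g1 g2 z)).
    move=> z zr; rewrite -feq.
    have fz := fr z zr; rewrite derive1n0 in fz.
    have -> : f z ^+ 2 * f^`()%classic z + lin_diff_poly a f z =
       f z ^+ 3 * (f^`()%classic z / f z) + f z * (lin_diff_poly a f z / f z).
      by move: (lin_diff_poly a f z) (f^`()%classic z) (f z) fz => w v u u0; field.
    apply: (le_trans (le_lnp (cmodD _ _))).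
    apply: (le_trans (lnpD (cmod_ge0 _) (cmod_ge0 _))); rewrite lerD2r.
    have b1 := lnpM (cmod_ge0 (f z ^+ 3)) (cmod_ge0 (f^`()%classic z / f z)).
    have b2 := lnpM (cmod_ge0 (f z)) (cmod_ge0 (lin_diff_poly a f z / f z)).
    have b3 := lnpX 3 (cmod_ge0 (f z)).
    rewrite -cmodM in b1; rewrite -cmodM in b2; rewrite -cmodX in b3.
    by move: b1 b2 b3; clear; lra.
  have c2 := circ_ctsD Dc Lc.
  have c3 := circ_ctsZ (k:=4) fc.
  rewrite cmeanD; [|exact: circ_ctsD|exact: circ_cts_cst].
  rewrite cmeanD // cmeanD // cmeanZ // cmean_cst characteristic_entire //.
  by move: Lm Dm; clear; lra.
(* With this [e] the bound [ln r <= e * r - ln e] keeps the logarithmic error below half of [c * r]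
   up to a constant; the constants collected in [D] take another quarter for large [r], which leaves
   the quarter in [c']. *)
pose e := c / (2 * (C1 + C2 + 1)).
have s0 : 0 < 2 * (C1 + C2 + 1) by lra.
have e0 : 0 < e by rewrite divr_gt0.
pose D := C + (C1 + C2) + (C1 + C2 + 1) * `|ln e| + 2 * pi * ln 2.
pose c' := c / (4 * (4 * (2 * pi))).
have q0 : 0 < 4 * (4 * (2 * pi)) :> R by move: p0; clear; lra.
exists c'; first by rewrite divr_gt0.
exists (1 + 4 * `|D| / c).
  by rewrite lerDl; rewrite divr_ge0 ?(ltW c0) // mulr_ge0.
move=> r rr gr.
have r1 : 1 <= r.
  by apply: le_trans rr; rewrite lerDl; rewrite divr_ge0 ?(ltW c0) // mulr_ge0.
have m := main r r1 gr.
have lr := ln_le_linear e0 (lt_le_trans ltr01 r1).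
have lr0 : 0 <= ln r by exact: ln_ge0.
have Dr : 4 * D <= c * r.
  have : 4 * `|D| / c <= r by lra.
  rewrite ler_pdivrMr // => h; have := ler_norm D; lra.
have h1 : (C1 + C2) * ln r <= (C1 + C2 + 1) * (e * r + `|ln e|).
  apply: ler_pM => //; [by lra|by lra|].
  by have := ler_norm (- ln e); rewrite normrN; lra.
have h2 : (C1 + C2 + 1) * (e * r) = c / 2 * r.
  by rewrite /e; field; lra.
rewrite /c' mulrAC ler_pdivrMr //.
move: m h1 h2 Dr; rewrite /D; clear; lra.
Qed.

(** A countable set has measure zero, an interval of length 1 does not. *)
Lemma generic_radius_ex f n (M : R) : entire f -> exists2 r, M < r & generic_radius f n r.
Proof.
move=> ef; apply: contrapT => h.
have cM : countable `]M, M + 1[%classic.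
  apply: sub_countable (countable_nongeneric n ef); apply: subset_card_le => r /=.
  by rewrite in_itv /= => /andP[Mr _] gr; apply: h; exists r.
have := countable_lebesgue_measure0 cM.
rewrite lebesgue_measure_itv /= lte_fin ltrDl ltr01 -EFinB.
by case; rewrite addrAC subrr add0r => /eqP; rewrite oner_eq0.
Qed.

Lemma pinftyP (P : R -> Prop) : (\forall r \near +oo, P r) <->
  exists M : R, forall r, M < r -> P r.
Proof.
split=> [[M [_ H]]|[M H]]; first by exists M.
by exists M; split; [exact: num_real|].
Qed.

(** The upper bound holds at all large radii, the lower one at generic radii only. This is enough
    for an upper limit, since every neighbourhood of [+oo] contains generic radii. *)
Lemma growth_order_eq1 f B c r1 n : entire f -> 0 <= B -> exp_bound f B -> 0 < c ->
  (forall r, r1 <= r -> generic_radius f n r -> c * r <= characteristic r f) ->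
  growth_order f = 1%:E.
Proof.
move=> ef B0 fB c0 fc; apply/eqP; rewrite eq_le; apply/andP; split.
- apply/lee_addgt0Pr => e e0; rewrite -EFinD.
  pose b := 2 * (B + 1); have b0 : 0 < b by rewrite /b; lra.
  pose M := expR (lnp b / e + 1).
  have M1 : 1 < M by rewrite -expR0 ltr_expR ltr_wpDl // divr_ge0 ?lnp_ge0 ?ltW.
  apply: ge_ereal_inf.
  exists (ereal_sup ((fun r => (ln (characteristic r f) / ln r)%:E) @` [set r | M < r])).
    by exists [set r | M < r] => //; apply/pinftyP; exists M.
  apply: ge_ereal_sup => _ [r /= Mr <-]; rewrite lee_fin.
  have r1' : 1 < r by lra.
  have lr : 0 < ln r by rewrite ln_gt0.
  rewrite ler_pdivrMr //.
  have T0 := characteristic_ge0 r ef.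
  have Tb : characteristic r f <= b * r.
    have r0 : 0 <= r by lra.
    apply: (le_trans (characteristic_le ef B0 fB r0)).
    have := mulr_ge0 B0 (ltac:(lra) : 0 <= r - 1); rewrite /b; lra.
  (* Where the characteristic vanishes, the quotient is 0 by the convention [ln 0 = 0]. *)
  have [->|Tn0] := eqVneq (characteristic r f) 0.
    by rewrite ln0 // mulr_ge0 // ltW //; lra.
  have Tp : 0 < characteristic r f by rewrite lt_neqAle eq_sym Tn0.
  have : ln (characteristic r f) <= ln (b * r).
    by rewrite ler_ln ?posrE // mulr_gt0 //; lra.
  rewrite lnM ?posrE //; last by lra.
  have h1 : lnp b / e <= ln r.
    have : ln M <= ln r by rewrite ler_ln ?posrE; lra.
    by rewrite /M expRK; lra.
  rewrite ler_pdivrMr // in h1.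
  by have := ln_le_lnp b; move: h1; clear; lra.
apply: le_ereal_inf_tmp => _ [V /pinftyP [M VM] <-].
apply/lee_subgt0Pr => e e0; rewrite -EFinB.
pose N := Num.max (Num.max M r1) (expR (`|ln c| / e + 1)).
have [r Nr gr] := generic_radius_ex n N ef.
have [rM rr1 rE] : [/\ M < r, r1 < r & expR (`|ln c| / e + 1) < r].
  by move: Nr; rewrite /N !gt_max => /andP[/andP[-> ->] ->].
have r1' : 1 < r.
  apply: le_lt_trans rE; rewrite -expR0 ler_expR addr_ge0 // divr_ge0 //; exact: ltW.
apply: (@le_trans _ _ (ln (characteristic r f) / ln r)%:E); last first.
  by apply: ereal_sup_ubound; exists r => //; apply: VM.
have lr : 0 < ln r by rewrite ln_gt0.
rewrite lee_fin ler_pdivlMr //.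
have : ln (c * r) <= ln (characteristic r f).
  have cr : 0 < c * r by rewrite mulr_gt0 //; lra.
  have h := fc r (ltW rr1) gr.
  by rewrite ler_ln ?posrE //; apply: lt_le_trans h.
rewrite lnM ?posrE //; last by lra.
have h1 : `|ln c| / e <= ln r.
  have : ln (expR (`|ln c| / e + 1)) <= ln r by rewrite ler_ln ?posrE ?expR_gt0 ?ltW //; lra.
  by rewrite expRK; lra.
rewrite ler_pdivrMr // in h1.
by have := ler_norm (- ln c); rewrite normrN; move: h1; clear; lra.
Qed.

(** [ln r] is o(r), the characteristic is at least [c * r] off [A], and a countable [A] is a null
    set. *)
Lemma small_error_of_log f (S : R -> R) (A : set R) (C c r1 : R) :
  countable A -> 0 <= C -> 0 < c -> 1 <= r1 ->
  (forall r, r1 <= r -> ~ A r -> `|S r| <= C * (1 + ln r) /\ c * r <= characteristic r f) ->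
  small_error S f.
Proof.
move=> cA C0 c0 r11 H; exists A; split.
- by apply: countable_measurable => // t; exact: measurable_set1.
- by rewrite countable_lebesgue_measure0.
move=> e e0; apply/pinftyP.
pose q := e * c / (2 * (C + 1)).
have s0 : 0 < 2 * (C + 1) by lra.
have ec0 : 0 < e * c by rewrite mulr_gt0.
have q0 : 0 < q by rewrite divr_gt0.
pose D := (C + 1) * (1 + `|ln q|).
have D0 : 0 <= D by rewrite mulr_ge0 ?addr_ge0.
exists (r1 + 2 * D / (e * c)) => r rM nA.
have dd : 0 <= 2 * D / (e * c) by rewrite divr_ge0 ?(ltW ec0) // mulr_ge0.
have [Sr Tr] := H r ltac:(lra) nA.
apply: (le_trans Sr); apply: (@le_trans _ _ (e * (c * r))); last by apply: ler_wpM2l => //; exact: ltW.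
have r0 : 0 < r by lra.
have lr := ln_le_linear q0 r0.
have h0 : 2 * D / (e * c) <= r by lra.
rewrite ler_pdivrMr // in h0.
have h1 : C * (1 + ln r) <= (C + 1) * (1 + (q * r + `|ln q|)).
  apply: ler_pM => //; first by rewrite addr_ge0 // ln_ge0 //; lra.
    by lra.
  by have := ler_norm (- ln q); rewrite normrN; lra.
have h2 : (C + 1) * (q * r) = e * c / 2 * r by rewrite /q; field; lra.
by move: h0 h1 h2; rewrite /D; clear; lra.
Qed.

End OrderOne.

(** * The annihilated equation *)

Section AnnihilatedExponentials.
Context {R : realType}.
Implicit Types (f g : R[i] -> R[i]) (a z w p q s : R[i]) (r t x y B : R).

Lemma is_derive_derive1n f n z : entire f ->
  is_derive z (1 : R[i]) f^`(n)%classic (f^`(n.+1)%classic z).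
Proof.
by move=> ef; have en := @entire_derive1n _ f n ef; rewrite derive1nS; exact: entire_is_derive.
Qed.

Lemma is_derive_eqfun f g z (d e : R[i]) : f =1 g ->
  is_derive z (1 : R[i]) f d -> is_derive z (1 : R[i]) g e -> d = e.
Proof.
move=> fg df dg; have E : f = g by apply/funext.
by rewrite -(is_derive_derive1 df) -(is_derive_derive1 dg) E.
Qed.

(** Coefficients of the derivative of a linear differential polynomial: every index moves up by one,
    and order 0 receives the coefficient 0. *)
Definition shift_coef k (c : 'I_k.+1 -> R[i]) (j : 'I_k.+2) : R[i] :=
  if unlift ord0 j is Some i then c i else 0.

Lemma is_derive_sum (I : Type) (l : seq I) (F G : I -> R[i] -> R[i]) z :
  (forall i, is_derive z (1 : R[i]) (F i) (G i z)) ->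
  is_derive z (1 : R[i]) (fun w => \sum_(i <- l) F i w) (\sum_(i <- l) G i z).
Proof.
move=> FG; elim: l => [|i l IH].
  rewrite big_nil (_ : (fun w => _) = fun=> 0); first exact: cder_cst.
  by apply/funext => w; rewrite big_nil.
rewrite big_cons (_ : (fun w => _) = fun w => F i w + \sum_(j <- l) F j w).
  exact: cderD.
by apply/funext => w; rewrite big_cons.
Qed.

Lemma is_derive_lin_diff k (c : 'I_k.+1 -> R[i]) f z : entire f ->
  is_derive z (1 : R[i]) (lin_diff_poly c f) (lin_diff_poly (shift_coef c) f z).
Proof.
move=> ef; rewrite [X in is_derive _ _ _ X]/lin_diff_poly big_ord_recl.
rewrite /shift_coef unlift_none mul0r add0r.
apply: (cder_eq (d := \sum_(j < k.+1) c j * f^`(j.+1)%classic z)).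
  apply: (@is_derive_sum _ _ (fun (j : 'I_k.+1) w => c j * f^`(j)%classic w)
    (fun (j : 'I_k.+1) w => c j * f^`(j.+1)%classic w)) => j.
  exact: cderZ (is_derive_derive1n j z ef).
by apply: eq_bigr => j _; rewrite liftK.
Qed.

(** [f ^ 2 f'], followed by its first and second derivatives in expanded form. *)
Definition cubic0 f z := f z ^+ 2 * f^`()%classic z.
Definition cubic1 f z := 2 * f z * f^`()%classic z ^+ 2 + f z ^+ 2 * f^`(2)%classic z.
Definition cubic2 f z := 2 * f^`()%classic z ^+ 3
  + 6 * f z * f^`()%classic z * f^`(2)%classic z + f z ^+ 2 * f^`(3)%classic z.

Lemma is_derive_cubic0 f z : entire f -> is_derive z (1 : R[i]) (cubic0 f) (cubic1 f z).
Proof.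
move=> ef.
have -> : cubic0 f = fun w => f w * (f w * f^`(1)%classic w).
  by apply/funext => w; rewrite /cubic0 expr2 -mulrA.
have d0 : is_derive z (1 : R[i]) f (f^`(1)%classic z) := is_derive_derive1n 0 z ef.
have d1 := is_derive_derive1n 1 z ef.
apply: (cder_eq (cderM d0 (cderM d0 d1))); rewrite /cubic1 -[f^`()%classic]/(f^`(1)%classic).
by move: (f z) (f^`(1)%classic z) (f^`(2)%classic z) => u v w; ring.
Qed.

Lemma is_derive_cubic1 f z : entire f -> is_derive z (1 : R[i]) (cubic1 f) (cubic2 f z).
Proof.
move=> ef.
have -> : cubic1 f = fun w => 2 * (f w * (f^`(1)%classic w * f^`(1)%classic w)) +
    f w * (f w * f^`(2)%classic w).
  by apply/funext => w; rewrite /cubic1 !expr2 -!mulrA.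
have d0 : is_derive z (1 : R[i]) f (f^`(1)%classic z) := is_derive_derive1n 0 z ef.
have d1 := is_derive_derive1n 1 z ef.
have d2 := is_derive_derive1n 2 z ef.
apply: (cder_eq (cderD (cderZ 2 (cderM d0 (cderM d1 d1))) (cderM d0 (cderM d0 d2)))).
rewrite /cubic2 -[f^`()%classic]/(f^`(1)%classic).
by move: (f z) (f^`(1)%classic z) (f^`(2)%classic z) (f^`(3)%classic z) => u v w x; ring.
Qed.

Lemma is_derive_exp_sum (p1 p2 g1 g2 : R[i]) z :
  is_derive z (1 : R[i]) (fun w => p1 * cexp (g1 * w) + p2 * cexp (g2 * w))
    (p1 * g1 * cexp (g1 * z) + p2 * g2 * cexp (g2 * z)).
Proof.
apply: (cder_eq (cderD (cderZ p1 (is_derive_cexpZ g1 z)) (cderZ p2 (is_derive_cexpZ g2 z)))).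
by rewrite !mulrA.
Qed.

(* (D - g1)(D - g2) applied to f^2 f'; it kills exp(g1 z) and exp(g2 z). *)
Definition annihilated f (g1 g2 : R[i]) z :=
  cubic2 f z - (g1 + g2) * cubic1 f z + g1 * g2 * cubic0 f z.

Lemma annihilatedE f k (c : 'I_k.+1 -> R[i]) (p1 p2 g1 g2 : R[i]) : entire f ->
  (forall z, cubic0 f z + lin_diff_poly c f z
             = p1 * cexp (g1 * z) + p2 * cexp (g2 * z)) ->
  forall z, annihilated f g1 g2 z =
    - (lin_diff_poly (shift_coef (shift_coef c)) f z
       - (g1 + g2) * lin_diff_poly (shift_coef c) f z + g1 * g2 * lin_diff_poly c f z).
Proof.
move=> ef E0.
have E1 z : cubic1 f z + lin_diff_poly (shift_coef c) f z =
    p1 * g1 * cexp (g1 * z) + p2 * g2 * cexp (g2 * z).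
  apply: (is_derive_eqfun (z := z) E0 _ (is_derive_exp_sum p1 p2 g1 g2 z)).
  exact: cderD (is_derive_cubic0 z ef) (is_derive_lin_diff c z ef).
have E2 z : cubic2 f z + lin_diff_poly (shift_coef (shift_coef c)) f z =
    p1 * g1 * g1 * cexp (g1 * z) + p2 * g2 * g2 * cexp (g2 * z).
  apply: (is_derive_eqfun (z := z) E1 _ (is_derive_exp_sum (p1 * g1) (p2 * g2) g1 g2 z)).
  exact: cderD (is_derive_cubic1 z ef) (is_derive_lin_diff (shift_coef c) z ef).
move=> z; rewrite /annihilated.
have -> : cubic2 f z = p1 * g1 * g1 * cexp (g1 * z) + p2 * g2 * g2 * cexp (g2 * z) -
   lin_diff_poly (shift_coef (shift_coef c)) f z by rewrite -E2 addrK.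
have -> : cubic1 f z = p1 * g1 * cexp (g1 * z) + p2 * g2 * cexp (g2 * z) -
   lin_diff_poly (shift_coef c) f z by rewrite -E1 addrK.
have -> : cubic0 f z = p1 * cexp (g1 * z) + p2 * cexp (g2 * z) -
   lin_diff_poly c f z by rewrite -E0 addrK.
move: (cexp (g1 * z)) (cexp (g2 * z)) (lin_diff_poly c f z) (lin_diff_poly (shift_coef c) f z)
  (lin_diff_poly _ f z) => e1 e2 L0 L1 L2; ring.
Qed.

Lemma entire_annihilated f k (c : 'I_k.+1 -> R[i]) (p1 p2 g1 g2 : R[i]) : entire f ->
  (forall z, cubic0 f z + lin_diff_poly c f z
             = p1 * cexp (g1 * z) + p2 * cexp (g2 * z)) ->
  entire (annihilated f g1 g2).
Proof.
move=> ef E0 z.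
have -> : annihilated f g1 g2 = fun z => - 1 *
    (lin_diff_poly (shift_coef (shift_coef c)) f z
       - (g1 + g2) * lin_diff_poly (shift_coef c) f z + g1 * g2 * lin_diff_poly c f z).
  by apply/funext => w; rewrite (annihilatedE ef E0) mulN1r.
have d0 := is_derive_lin_diff c z ef.
have d1 := is_derive_lin_diff (shift_coef c) z ef.
have d2 := is_derive_lin_diff (shift_coef (shift_coef c)) z ef.
exact: cder_derivable
  (cderZ (-1) (cderD (cderB d2 (cderZ (g1 + g2) d1)) (cderZ (g1 * g2) d0))).
Qed.

Lemma lnp_cmod3 z w q : lnp (cmod (z + w + q)) <= lnp (cmod z) + lnp (cmod w) + lnp (cmod q) + 2 * ln 2.
Proof.
apply: (le_trans (le_lnp (cmodD _ _))); apply: (le_trans (lnpD (cmod_ge0 _) (cmod_ge0 _))).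
have h : lnp (cmod (z + w)) <= lnp (cmod z) + lnp (cmod w) + ln 2.
  by apply: (le_trans (le_lnp (cmodD _ _))); apply: (lnpD (cmod_ge0 _) (cmod_ge0 _)).
by move: h; clear; lra.
Qed.

Lemma lnp_cmodM z w : lnp (cmod (z * w)) <= lnp (cmod z) + lnp (cmod w).
Proof. by rewrite cmodM; apply: lnpM; apply: cmod_ge0. Qed.

(** For [z = f' / f], [w = f'' / f], [u = f''' / f], [s = g1 + g2] and [q = g1 * g2] the argument is
    [annihilated f g1 g2] divided by [f ^ 3], as [annihilated_ratio] shows. *)
Lemma lnp_cubic_poly q s : exists2 C : R, 0 <= C & forall z w u : R[i],
  lnp (cmod ((2 * z ^+ 3 + 6 * (z * w) + u) + (- (s * 2 * z ^+ 2) + - (s * w) + q * z))) <=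
   C + 8 * lnp (cmod z) + 2 * lnp (cmod w) + lnp (cmod u).
Proof.
have l2 : 0 <= ln 2 :> R by apply: ln_ge0; rewrite ler1n.
pose C := lnp (cmod (2 : R[i])) + lnp (cmod (6 : R[i])) + lnp (cmod (s * 2)) + lnp (cmod s)
   + lnp (cmod q) + 10 * ln 2.
exists C.
  have p0 (u : R[i]) : 0 <= lnp (cmod u) by exact: lnp_ge0.
  have := p0 2; have := p0 6; have := p0 (s * 2); have := p0 s; have := p0 q.
  by move: l2; rewrite /C; clear; lra.
move=> x1 x2 x3.
apply: (le_trans (le_lnp (cmodD _ _))); apply: (le_trans (lnpD (cmod_ge0 _) (cmod_ge0 _))).
have h1 := lnp_cmod3 (2 * x1 ^+ 3) (6 * (x1 * x2)) x3.
have h2 := lnp_cmod3 (- (s * 2 * x1 ^+ 2)) (- (s * x2)) (q * x1).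
rewrite !cmodN in h2.
have a1 := lnp_cmodM 2 (x1 ^+ 3).
have a2 := lnp_cmodM 6 (x1 * x2).
have a3 := lnp_cmodM x1 x2.
have a4 := lnp_cmodM (s * 2) (x1 ^+ 2).
have a5 := lnp_cmodM s x2.
have a6 := lnp_cmodM q x1.
have a7 := lnpX 3 (cmod_ge0 x1).
have a8 := lnpX 2 (cmod_ge0 x1).
rewrite -cmodX in a7; rewrite -cmodX in a8.
have b1 := lnp_ge0 (cmod x1).
have b2 := lnp_ge0 (cmod x2).
have b3 := lnp_ge0 (cmod x3).
rewrite /C.
move: a1 a2 a3 a4 a5 a6 a7 a8 h1 h2 b1 b2 b3 l2.
move: (lnp (cmod (2 * x1 ^+ 3))) (lnp (cmod (6 * (x1 * x2)))) (lnp (cmod (x1 * x2)))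
  (lnp (cmod (s * 2 * x1 ^+ 2))) (lnp (cmod (s * x2))) (lnp (cmod (q * x1)))
  (lnp (cmod (x1 ^+ 3))) (lnp (cmod (x1 ^+ 2))).
move: (lnp (cmod (s * 2))) (lnp (cmod 2)) (lnp (cmod 6)) (lnp (cmod s)) (lnp (cmod q)).
move: (lnp (cmod (2 * x1 ^+ 3 + 6 * (x1 * x2) + x3))).
move: (lnp (cmod (- (s * 2 * x1 ^+ 2) + - (s * x2) + q * x1))).
move: (lnp (cmod x1)) (lnp (cmod x2)) (lnp (cmod x3)).
by clear; move=> *; lra.
Qed.

Lemma annihilated_ratio f (g1 g2 : R[i]) z : f z != 0 ->
  annihilated f g1 g2 z / f z ^+ 3 =
    (2 * (f^`(1)%classic z / f z) ^+ 3
     + 6 * (f^`(1)%classic z / f z * (f^`(2)%classic z / f z)) + f^`(3)%classic z / f z)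
    + (- ((g1 + g2) * 2 * (f^`(1)%classic z / f z) ^+ 2)
       + - ((g1 + g2) * (f^`(2)%classic z / f z)) + g1 * g2 * (f^`(1)%classic z / f z)).
Proof.
move=> fz; rewrite /annihilated /cubic2 /cubic1 /cubic0 -[f^`()%classic]/(f^`(1)%classic).
by move: (f z) (f^`(1)%classic z) (f^`(2)%classic z) (f^`(3)%classic z) fz => u v w x u0; field.
Qed.

(** For [x > 1] the bound [lnp (y / x) >= ln y - ln x] suffices and [lnp h] is dropped; for [x <= 1]
    the left side is 0 and [lnp h >= ln y - 3 * ln x] suffices. *)
Lemma two_lnp_le (x y h : R) : 0 < x -> 0 < y -> h = y / x ^+ 3 ->
  2 * lnp x <= lnp (y / x) + lnp h - ln y + 3 * ln x.
Proof.
move=> x0 y0 hE.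
have h1 : ln (y / x) = ln y - ln x by rewrite ln_div ?posrE.
have h2 : ln h = ln y - 3 * ln x.
  by rewrite hE ln_div ?posrE ?exprn_gt0 // lnXn // -[_ *+ 3]mulr_natl.
have a1 := ln_le_lnp (y / x); have a2 := lnp_ge0 (y / x).
have b1 := ln_le_lnp h; have b2 := lnp_ge0 h.
have [->|->] : lnp x = 0 \/ lnp x = ln x by rewrite /lnp; case: (leP 0 (ln x)); auto.
  by move: h1 h2 a1 a2 b1 b2; clear; lra.
by move: h1 h2 a1 a2 b1 b2; clear; lra.
Qed.

Lemma char_le_zeros f B z0 k (c : 'I_k.+1 -> R[i]) (p1 p2 g1 g2 : R[i]) z1 n :
  (k.+2 <= n)%N -> (3 <= n)%N ->
  entire f -> f z0 != 0 -> 0 <= B -> exp_bound f B ->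
  (forall z, cubic0 f z + lin_diff_poly c f z
             = p1 * cexp (g1 * z) + p2 * cexp (g2 * z)) ->
  annihilated f g1 g2 z1 != 0 ->
  exists2 C : R, 0 <= C & forall r, 1 <= r -> generic_radius f n r ->
    (forall z, cmod z = r -> annihilated f g1 g2 z != 0) ->
    2 * characteristic r f <= 3 * N_zeros r f + C * (1 + ln r).
Proof.
move=> kn n3 ef f0 B0 fB E0 H0.
have eH := entire_annihilated ef E0.
have HE := annihilatedE ef E0.
have [Ch Ch0 hb0] := lnp_cubic_poly (g1 * g2) (g1 + g2).
have hrat := annihilated_ratio (f := f) g1 g2.
set H := annihilated f g1 g2 in eH HE hrat H0 *.
have [C1 C10 m1] := logder_mean_uniform n ef f0 B0 fB.
have [D0 D00 M0] := lin_diff_mean c (leq_trans (leqW (leqnSn k)) kn) ef f0 B0 fB.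
have [D1 D10 M1] := lin_diff_mean (shift_coef c) (ltnW kn) ef f0 B0 fB.
have [D2 D20 M2] := lin_diff_mean (shift_coef (shift_coef c)) kn ef f0 B0 fB.
have [m [h1 [eh1 h10 HhE]]] := zero_split eH H0.
have [l [f1 [ef1 f10 ffE]]] := zero_split ef f0.
have l2 : 0 <= ln 2 :> R by apply: ln_ge0; rewrite ler1n.
have p0 := @twopi_gt0 R.
pose K := lnp (cmod (g1 + g2)) + lnp (cmod (g1 * g2)) + 2 * ln 2.
have K0 : 0 <= K.
  by have := lnp_ge0 (cmod (g1 + g2)); have := lnp_ge0 (cmod (g1 * g2)); rewrite /K; move: l2; lra.
(* The 11 is the total weight [8 + 2 + 1] of the three quotients in [lnp_cubic_poly]. *)
pose T := D0 + D1 + D2 + 11 * C1.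
have T0 : 0 <= T by rewrite /T; lra.
pose A := K + Ch + `|ln (cmod (h1 0))| + 3 * `|ln (cmod (f1 0))|.
have A0 : 0 <= A.
  by have := normr_ge0 (ln (cmod (h1 0))); have := normr_ge0 (ln (cmod (f1 0))); rewrite /A; lra.
exists (A + T / (2 * pi)); first by rewrite addr_ge0 // divr_ge0 // ltW.
move=> r r1 gr Hr; have r0 : 0 <= r by lra.
have rp : 0 < r by lra.
have fr := gr 0%N (leq0n _) (ex_intro _ z0 f0); rewrite derive1n0 in fr.
have [c0 M0r] := M0 r r1 gr.
have [c1 M1r] := M1 r r1 gr.
have [c2 M2r] := M2 r r1 gr.
have n2 : (2 <= n)%N := ltnW n3.
have n1 : (1 <= n)%N := ltnW n2.
(* X and Y are kept abstract: their instances for distinct orders are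
   otherwise compared by unfolding the derivatives. *)
have [X XE] : exists X : nat -> R[i] -> R,
    X = fun i z => lnp (cmod (f^`(i)%classic z / f z)) by eexists.
have xm i : (i <= n)%N -> cmean (X i) r <= C1 * (1 + ln r).
  by move=> ni; rewrite XE; exact: m1.
have xc i : circ_cts (X i) r.
  by rewrite XE; have ei := @entire_derive1n _ f i ef; exact: circ_cts_quotient.
have hb z : f z != 0 -> lnp (cmod (H z / f z ^+ 3)) <= Ch + 8 * X 1%N z + 2 * X 2%N z + X 3%N z.
  by move=> fz; rewrite hrat // XE; exact: hb0.
have x1m := xm 1%N n1; have x2m := xm 2%N n2; have x3m := xm 3%N n3.
have [Y0 Y0E] : exists Y, Y = fun z => lnp (cmod (lin_diff_poly c f z / f z)) by eexists.
have [Y1 Y1E] : exists Y, Y = fun z => lnp (cmod (lin_diff_poly (shift_coef c) f z / f z)).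
  by eexists.
have [Y2 Y2E] : exists Y,
  Y = fun z => lnp (cmod (lin_diff_poly (shift_coef (shift_coef c)) f z / f z)) by eexists.
rewrite -Y0E in c0 M0r; rewrite -Y1E in c1 M1r; rewrite -Y2E in c2 M2r.
have lnfc : circ_cts (fun z => ln (cmod (f z))) r.
  by apply: circ_cts_ln => // z _; exact: entire_ctsC.
have lnHc : circ_cts (fun z => ln (cmod (H z))) r.
  by apply: circ_cts_ln => // z _; exact: entire_ctsC.
have fc : circ_cts (fun z => lnp (cmod (f z))) r.
  by apply: circ_cts_lnp => // z _; exact: entire_ctsC.
pose V z := (Y2 z + Y1 z + Y0 z) + (8 * X 1%N z + 2 * X 2%N z + X 3%N z) + (K + Ch)
   - ln (cmod (H z)) + 3 * ln (cmod (f z)).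
have v1 := circ_ctsD (circ_ctsD c2 c1) c0.
have v2 := circ_ctsD (circ_ctsD (circ_ctsZ (k:=8) (xc 1%N)) (circ_ctsZ (k:=2) (xc 2%N))) (xc 3%N).
have v3 := circ_ctsD v1 v2.
have v4 := circ_ctsD v3 (@circ_cts_cst R (K + Ch) r).
have v5 := circ_ctsB v4 lnHc.
have v6 := circ_ctsD v5 (circ_ctsZ (k:=3) lnfc).
have main : cmean (fun z => 2 * lnp (cmod (f z))) r <= cmean V r.
  apply: le_cmean => //; first exact: circ_ctsZ.
  move=> z zr; have fz := fr z zr.
  have fz0 : 0 < cmod (f z) by rewrite cmod_gt0.
  have Hz0 : 0 < cmod (H z) by rewrite cmod_gt0 Hr.
  have hE : cmod (H z / f z ^+ 3) = cmod (H z) / cmod (f z) ^+ 3.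
    by rewrite cmodM cmodV cmodX.
  have t := two_lnp_le fz0 Hz0 hE.
  have Hf : lnp (cmod (H z) / cmod (f z)) <= Y2 z + Y1 z + Y0 z + K.
    have -> : cmod (H z) / cmod (f z) =
      cmod (lin_diff_poly (shift_coef (shift_coef c)) f z / f z
        + - ((g1 + g2) * (lin_diff_poly (shift_coef c) f z / f z))
        + g1 * g2 * (lin_diff_poly c f z / f z)).
      rewrite -cmodV -cmodM HE mulNr cmodN; congr cmod.
      rewrite mulrDl mulrBl; congr (_ - _ + _); by rewrite mulrA.
    apply: (le_trans (lnp_cmod3 _ _ _)); rewrite cmodN.
    have b1 := lnp_cmodM (g1 + g2) (lin_diff_poly (shift_coef c) f z / f z).
    have b0 := lnp_cmodM (g1 * g2) (lin_diff_poly c f z / f z).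
    by move: b0 b1; rewrite /K Y0E Y1E Y2E; clear; lra.
  by move: (hb z fz) t Hf; rewrite /V; clear; lra.
move: main; rewrite cmeanZ // -characteristic_entire //.
rewrite /V (cmeanD v5 (circ_ctsZ (k:=3) lnfc)) (cmeanB v4 lnHc).
rewrite (cmeanD v3 (@circ_cts_cst R (K + Ch) r)) (cmeanD v1 v2).
rewrite (cmeanD (circ_ctsD c2 c1) c0) (cmeanD c2 c1).
rewrite (cmeanD (circ_ctsD (circ_ctsZ (k:=8) (xc 1%N)) (circ_ctsZ (k:=2) (xc 2%N))) (xc 3%N)).
rewrite (cmeanD (circ_ctsZ (k:=8) (xc 1%N)) (circ_ctsZ (k:=2) (xc 2%N))).
rewrite !cmeanZ // cmean_cst.
rewrite (jensen ef1 f10 ffE rp fr) (jensen eh1 h10 HhE rp Hr).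
(* Jensen's formula for [H] enters with a negative sign, so the counting function of its zeros is
   nonnegative and may be discarded. *)
have NH := N_zeros_ge0 eH H0 r1.
have lr : 0 <= ln r by exact: ln_ge0.
move=> main.
have q1 : 2 * pi * (2 * characteristic r f) <=
   2 * pi * (K + Ch - ln (cmod (h1 0)) + 3 * ln (cmod (f1 0)) + 3 * N_zeros r f)
   + T * (1 + ln r).
  have h : 0 <= 2 * pi * N_zeros r H by rewrite mulr_ge0 // ltW.
  move: main h M0r M1r M2r x1m x2m x3m; rewrite /T; clear; lra.
have q2 : T * (1 + ln r) = 2 * pi * (T / (2 * pi) * (1 + ln r)).
  by rewrite mulrA mulrCA divff ?mulr1 // lt0r_neq0.
rewrite q2 -[X in _ <= X]mulrDr ler_pM2l // in q1.
apply: (le_trans q1); rewrite [X in _ <= _ + X]mulrDl.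
have h : A <= A * (1 + ln r) by rewrite ler_peMr // lerDl.
have a1 := ler_norm (- ln (cmod (h1 0))); have a2 := ler_norm (ln (cmod (f1 0))).
rewrite normrN in a1.
by move: h a1 a2; rewrite {1}/A; clear; lra.
Qed.

End AnnihilatedExponentials.

(** * The exceptional solutions *)

Section ExponentialSolutions.
Context {R : realType}.
Implicit Types (f g W : R[i] -> R[i]) (a b c z w p q s C : R[i]) (r t B : R).

Lemma linear_ode W b : (forall z, is_derive z (1 : R[i]) W (b * W z)) ->
  forall z, W z = W 0 * cexp (b * z).
Proof.
move=> dW z.
have d w : is_derive w (1 : R[i]) (fun w => W w * cexp (- b * w)) 0.
  apply: (cder_eq (cderM (dW w) (is_derive_cexpZ (- b) w))).
  by move: (W w) (cexp _) => x y; ring.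
have := is_derive_const_eq d z 0; rewrite mulr0 cexp0 mulr1 => <-.
by rewrite -mulrA -cexpD -mulrDl addNr mul0r cexp0 mulr1.
Qed.

(** Induction on the number of terms: dividing by one exponential makes its term constant, and
    differentiating removes it, while the coefficient of the new frequency is multiplied by [g - b],
    which is not 0. Frequencies inside [l] may coincide. *)
Lemma exp_indep (l : seq (R[i] * R[i])) (al g : R[i]) :
  g \notin map snd l ->
  (forall z, \sum_(x <- l) x.1 * cexp (x.2 * z) = al * cexp (g * z)) -> al = 0.
Proof.
move: {2}(size l) (erefl (size l)) => n; elim: n l al g => [|n IH] l al g.
  move=> /eqP; rewrite size_eq0 => /eqP -> _ /(_ 0).
  by rewrite big_nil mulr0 cexp0 mulr1.
case: l => [//|[c b] l] [sl]; rewrite /= inE negb_or => /andP[gb gl] E.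
have E1 z : c + \sum_(x <- l) x.1 * cexp ((x.2 - b) * z) = al * cexp ((g - b) * z).
  have := E z; rewrite big_cons /= => /(congr1 (fun u => u * cexp (- (b * z)))).
  rewrite mulrDl mulr_suml -mulrA -cexpD subrr cexp0 mulr1 -[RHS]mulrA -cexpD -mulrBl => <-.
  by congr (_ + _); apply: eq_bigr => x _; rewrite -mulrA -cexpD mulrBl.
pose l' := [seq (x.1 * (x.2 - b), x.2 - b) | x <- l].
have gb0 : g - b != 0 by rewrite subr_eq0.
apply: (mulIf gb0); rewrite mul0r; apply: (IH l' _ (g - b)); first by rewrite size_map.
  rewrite -map_comp; apply: contra gl => /mapP [x xl /=] /(congr1 (fun u => u + b)).
  by rewrite !subrK => ->; apply: map_f.
move=> z; rewrite big_map /=.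
apply: (is_derive_eqfun (z := z) E1).
  apply: (cder_eq (cderD (cder_cst c z) (@is_derive_sum _ _ l
     (fun x w => x.1 * cexp ((x.2 - b) * w))
     (fun x w => x.1 * (x.2 - b) * cexp ((x.2 - b) * w)) z _))); last by rewrite add0r.
  move=> x; apply: (cder_eq (cderZ x.1 (is_derive_cexpZ (x.2 - b) z))).
  by rewrite mulrA.
apply: (cder_eq (cderZ al (is_derive_cexpZ (g - b) z))).
by rewrite mulrA.
Qed.

Lemma derive1n_exp f c b : (forall z, f z = c * cexp (b * z)) ->
  forall n z, f^`(n)%classic z = c * b ^+ n * cexp (b * z).
Proof.
move=> fE; elim=> [|n IH] z; first by rewrite derive1n0 expr0 mulr1.
rewrite derive1nS; have -> : f^`(n)%classic = fun z => c * b ^+ n * cexp (b * z) by apply/funext.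
apply: is_derive_derive1; apply: (cder_eq (cderZ _ (is_derive_cexpZ b z))).
by rewrite exprSr !mulrA.
Qed.

Lemma derive_cube f z : entire f ->
  is_derive z (1 : R[i]) (fun w => f w ^+ 3) (3 * cubic0 f z).
Proof.
move=> ef.
have -> : (fun w => f w ^+ 3) = fun w => f w * (f w * f w).
  by apply/funext => w; rewrite !exprS expr0 mulr1.
have d0 := entire_is_derive z ef.
apply: (cder_eq (cderM d0 (cderM d0 d0))); rewrite /cubic0.
by move: (f z) (f^`()%classic z) => u v; ring.
Qed.

(** The vanishing of [annihilated] is a first-order equation for [cubic1 - g2 * cubic0] and another
    for [cubic1 - g1 * cubic0]; the difference of their solutions isolates [cubic0], and one
    integration gives [f ^ 3]. *)
Lemma cube_exp_sum f (g1 g2 : R[i]) : entire f -> g1 != 0 -> g2 != 0 -> g1 != g2 ->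
  (forall z, annihilated f g1 g2 z = 0) ->
  exists al be C, forall z,
    f z ^+ 3 = al * cexp (g1 * z) + be * cexp (g2 * z) + C.
Proof.
move=> ef g10 g20 g12 H0.
have g120 : g1 - g2 != 0 by rewrite subr_eq0.
have dW (b : R[i]) z : is_derive z (1 : R[i]) (fun w => cubic1 f w - b * cubic0 f w)
    (cubic2 f z - b * cubic1 f z).
  exact: cderB (is_derive_cubic1 z ef) (cderZ b (is_derive_cubic0 z ef)).
have c2E z : cubic2 f z = (g1 + g2) * cubic1 f z - g1 * g2 * cubic0 f z.
  have := H0 z; rewrite /annihilated => h; apply/eqP; rewrite -subr_eq0 -[X in _ == X]h.
  by apply/eqP; ring.
have [a1 e1] : exists a1, forall z, cubic1 f z - g2 * cubic0 f z = a1 * cexp (g1 * z).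
  exists (cubic1 f 0 - g2 * cubic0 f 0).
  apply: (linear_ode (W := fun w => cubic1 f w - g2 * cubic0 f w)) => w.
  apply: (cder_eq (dW g2 w)); rewrite c2E; move: (cubic1 f w) (cubic0 f w) => u v; ring.
have [a2 e2] : exists a2, forall z, cubic1 f z - g1 * cubic0 f z = a2 * cexp (g2 * z).
  exists (cubic1 f 0 - g1 * cubic0 f 0).
  apply: (linear_ode (W := fun w => cubic1 f w - g1 * cubic0 f w)) => w.
  apply: (cder_eq (dW g1 w)); rewrite c2E; move: (cubic1 f w) (cubic0 f w) => u v; ring.
have [A [D c0E]] : exists A D, forall z, cubic0 f z = A * cexp (g1 * z) + D * cexp (g2 * z).
  exists (a1 / (g1 - g2)), (- a2 / (g1 - g2)) => z; apply: (mulfI g120).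
  have -> : (g1 - g2) * cubic0 f z =
     (cubic1 f z - g2 * cubic0 f z) - (cubic1 f z - g1 * cubic0 f z).
    by move: (cubic1 f z) (cubic0 f z) => u v; ring.
  rewrite e1 e2.
  by move: (cexp (g1 * z)) (cexp (g2 * z)) => x y; field; exact: g120.
exists (3 * A / g1), (3 * D / g2).
pose G w := f w ^+ 3 - (3 * A / g1 * cexp (g1 * w) + 3 * D / g2 * cexp (g2 * w)).
have dG z : is_derive z (1 : R[i]) G 0.
  apply: (cder_eq (cderB (derive_cube z ef) (is_derive_exp_sum (3 * A / g1) (3 * D / g2) g1 g2 z))).
  rewrite c0E; move: (cexp (g1 * z)) (cexp (g2 * z)) => x y; field.
  by rewrite g10 g20.
exists (G 0) => z; rewrite (is_derive_const_eq dG 0 z) /G.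
by rewrite addrC subrK.
Qed.

Lemma exp_of_logder f b : entire f -> (forall z, f^`()%classic z = b * f z) ->
  forall z, f z = f 0 * cexp (b * z).
Proof.
move=> ef fb; apply: linear_ode => z.
exact: cder_eq (entire_is_derive z ef) (fb z).
Qed.

Lemma liouville_derive f (M : R) : entire f -> (forall z, cmod (f z) <= M) ->
  forall z, f^`()%classic z = 0.
Proof.
move=> ef fM z; apply/eqP; rewrite -cmod_eq0 eq_le cmod_ge0 andbT leNgt; apply/negP => h.
set d := cmod _ in h.
have M0 : 0 <= M := le_trans (cmod_ge0 _) (fM 0).
pose rho := (M + 1) / d.
have rho0 : 0 < rho by rewrite divr_gt0 //; lra.
have : d <= M / rho.
  by apply: (@cauchy_estimate _ f z (rho + 1) rho) => //; rewrite ltrDl.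
rewrite /rho invf_div mulrCA; apply/negP; rewrite -ltNge gtr_pMr //.
by rewrite ltr_pdivrMr; lra.
Qed.

(** The Borel-Caratheodory inequality on circles of growing radius bounds [f' / f] by [2 * B]
    everywhere, and Liouville's theorem makes it constant. *)
Lemma zero_free_logder f B : entire f -> 0 <= B -> exp_bound f B ->
  (forall z, f z != 0) -> exists b, forall z, f^`()%classic z = b * f z.
Proof.
move=> ef B0 fB f0.
have fl z : ln (cmod (f z)) <= B * (cmod z + 1).
  by rewrite -[leRHS]expRK ler_ln ?posrE ?expR_gt0 ?cmod_gt0 //.
have bnd z : cmod (f^`()%classic z / f z) <= 2 * B.
  rewrite leNgt; apply/negP => h; set d := cmod _ in h.
  pose K := B * (cmod z + 1) - ln (cmod (f z)).
  (* Chosen so that [rho * (d - 2 * B)] equals 2 (|K| + 1), whereas the inequality at radius [rho]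
     bounds it by [2 * K]. *)
  pose rho := 2 * (`|K| + 1) / (d - 2 * B).
  have K0 := normr_ge0 K.
  have d0 : 0 < d - 2 * B by lra.
  have rho0 : 0 < rho by rewrite divr_gt0 //; lra.
  have : d <= 2 / rho * (B * (cmod z + rho + 1) - ln (cmod (f z))).
    apply: (@borel_caratheodory _ f z (rho + 1) rho) => //; first by rewrite ltrDl.
    move=> w wz; apply: (le_trans (fl w)); apply: ler_wpM2l => //.
    by have := cmodD (w - z) z; rewrite subrK wz; lra.
  have -> : B * (cmod z + rho + 1) - ln (cmod (f z)) = K + B * rho by rewrite /K; ring.
  have -> : 2 / rho * (K + B * rho) = 2 * K / rho + 2 * B by field; rewrite lt0r_neq0.
  have e1 : rho * (d - 2 * B) = 2 * (`|K| + 1) by rewrite /rho divfK // lt0r_neq0.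
  rewrite -lerBlDr ler_pdivlMr // mulrC e1.
  by have := ler_norm K; lra.
have dq z : derivable (fun w => f^`()%classic w / f w) z 1.
  have ef' := entire_derivative ef.
  exact: cder_derivable (cderM (entire_is_derive z ef') (cderV (f0 z) (entire_is_derive z ef))).
have dq0 z : is_derive z (1 : R[i]) (fun w => f^`()%classic w / f w) 0.
  exact: cder_eq (entire_is_derive z dq) (liouville_derive dq bnd z).
exists (f^`()%classic 0 / f 0) => z.
by rewrite (is_derive_const_eq dq0 0 z) divfK.
Qed.

(* A zero of f is a zero of f^2 f' and of its derivative, which forces
   both exponentials to cancel. *)
Lemma cube_exp_sum_zero_free f (g1 g2 al be C : R[i]) : entire f ->
  g1 != 0 -> g1 != g2 -> al != 0 ->
  (forall z, f z ^+ 3 = al * cexp (g1 * z) + be * cexp (g2 * z) + C) ->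
  forall z, f z != 0.
Proof.
move=> ef g10 g12 al0 fE z; apply/negP => /eqP fz.
have E1 w : 3 * cubic0 f w = al * g1 * cexp (g1 * w) + be * g2 * cexp (g2 * w).
  apply: (is_derive_eqfun (z := w) fE (derive_cube w ef)).
  apply: (cder_eq (cderD (is_derive_exp_sum al be g1 g2 w) (cder_cst C w))).
  by rewrite addr0.
have E2 w : 3 * cubic1 f w = al * g1 * g1 * cexp (g1 * w) + be * g2 * g2 * cexp (g2 * w).
  apply: (is_derive_eqfun (z := w) E1 (cderZ 3 (is_derive_cubic0 w ef))).
  exact: is_derive_exp_sum.
have c0 : cubic0 f z = 0 by rewrite /cubic0 fz expr0n mul0r.
have c1 : cubic1 f z = 0 by rewrite /cubic1 fz expr0n mulr0 !mul0r addr0.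
have := E1 z; have := E2 z; rewrite c0 c1 mulr0 => h2 h1.
have : al * g1 * (g1 - g2) * cexp (g1 * z) = 0.
  have -> : al * g1 * (g1 - g2) * cexp (g1 * z) =
   (al * g1 * g1 * cexp (g1 * z) + be * g2 * g2 * cexp (g2 * z)) -
   g2 * (al * g1 * cexp (g1 * z) + be * g2 * cexp (g2 * z)).
    by move: (cexp (g1 * z)) (cexp (g2 * z)) => x y; ring.
  by rewrite -h1 -h2 mulr0 subr0.
by move/eqP; rewrite mulf_eq0 (negbTE (cexp_neq0 _)) !mulf_eq0 subr_eq0 (negbTE al0) (negbTE g10) (negbTE g12).
Qed.

Lemma cube_exp_sum_single f B (g1 g2 al be C : R[i]) : entire f -> 0 <= B -> exp_bound f B ->
  g1 != 0 -> g2 != 0 -> g1 != g2 ->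
  (forall z, f z ^+ 3 = al * cexp (g1 * z) + be * cexp (g2 * z) + C) ->
  al = 0 \/ be = 0.
Proof.
move=> ef B0 fB g10 g20 g12 fE.
have [->|al0] := eqVneq al 0; first by left.
have [->|be0] := eqVneq be 0; first by right.
have f0 := cube_exp_sum_zero_free ef g10 g12 al0 fE.
have [b fb] := zero_free_logder ef B0 fB f0.
have fexp := exp_of_logder ef fb.
have E z : f 0 ^+ 3 * cexp (3 * b * z) = al * cexp (g1 * z) + be * cexp (g2 * z) + C.
  by rewrite -fE (fexp z) exprMn cexpX mulrA.
(* [3 * b] equals at most one of [g1] and [g2]; the other frequency is then new and its coefficient
   vanishes. The constant [C] takes part as the exponential of frequency 0. *)
have [bg1|bg1] := eqVneq (3 * b) g1.
  right; apply: (@exp_indep [:: (f 0 ^+ 3, 3 * b); (- al, g1); (- C, 0)] be g2).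
    by rewrite /= !inE bg1 !negb_or g20 eq_sym g12.
  move=> z; rewrite !big_cons big_nil /= E mul0r cexp0.
  by move: (cexp (g1 * z)) (cexp (g2 * z)) => x y; ring.
left; apply: (@exp_indep [:: (f 0 ^+ 3, 3 * b); (- be, g2); (- C, 0)] al g1).
  by rewrite /= !inE !negb_or g10 g12 eq_sym bg1.
move=> z; rewrite !big_cons big_nil /= E mul0r cexp0.
by move: (cexp (g1 * z)) (cexp (g2 * z)) => x y; ring.
Qed.

(** A zero of [f] would be a zero of [(f ^ 3)' = al * g * cexp (g * z)], so [f] is zero-free. For
    [C != 0] the right side would take the value 0, since [cexp] takes every nonzero value. With
    [C = 0] the equation gives [f' = (g / 3) f]. *)
Lemma cube_exp_const f (g al C : R[i]) : entire f -> g != 0 -> al != 0 ->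
  (forall z, f z ^+ 3 = al * cexp (g * z) + C) ->
  forall z, f z = f 0 * cexp (g / 3 * z).
Proof.
move=> ef g0 al0 fE.
have E1 w : 3 * cubic0 f w = al * g * cexp (g * w).
  apply: (is_derive_eqfun (z := w) fE (derive_cube w ef)).
  apply: (cder_eq (cderD (cderZ al (is_derive_cexpZ g w)) (cder_cst C w))).
  by rewrite addr0 mulrA.
have f0 z : f z != 0.
  apply/negP => /eqP fz; have := E1 z; rewrite /cubic0 fz expr0n mul0r mulr0 => /esym.
  by move/eqP; rewrite mulf_eq0 (negbTE (cexp_neq0 _)) mulf_eq0 (negbTE al0) (negbTE g0).
have C0 : C = 0.
  apply/eqP/negPn/negP => Cn.
  have nz : - C / al != 0 by rewrite mulf_neq0 ?oppr_eq0 ?invr_neq0.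
  have [w we] := cexp_surj nz.
  have gw : g * (w / g) = w by rewrite mulrC divfK.
  have aC : al * (- C / al) = - C by rewrite mulrC divfK.
  have := fE (w / g); rewrite gw we aC addNr => /eqP.
  by rewrite expf_eq0 /= (negbTE (f0 _)).
apply: exp_of_logder => // z.
have z3 : (3 : R[i]) != 0 by rewrite pnatr_eq0.
apply: (mulfI (expf_neq0 2 (f0 z))); apply: (mulfI z3).
have := E1 z; rewrite /cubic0 => ->.
have := fE z; rewrite C0 addr0 => h.
rewrite -mulrA (mulrCA al) -h.
by move: (f z) => u; field.
Qed.

End ExponentialSolutions.

(** * The alternatives of the theorem *)

Section Alternatives.
Context {R : realType}.
Implicit Types (f : R[i] -> R[i]) (z w p g : R[i]) (r B : R).

(** After substitution only the frequencies [g1], [g1 / 3] and [g2] occur. As [p2 != 0],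
    independence of exponentials forces [g2 = g1 / 3], and comparing coefficients gives the rest.
    With the indices exchanged the lemma covers the other exceptional case. *)
Lemma single_exponential f k (a : 'I_k.+1 -> R[i]) p1 p2 g1 g2 (c : R[i]) :
  p2 != 0 -> g1 != 0 -> g1 != g2 -> c != 0 ->
  (forall z, f z ^+ 2 * f^`()%classic z + lin_diff_poly a f z
             = p1 * cexp (g1 * z) + p2 * cexp (g2 * z)) ->
  (forall z, f z = c * cexp (g1 / 3 * z)) ->
  [/\ c ^+ 3 = 3 * p1 / g1,
      forall z, f z = c * cexp (g1 * z / 3),
      p2 = c * \sum_(j < k.+1) a j * (g1 / 3) ^+ j
    & g1 / g2 = 3].
Proof.
move=> p20 g10 g12 c0 feq fE.
have z3 : (3 : R[i]) != 0 by rewrite pnatr_eq0.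
pose b := g1 / 3; pose Q := \sum_(j < k.+1) a j * b ^+ j.
have fn := derive1n_exp fE.
have E z : c ^+ 3 * b * cexp (g1 * z) + c * Q * cexp (b * z) =
    p1 * cexp (g1 * z) + p2 * cexp (g2 * z).
  rewrite -feq; congr (_ + _).
    have -> : f^`()%classic z = c * b * cexp (b * z) by have := fn 1%N z; rewrite expr1.
    have -> : cexp (g1 * z) = cexp (b * z) ^+ 3.
      by rewrite cexpX mulrA; congr (cexp (_ * z)); rewrite /b mulrC divfK.
    by rewrite fE -/b; move: (cexp (b * z)) => x; ring.
  rewrite /lin_diff_poly /Q mulr_sumr mulr_suml; apply: eq_bigr => j _.
  by rewrite fn -/b; move: (cexp (b * z)) => x; ring.
have b0 : b != 0 by rewrite /b mulf_neq0 ?invr_neq0.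
have bg1 : b != g1.
  rewrite -subr_eq0; have -> : b - g1 = - (2 / 3) * g1 by rewrite /b; field.
  by rewrite mulf_neq0 // oppr_eq0 mulf_neq0 ?invr_neq0 ?pnatr_eq0.
have g2b : g2 = b.
  apply/eqP/negPn/negP => g2b; move/eqP: p20; apply.
  apply: (@exp_indep _ [:: (c ^+ 3 * b - p1, g1); (c * Q, b)] p2 g2).
    by rewrite /= !inE negb_or g2b eq_sym g12.
  move=> z; rewrite !big_cons big_nil /=.
  have -> : p2 * cexp (g2 * z) = c ^+ 3 * b * cexp (g1 * z) + c * Q * cexp (b * z)
    - p1 * cexp (g1 * z) by rewrite E addrC addKr.
  by move: (cexp (g1 * z)) (cexp (b * z)) => x y; ring.
have e1 : c ^+ 3 * b - p1 = 0.
  apply: (@exp_indep _ [:: (p2 - c * Q, b)] _ g1); first by rewrite /= inE eq_sym.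
  move=> z; rewrite !big_cons big_nil /=; have := E z; rewrite g2b.
  move: (cexp (g1 * z)) (cexp (b * z)) => x y h.
  have -> : (p2 - c * Q) * y + 0 = (p1 * x + p2 * y) - p1 * x - c * Q * y by ring.
  by rewrite -h; ring.
have e2 : p2 - c * Q = 0.
  apply: (@exp_indep _ [::] _ b) => // z; rewrite big_nil.
  have := E z; rewrite g2b; have -> : c ^+ 3 * b = p1 by apply/eqP; rewrite -subr_eq0 e1.
  by move=> /addrI h; rewrite mulrBl h subrr.
split.
- have -> : p1 = c ^+ 3 * b by apply/esym/eqP; rewrite -subr_eq0 e1.
  by rewrite /b; field; rewrite ?g10 ?z3.
- by move=> z; rewrite fE; congr (c * cexp _); rewrite mulrAC.
- by apply/eqP; rewrite -subr_eq0 e2.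
- by rewrite g2b /b; field; rewrite ?g10 ?z3.
Qed.

(** A constant cube makes [f] zero-free with [f' = 0], hence a constant polynomial. *)
Lemma cube_not_const f (C : R[i]) : transcendental_entire f -> ~ forall z, f z ^+ 3 = C.
Proof.
move=> tf fC; have [z0 fz0] := nonzero_of_transcendental tf; case: tf => ef tf; apply: tf.
have f0 z : f z != 0.
  by apply: contra_neq (expf_neq0 3 fz0) => fz; rewrite fC -(fC z) fz expr0n.
have z3 : (3 : R[i]) != 0 by rewrite pnatr_eq0.
have df z : f^`()%classic z = 0.
  have h := is_derive_eqfun fC (derive_cube z ef) (cder_cst C z).
  apply: (mulfI (expf_neq0 2 (f0 z))); apply: (mulfI z3).
  by rewrite !mulr0 -[RHS]h.
have d0 z : is_derive z (1 : R[i]) f 0 by exact: cder_eq (entire_is_derive z ef) (df z).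
by exists (f 0)%:P => z; rewrite hornerC; exact: is_derive_const_eq.
Qed.

Lemma countableU (T : Type) (A D : set T) : countable A -> countable D -> countable (A `|` D).
Proof.
move=> cA cD; apply: (@sub_countable _ _ _ (\bigcup_(b in [set: bool]) (if b then A else D))).
  by apply: subset_card_le => x [Ax|Dx]; [exists true|exists false].
by apply: bigcup_countable => // -[].
Qed.

End Alternatives.

Unset Implicit Arguments.
Set Strict Implicit.
Set Printing Implicit Defensive.

Theorem theorem4 (R : realType) (p1 p2 g1 g2 : R[i])
    (hp1 : p1 != 0) (hp2 : p2 != 0) (hg1 : g1 != 0) (hg2 : g2 != 0)
    (hg12 : g1 != g2) (k : nat) (a : 'I_k.+1 -> R[i]) (f : R[i] -> R[i])
    (hf : transcendental_entire f)
    (heq : forall z : R[i],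
       f z ^+ 2 * f^`()%classic z + lin_diff_poly a f z
       = p1 * cexp (g1 * z) + p2 * cexp (g2 * z)) :
  growth_order f = 1%:E /\
  [\/ exists S : R -> R, small_error S f /\
        (forall r : R, 0 < r ->
           2 * characteristic r f <= 3 * N_zeros r f + S r),
      exists c1 : R[i],
        [/\ c1 ^+ 3 = 3 * p1 / g1,
            forall z : R[i], f z = c1 * cexp (g1 * z / 3),
            p2 = c1 * \sum_(j < k.+1) a j * (g1 / 3) ^+ j
          & g1 / g2 = 3]
    | exists c2 : R[i],
        [/\ c2 ^+ 3 = 3 * p2 / g2,
            forall z : R[i], f z = c2 * cexp (g2 * z / 3),
            p1 = c2 * \sum_(j < k.+1) a j * (g2 / 3) ^+ j
          & g2 / g1 = 3]].
Proof.
have ef := hf.1.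
have [z0 f0] := nonzero_of_transcendental hf.
have [C [K [C0 K0 step]]] := cubic_step ef heq.
have [B B0 fB] := cubic_exp_bound ef C0 K0 step.
(* High enough for both forms of [annihilated]: order [k.+2] on the linear side, after two shifts of
   the coefficients, and order 3 on the cubic side. *)
pose n := k.+3.
have heq' z : f z ^+ 2 * f^`()%classic z + lin_diff_poly a f z
       = p2 * cexp (g2 * z) + p1 * cexp (g1 * z) by rewrite heq addrC.
have [c c0 [r1 r11 Tge]] : exists2 c : R, 0 < c & exists2 r1, 1 <= r1 &
    forall r, r1 <= r -> generic_radius f n r -> c * r <= characteristic r f.
  have kn : (k <= n)%N by rewrite /n -addn3 leq_addr.
  (* The exponential whose rate has the larger modulus must come first; [heq'] is the equation with
     the indices exchanged. *)
  have [g21|g21] := leP (cmod g2) (cmod g1).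
    exact: (characteristic_ge_le kn isT ef f0 B0 fB hp1 hg1 hg12 g21 heq).
  have hg21 : g2 != g1 by rewrite eq_sym.
  exact: (characteristic_ge_le kn isT ef f0 B0 fB hp2 hg2 hg21 (ltW g21) heq').
split; first exact: growth_order_eq1 ef B0 fB c0 Tge.
have [[z1 H0]|H0] := pselect (exists z, annihilated f g1 g2 z != 0).
  apply: Or31.
  have [D D0 HD] := @char_le_zeros R f B z0 k a p1 p2 g1 g2 z1 n (leqnSn _) isT ef f0 B0 fB heq H0.
  (* The error is the positive part of the difference, so the inequality holds at every radius by
     construction; what remains is that it is O(log r) off the countable set [A]. *)
  exists (fun r => Num.max 0 (2 * characteristic r f - 3 * N_zeros r f)); split; last first.
    by move=> r _; rewrite -lerBlDl le_max lexx orbT.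
  pose A := [set r | ~ generic_radius f n r] `|`
    [set r | exists2 z, cmod z = r & annihilated f g1 g2 z = 0].
  have eH := entire_annihilated ef heq.
  have cA : countable A.
    by apply: countableU; [exact: countable_nongeneric|exact: (countable_zero_radii eH H0)].
  apply: (@small_error_of_log R f _ A D c r1 cA D0 c0 r11) => r rr nA.
  have gr : generic_radius f n r by apply: contrapT => h; apply: nA; left.
  have Hr z : cmod z = r -> annihilated f g1 g2 z != 0.
    by move=> zr; apply/eqP => Hz; apply: nA; right; exists z.
  split; last exact: Tge.
  have rge1 := le_trans r11 rr.
  rewrite ger0_norm ?le_max ?lexx // ge_max; apply/andP; split.
    by rewrite mulr_ge0 // addr_ge0 // ln_ge0.
  by rewrite lerBlDl; exact: HD.
have {}H0 z : annihilated f g1 g2 z = 0.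
  by apply/eqP; apply: contrapT => h; apply: H0; exists z; apply/negP.
have [al [be [E fE]]] := cube_exp_sum ef hg1 hg2 hg12 H0.
have fne (c' b : R[i]) : (forall z, f z = c' * cexp (b * z)) -> c' != 0.
  by move=> fc; apply: contra_neq f0 => c'0; rewrite fc c'0 mul0r.
have single := cube_exp_sum_single ef B0 fB hg1 hg2 hg12 fE.
have [al0|al0] := eqVneq al 0.
  (* Both coefficients zero would make [f ^ 3] constant, against transcendence. *)
  have [be0|be0] := eqVneq be 0.
    exfalso; apply: (@cube_not_const R f E hf) => z.
    by rewrite fE al0 be0 !mul0r !add0r.
  have fE' z : f z ^+ 3 = be * cexp (g2 * z) + E by rewrite fE al0 mul0r add0r.
  have fexp := cube_exp_const ef hg2 be0 fE'.
  apply: Or33; exists (f 0); apply: (single_exponential hp1 hg2 _ (fne _ _ fexp) heq' fexp).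
  by rewrite eq_sym.
have be0 : be = 0 by case: single => // /eqP; rewrite (negbTE al0).
have fE' z : f z ^+ 3 = al * cexp (g1 * z) + E by rewrite fE be0 mul0r addr0.
have fexp := cube_exp_const ef hg1 al0 fE'.
apply: Or32; exists (f 0); exact: (single_exponential hp2 hg1 hg12 (fne _ _ fexp) heq fexp).
Qed.
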